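(* Let $\omega_1,\dots,\omega_L\in L^\infty(\mathbb{T})$ be symbols with pairwise disjoint singular supports, $$\operatorname{sing\,supp}\omega_\ell\cap\operatorname{sing\,supp}\omega_j=\varnothing,\quad \ell\ne j,$$ such that each $\omega_\ell$ satisfies the symmetry condition $\overline{\omega_\ell(\mu)}=\omega_\ell(\overline\mu)$, $\mu\in\mathbb{T}$, and such that the Hankel operators $H(\omega_\ell)$ are compact. Then for $\omega=\omega_1+\dots+\omega_L$, for an arbitrary $p>0$ and for each choice of the sign $\pm$, $$\Delta_p^\pm(H(\omega))\le\sum_{\ell=1}^L\Delta_p^\pm(H(\omega_\ell)),\qquad \delta_p^\pm(H(\omega))\ge\sum_{\ell=1}^L\delta_p^\pm(H(\omega_\ell))$$ (the quantities involved may be infinite). In particular, if $\Delta_p^\pm(H(\omega_\ell))=\delta_p^\pm(H(\omega_\ell))$ for all $\ell$, then $$\Delta_p^\pm(H(\omega))=\delta_p^\pm(H(\omega))=\sum_{\ell=1}^L\Delta_p^\pm(H(\omega_\ell)).$$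
   Context: $\mathbb{T}$ is the unit circle in $\mathbb{C}$ with normalized Lebesgue measure; $H^2(\mathbb{T})\subset L^2(\mathbb{T})$ is the closed subspace spanned by $1,\mu,\mu^2,\dots$; $P_+$ is the orthogonal projection of $L^2(\mathbb{T})$ onto $H^2(\mathbb{T})$; $(Wf)(\mu)=f(\overline\mu)$. For $\omega\in L^\infty(\mathbb{T})$ the Hankel operator with symbol $\omega$ is $H(\omega)f=P_+(\omega Wf)$, $f\in H^2(\mathbb{T})$; it is self-adjoint under the symmetry condition. The singular support $\operatorname{sing\,supp}\omega$ is the smallest closed set $X\subset\mathbb{T}$ such that $\omega\in C^\infty(\mathbb{T}\setminus X)$. For a compact self-adjoint operator $A$, $\{\lambda_n^+(A)\}_{n\ge1}$ is the non-increasing sequence of positive eigenvalues of $A$, counted with multiplicities and appended by zeros if there are only finitely many; $\lambda_n^-(A)=\lambda_n^+(-A)$. For $p>0$, $$\Delta_p^\pm(A)=\limsup_{n\to\infty}n\lambda_n^\pm(A)^p,\qquad \delta_p^\pm(A)=\liminf_{n\to\infty}n\lambda_n^\pm(A)^p,$$ with values in $[0,\infty]$. *)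

(* Defs.v *)
From HB Require Import structures.
From mathcomp Require Import all_boot all_order all_algebra complex lra.
From mathcomp Require Import all_classical all_reals all_analysis measurable_realfun.
Set Implicit Arguments.
Unset Strict Implicit.
Unset Printing Implicit Defensive.
Import Order.TTheory GRing.Theory Num.Theory.
Import numFieldNormedType.Exports.
Local Open Scope classical_set_scope.
Local Open Scope card_scope.
Local Open Scope complex_scope.
Local Open Scope ring_scope.

Definition circle (R : realType) : Type := {z : R[i] | `|z| == 1}.

(* [R[i]^o] is the copy of [R[i]] that carries the usual topology. *)
Definition circle_val (R : realType) (z : circle R) : R[i]^o := sval z.

HB.instance Definition _ (R : realType) := Choice.on (circle R).
HB.instance Definition _ (R : realType) :=
  Topological.copy (circle R) (initial_topology (@circle_val R)).

Lemma expi_subproof (R : realType) (t : R) : `|cos t +i* sin t| == 1 :> R[i].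
Proof. by rewrite normc_def /= cos2Dsin2 sqrtr1. Qed.

Definition expi (R : realType) (t : R) : circle R :=
  exist _ (cos t +i* sin t) (expi_subproof t).

HB.instance Definition _ (R : realType) := isPointed.Build (circle R) (expi 0).

Lemma circle_conj_subproof (R : realType) (z : circle R) :
  `|(sval z)^*%C| == 1 :> R[i].
Proof.
by case: z => -[x y] /= /eqP h; apply/eqP; rewrite -h !normc_def /= sqrrN.
Qed.

Definition circle_conj (R : realType) (z : circle R) : circle R :=
  exist _ ((sval z)^*)%C (circle_conj_subproof z).

Definition circle_open (R : realType) : set (set (circle R)) := open.

HB.instance Definition _ (R : realType) :=
  Measurable.copy (circle R) (g_sigma_algebraType (@circle_open R)).

Lemma continuous_expi (R : realType) : continuous (@expi R).
Proof.
apply: (@continuous_comp_initial _ _ _ (@circle_val R) (@expi R)) => t.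
apply/cvgrPdist_lt => -[e e']; rewrite ltcE /= => /andP[/eqP e'0 e0].
have e2 : 0 < e / 2 by rewrite divr_gt0.
have /cvgrPdist_lt/(_ _ e2) hc := @continuous_cos R t.
have /cvgrPdist_lt/(_ _ e2) hs := @continuous_sin R t.
near=> x; rewrite /circle_val /= e'0 normc_def /= ltcR.
rewrite -(ger0_norm (ltW e0)) -sqrtr_sqr ltr_sqrt ?exprn_gt0 //.
have : `|cos t - cos x| < e / 2 by near: x.
have : `|sin t - sin x| < e / 2 by near: x.
rewrite !ltr_norml => /andP[? ?] /andP[? ?].
by rewrite !expr2; nra.
Unshelve. all: by end_near. Qed.

Lemma measurable_expi (R : realType) :
  measurable_fun [set: measurableTypeR R] (@expi R).
Proof.
apply: (measurability (@circle_open R)) => // _ [U oU <-].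
rewrite setTI; apply: open_measurable.
by move/continuousP : (@continuous_expi R); apply.
Qed.

Section normalized_lebesgue_measure.
Variable R : realType.

Let mpi : measurable (`]- pi, pi]%classic : set (measurableTypeR R)).
Proof. exact: measurable_itv. Qed.

Definition arc_length : set (circle R) -> \bar R :=
  pushforward (mrestr (@lebesgue_measure R) mpi) (@expi R).

Let arc_length0 : arc_length set0 = 0%E.
Proof. by rewrite /arc_length /pushforward preimage_set0 measure0. Qed.

Let arc_length_ge0 A : (0 <= arc_length A)%E.
Proof. by rewrite /arc_length /pushforward; exact: measure_ge0. Qed.

Let arc_length_sigma_additive : semi_sigma_additive arc_length.
Proof.
apply: (@measure_semi_sigma_additive _ _ _
  (@pushforward _ _ _ _ _ (mrestr (@lebesgue_measure R) mpi) (@expi R))).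
exact: measurable_expi.
Qed.

HB.instance Definition _ := isMeasure.Build _ _ _ arc_length
  arc_length0 arc_length_ge0 arc_length_sigma_additive.

Let pi2V_ge0 : 0 <= (2 * pi)^-1 :> R.
Proof. by rewrite invr_ge0 mulr_ge0 ?pi_ge0. Qed.

Definition circle_measure : set (circle R) -> \bar R :=
  mscale (NngNum pi2V_ge0) arc_length.

HB.instance Definition _ := Measure.on circle_measure.

Lemma circle_measure_setT : circle_measure setT = 1%E.
Proof.
rewrite /circle_measure /mscale /= /arc_length /pushforward /mrestr.
rewrite preimage_setT setTI lebesgue_measure_itv /= lte_fin gtrN ?pi_gt0 //.
rewrite -EFinD -EFinM opprK -[pi + pi]mulr2n -[pi *+ 2]mulr_natl.
by rewrite mulVf // mulf_neq0 // gt_eqF ?pi_gt0.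
Qed.

HB.instance Definition _ := Measure_isProbability.Build _ _ _
  circle_measure circle_measure_setT.

End normalized_lebesgue_measure.
Arguments circle_measure R : clear implicits.

Section function_spaces.
Variable R : realType.
Implicit Types (f g w : circle R -> R[i]).

(* Elements of [L^p] are represented by functions, compared up to equality
   almost everywhere. *)
Definition cLfun (p : \bar R) f : Prop :=
  ((fun z => complex.Re (f z)) \in Lfun (circle_measure R) p) /\
  ((fun z => complex.Im (f z)) \in Lfun (circle_measure R) p).

Definition circle_integral f : R[i] :=
  (\int[circle_measure R]_z complex.Re (f z)) +i*
  (\int[circle_measure R]_z complex.Im (f z)).

Definition inner f g : R[i] := circle_integral (fun z => f z * ((g z)^*)%C).

Definition L2norm f : R := Num.sqrt (complex.Re (inner f f)).

Definition poly_fun (q : {poly R[i]}) : circle R -> R[i] :=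
  fun z => q.[sval z].

Definition hardy2 : set (circle R -> R[i]) :=
  [set f | cLfun 2%:E f /\
    forall e : R, 0 < e -> exists q, L2norm (f - poly_fun q) < e].

(* The projection of [f] is determined almost everywhere only; [xget] selects
   one representative. *)
Definition Pplus f : circle R -> R[i] :=
  xget 0 [set g | hardy2 g /\ forall h, hardy2 h -> inner (f - g) h = 0].

Definition reflection f : circle R -> R[i] := f \o @circle_conj R.

Definition hankel w f : circle R -> R[i] :=
  Pplus (fun z => w z * reflection f z).

Definition symmetric_symbol w : Prop :=
  {ae circle_measure R, forall z, ((w z)^*)%C = w (circle_conj z)}.

(* [w] has a representative which is smooth in the angular variable at every
   point of the open set [~` X]. *)
Definition smooth_off (X : set (circle R)) w : Prop :=
  exists2 g, w = g %[ae circle_measure R in ~` X] &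
    forall (n : nat) (t : R), ~ X (expi t) ->
      derivable (derive1n n (fun s : R => complex.Re (g (expi s)))) t 1 /\
      derivable (derive1n n (fun s : R => complex.Im (g (expi s)))) t 1.

Definition sing_supp w : set (circle R) :=
  \bigcap_(X in [set X | closed X /\ smooth_off X w]) X.

End function_spaces.

(* Operators on [hardy2] are maps on representatives. *)
Section spectral_asymptotics.
Variable R : realType.
Local Notation fun_circle := (circle R -> R[i]).
Implicit Types (A : fun_circle -> fun_circle) (V : set fun_circle).

Definition compact_op A : Prop :=
  forall f : nat -> fun_circle,
    (forall n, hardy2 (f n) /\ L2norm (f n) <= 1) ->
    exists (k : nat -> nat) (g : fun_circle),
      [/\ {homo k : m n / (m < n)%N}, hardy2 g &
          L2norm (A (f (k n)) - g) @[n --> \oo] --> 0].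

Definition eigspace A (s : R) : set fun_circle :=
  [set f | hardy2 f /\ A f = s%:C *: f %[ae circle_measure R]].

Definition lin_indep (d : nat) (b : 'I_d -> fun_circle) : Prop :=
  forall c : 'I_d -> R[i],
    \sum_i c i *: b i = 0 %[ae circle_measure R] -> forall i, c i = 0.

Definition has_dim V (d : nat) : Prop :=
  exists b : 'I_d -> fun_circle,
    [/\ forall i, V (b i), lin_indep b &
        forall f, V f -> exists c : 'I_d -> R[i],
          f = \sum_i c i *: b i %[ae circle_measure R]].

Definition pos_eigenvalue_seq A (u : nat -> R) : Prop :=
  [/\ nonincreasing_seq u, forall n, 0 <= u n &
      forall s : R, 0 < s ->
        exists2 d, has_dim (eigspace A s) d & [set n | u n = s] #= `I_d].

(* Sequences are indexed from 0: [lambda_pos A n] is the [n.+1]-st positive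
   eigenvalue. At most one sequence satisfies [pos_eigenvalue_seq A], and one
   does if [A] is compact and self-adjoint. *)
Definition lambda_pos A : nat -> R := xget (fun=> 0) (pos_eigenvalue_seq A).

Definition lambda_neg A : nat -> R := lambda_pos (fun f => - A f).

(* [true] stands for the sign [+], [false] for [-]. *)
Definition lambda (sgn : bool) A : nat -> R :=
  if sgn then lambda_pos A else lambda_neg A.

Definition Delta (sgn : bool) (p : R) A : \bar R :=
  limn_esup (fun n => (n.+1%:R * (lambda sgn A n `^ p))%:E).

Definition delta (sgn : bool) (p : R) A : \bar R :=
  limn_einf (fun n => (n.+1%:R * (lambda sgn A n `^ p))%:E).

End spectral_asymptotics.

(* Main.v *)
(* If A_1, ..., A_L are compact self-adjoint operators such that every product
   A_i A_j with i <> j has, for each q, a form bounded by C N^-q off a subspace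
   of codimension O(N), then the min-max principle applied to vectors split along
   the large spectral subspaces of the A_i shows that, up to o(n) indices and a
   factor tending to 1, the eigenvalues of the sum are those of the direct sum.
   This yields both inequalities, one pair of operators at a time.

   For Hankel operators with disjoint singular supports choose a smooth phi such
   that phi w_1 and (1 - phi) w_2 are smooth.  Writing F = w_2 Wf, G = w_1 Wg and
   X+ , X- for the parts of X with nonnegative and negative frequencies,
     <F+, G+> = <F+, phi G> + <F+, (1 - phi) G-> + <(1 - phi) F, G+>
                - <(1 - phi) F-, G+>,
   where phi G and (1 - phi) F are smooth multiples of Wg and Wf.  Replacing every
   smooth multiplier by a trigonometric polynomial of degree N costs O(N^-q), and
   the remaining terms vanish when O(N) Fourier coefficients of f and F do. *)

Require Import Defs.
From HB Require Import structures.
From mathcomp Require Import all_boot all_order all_algebra complex lra ring zify.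
From mathcomp Require Import all_classical all_reals all_analysis.
From mathcomp Require Import measurable_realfun ess_sup_inf.
Set Implicit Arguments.
Unset Strict Implicit.
Unset Printing Implicit Defensive.
Import Order.TTheory GRing.Theory Num.Theory.
Import numFieldNormedType.Exports.
Local Open Scope classical_set_scope.
Local Open Scope card_scope.
Local Open Scope complex_scope.
Local Open Scope ring_scope.

(** * Semi-inner products *)

(** Elements of L^2 and H^2 stay functions, and [Pplus] picks a representative arbitrarily, so
    operators are not linear on the nose. The abstract part therefore works with a semi-inner
    product and assumes of an operator only symmetry and compactness; symmetry already forces
    linearity up to null vectors, and identities between images are tested weakly. Since p is
    arbitrary, no fixed decay rate of the products would do: at spectral level s the error has to be
    small against s^2 while only o(s^-p) linear conditions may be imposed. Decay of every order q in
    N leaves this freedom. Conversely, a given q calls for finitely many derivatives only, so the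
    cutoff may be chosen after q and built from truncated powers of cosines instead of flat
    functions. It is glued from local bumps, because [sing_supp] is an intersection of closed sets
    and supplies a good representative of the symbol only near each point outside it. The rate of
    trigonometric approximation comes from decay of Fourier coefficients, once the partial sums are
    known to converge pointwise to the function. *)

Section re_im.
Variable R : realType.
Implicit Types z y : R[i].

Lemma cReD z y : complex.Re (z + y) = complex.Re z + complex.Re y.
Proof. by case: z y => a b []. Qed.

Lemma cImD z y : complex.Im (z + y) = complex.Im z + complex.Im y.
Proof. by case: z y => a b []. Qed.

Lemma cReN z : complex.Re (- z) = - complex.Re z.
Proof. by case: z. Qed.

Lemma cImN z : complex.Im (- z) = - complex.Im z.
Proof. by case: z. Qed.

Lemma cReM z y : complex.Re (z * y) =
  complex.Re z * complex.Re y - complex.Im z * complex.Im y.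
Proof. by case: z y => a b []. Qed.

Lemma cImM z y : complex.Im (z * y) =
  complex.Re z * complex.Im y + complex.Im z * complex.Re y.
Proof. by case: z y => a b [] c d. Qed.

Lemma cReJ z : complex.Re z^*%C = complex.Re z.
Proof. by case: z. Qed.

Lemma cImJ z : complex.Im z^*%C = - complex.Im z.
Proof. by case: z. Qed.

Lemma conjcD z y : (z + y)^*%C = z^*%C + y^*%C.
Proof. exact: rmorphD. Qed.

Lemma conjcM z y : (z * y)^*%C = z^*%C * y^*%C.
Proof. exact: rmorphM. Qed.

Lemma conjcN z : (- z)^*%C = - z^*%C.
Proof. exact: rmorphN. Qed.

Lemma mulcJ z : z * z^*%C = (complex.Re z ^+ 2 + complex.Im z ^+ 2)%:C.
Proof. by case: z => a b; apply/eqP; rewrite eq_complex /=; apply/andP; split; apply/eqP; ring. Qed.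

Lemma cRe_sum I r (P : pred I) (F : I -> R[i]) :
  complex.Re (\sum_(i <- r | P i) F i) = \sum_(i <- r | P i) complex.Re (F i).
Proof. exact: (big_morph (@complex.Re R) cReD). Qed.

Lemma cIm_sum I r (P : pred I) (F : I -> R[i]) :
  complex.Im (\sum_(i <- r | P i) F i) = \sum_(i <- r | P i) complex.Im (F i).
Proof. exact: (big_morph (@complex.Im R) cImD). Qed.

Lemma cReZ (a : R) z : complex.Re (a%:C * z) = a * complex.Re z.
Proof. by rewrite cReM /= mul0r subr0. Qed.

Lemma cImZ (a : R) z : complex.Im (a%:C * z) = a * complex.Im z.
Proof. by rewrite cImM /= mul0r addr0. Qed.

Definition cnorm2 z : R := complex.Re z ^+ 2 + complex.Im z ^+ 2.

Lemma cnorm2_ge0 z : 0 <= cnorm2 z.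
Proof. by rewrite addr_ge0 ?sqr_ge0. Qed.

Lemma cnorm2M z y : cnorm2 (z * y) = cnorm2 z * cnorm2 y.
Proof. by rewrite /cnorm2 cReM cImM; ring. Qed.

Lemma cnorm2_eq0 z : (cnorm2 z == 0) = (z == 0).
Proof. by rewrite paddr_eq0 ?sqr_ge0// !sqrf_eq0 eq_complex. Qed.

End re_im.

(** The form is only semidefinite: in the application vectors are functions, and the null vectors
    are those vanishing almost everywhere. No quotient space is formed. *)
Record semi_ip (R : realType) (V : lmodType R[i]) := SemiIP {
  ip :> V -> V -> R[i];
  ipDl : forall f g h, ip (f + g) h = ip f h + ip g h;
  ipZl : forall c f h, ip (c *: f) h = c * ip f h;
  ipJ : forall f g, (ip f g)^*%C = ip g f;
  nsq_ge0 : forall f, 0 <= complex.Re (ip f f) }.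

Section semi_inner_product.
Variables (R : realType) (V : lmodType R[i]) (ip : semi_ip V).
Implicit Types (f g h : V) (c : R[i]) (a : R).

Definition re_ip f g := complex.Re (ip f g).
Local Notation rip := re_ip.
Definition sqnorm f := rip f f.
Local Notation nsq := sqnorm.
Definition seminorm f := Num.sqrt (nsq f).
Local Notation nm := seminorm.

Lemma ipDr f g h : ip f (g + h) = ip f g + ip f h.
Proof. by rewrite -ipJ ipDl conjcD !ipJ. Qed.

Lemma ipZr c f g : ip f (c *: g) = c^*%C * ip f g.
Proof. by rewrite -ipJ ipZl conjcM !ipJ. Qed.

Lemma ipNl f g : ip (- f) g = - ip f g.
Proof. by rewrite -scaleN1r ipZl mulN1r. Qed.

Lemma ipNr f g : ip f (- g) = - ip f g.
Proof. by rewrite -ipJ ipNl conjcN ipJ. Qed.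

Lemma ipBl f g h : ip (f - g) h = ip f h - ip g h.
Proof. by rewrite ipDl ipNl. Qed.

Lemma ip0l f : ip 0 f = 0.
Proof. by rewrite -(scale0r 0) ipZl mul0r. Qed.

Lemma ip0r f : ip f 0 = 0.
Proof. by rewrite -ipJ ip0l conjc0. Qed.

Lemma ip_suml I r (P : pred I) (F : I -> V) g :
  ip (\sum_(i <- r | P i) F i) g = \sum_(i <- r | P i) ip (F i) g.
Proof.
by apply: (big_morph (ip^~ g)) => [x y|]; rewrite ?ipDl ?ip0l.
Qed.

Lemma ip_sumr I r (P : pred I) (F : I -> V) g :
  ip g (\sum_(i <- r | P i) F i) = \sum_(i <- r | P i) ip g (F i).
Proof. by apply: (big_morph (ip g)) => [x y|]; rewrite ?ipDr ?ip0r. Qed.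

Lemma ripDl f g h : rip (f + g) h = rip f h + rip g h.
Proof. by rewrite /re_ip ipDl cReD. Qed.

Lemma ripDr f g h : rip h (f + g) = rip h f + rip h g.
Proof. by rewrite /re_ip ipDr cReD. Qed.

Lemma ripC f g : rip f g = rip g f.
Proof. by rewrite /re_ip -ipJ cReJ. Qed.

Lemma ripNl f g : rip (- f) g = - rip f g.
Proof. by rewrite /re_ip ipNl cReN. Qed.

Lemma ripNr f g : rip f (- g) = - rip f g.
Proof. by rewrite /re_ip ipNr cReN. Qed.

Lemma ripZl a f g : rip (a%:C *: f) g = a * rip f g.
Proof. by rewrite /re_ip ipZl cReZ. Qed.

Lemma ripZr a f g : rip f (a%:C *: g) = a * rip f g.
Proof. by rewrite ripC ripZl ripC. Qed.

Lemma ip_self f : ip f f = (nsq f)%:C.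
Proof.
have : complex.Im (ip f f) = 0.
  have := congr1 (@complex.Im R) (ipJ ip f f); rewrite cImJ => h; lra.
by rewrite /sqnorm /re_ip; case: (ip f f) => x y /= ->.
Qed.

Lemma nsqP f : 0 <= nsq f.
Proof. exact: nsq_ge0. Qed.

Lemma nsqD f g : nsq (f + g) = nsq f + 2 * rip f g + nsq g.
Proof. by rewrite /sqnorm ripDl !ripDr (ripC g f); ring. Qed.

Lemma nsqN f : nsq (- f) = nsq f.
Proof. by rewrite /sqnorm ripNl ripNr opprK. Qed.

Lemma nsqB f g : nsq (f - g) = nsq f - 2 * rip f g + nsq g.
Proof. by rewrite nsqD nsqN ripNr; ring. Qed.

Lemma nsqZ c f : nsq (c *: f) = (complex.Re c ^+ 2 + complex.Im c ^+ 2) * nsq f.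
Proof. by rewrite {1}/sqnorm /re_ip ipZl ipZr mulrA mulcJ cReZ. Qed.

Lemma nsqZr a f : nsq (a%:C *: f) = a ^+ 2 * nsq f.
Proof. by rewrite nsqZ /=; ring. Qed.

Lemma nsq0 : nsq 0 = 0.
Proof. by rewrite /sqnorm /re_ip ip0l. Qed.

Lemma rip_sqr_le f g : rip f g ^+ 2 <= nsq f * nsq g.
Proof.
have key (t : R) : 0 <= nsq f - 2 * t * rip f g + t ^+ 2 * nsq g.
  have := nsqP (f - t%:C *: g); rewrite nsqB nsqZr ripZr mulrA; lra.
have [g0|g0] := eqVneq (nsq g) 0; last first.
  have gp : 0 < nsq g by rewrite lt_neqAle eq_sym g0 nsqP.
  have := key (rip f g / nsq g).
  rewrite -(pmulr_lge0 _ gp).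
  have -> : (nsq f - 2 * (rip f g / nsq g) * rip f g +
     (rip f g / nsq g) ^+ 2 * nsq g) * nsq g = nsq f * nsq g - rip f g ^+ 2.
    by field.
  by rewrite subr_ge0.
rewrite g0 mulr0; have [->|r0] := eqVneq (rip f g) 0; first by rewrite expr0n.
(* With [nsq g = 0] the lower bound [key] is affine in t, and this t gives it the value -1. *)
have := key ((nsq f + 1) / (2 * rip f g)).
rewrite g0 mulr0 addr0.
have -> : 2 * ((nsq f + 1) / (2 * rip f g)) * rip f g = nsq f + 1 by field.
lra.
Qed.

Lemma nm_ge0 f : 0 <= nm f.
Proof. exact: sqrtr_ge0. Qed.

Lemma nm_sqr f : nm f ^+ 2 = nsq f.
Proof. by rewrite sqr_sqrtr ?nsqP. Qed.

Lemma rip_le f g : `|rip f g| <= nm f * nm g.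
Proof.
rewrite -(@ler_pXn2r _ 2) ?nnegrE ?mulr_ge0 ?nm_ge0 //.
by rewrite real_normK ?num_real// exprMn !nm_sqr rip_sqr_le.
Qed.

Lemma nmN f : nm (- f) = nm f.
Proof. by rewrite /seminorm nsqN. Qed.

Lemma nmBC f g : nm (f - g) = nm (g - f).
Proof. by rewrite -nmN opprB. Qed.

Lemma nmZ a f : nm (a%:C *: f) = `|a| * nm f.
Proof. by rewrite /seminorm nsqZr sqrtrM ?sqr_ge0// sqrtr_sqr. Qed.

Lemma nm0 : nm 0 = 0.
Proof. by rewrite /seminorm nsq0 sqrtr0. Qed.

Lemma nmD f g : nm (f + g) <= nm f + nm g.
Proof.
rewrite -(@ler_pXn2r _ 2) ?nnegrE ?addr_ge0 ?nm_ge0 //.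
rewrite nm_sqr nsqD -!nm_sqr sqrrD.
have := le_trans (ler_norm _) (rip_le f g).
by rewrite mulr2n; lra.
Qed.

Lemma nmB f g : nm (f - g) <= nm f + nm g.
Proof. by rewrite (le_trans (nmD _ _))// nmN. Qed.

Lemma nm_dist f g h : nm (f - h) <= nm (f - g) + nm (g - h).
Proof. by rewrite (le_trans _ (nmD _ _))// addrA subrK. Qed.

Lemma nm_eq0 f : (nm f == 0) = (nsq f == 0).
Proof. by rewrite sqrtr_eq0 le_eqVlt ltNge nsqP orbF. Qed.

(** Cauchy-Schwarz kills the real part; the imaginary part is, up to sign, the real part for i f,
    which is null as well. *)
Lemma ip_nsq0 f g : nsq f = 0 -> ip f g = 0.
Proof.
move=> f0; have rip0 h : nsq h = 0 -> rip h g = 0.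
  move=> h0; apply/eqP; rewrite -sqrf_eq0 eq_le sqr_ge0 andbT.
  by rewrite (le_trans (rip_sqr_le _ _))// h0 mul0r.
have hr := rip0 _ f0.
have := rip0 ((0 +i* 1) *: f); rewrite nsqZ f0 mulr0 => /(_ erefl).
move: hr; rewrite /re_ip ipZl; case: (ip f g) => a b /= -> h.
by apply/eqP; rewrite eq_complex /= eqxx /=; apply/eqP; lra.
Qed.

Lemma nsq_eq0P f : nsq f = 0 <-> forall g, ip f g = 0.
Proof.
by split=> [f0 g|/(_ f)]; [exact: ip_nsq0|rewrite ip_self => -[]].
Qed.

Definition limit_of (u : nat -> V) g := (fun n => nm (u n - g)) @ \oo --> (0 : R).

Lemma limit_ofP u g : limit_of u g <->
  forall e, 0 < e -> exists N, forall n, (N <= n)%N -> nm (u n - g) < e.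
Proof.
split=> [/cvgrPdist_lt h e e0|h].
  have [N _ hN] := h _ e0; exists N => n Nn.
  by have := hN _ Nn; rewrite /= sub0r normrN ger0_norm ?nm_ge0.
apply/cvgrPdist_lt => e /h[N hN]; exists N => // n /= Nn.
by rewrite sub0r normrN ger0_norm ?nm_ge0 ?hN.
Qed.

Lemma limit_of_le u g a : limit_of u g ->
  (forall e, 0 < e -> exists N, forall n, (N <= n)%N -> a <= nm (u n) + e) ->
  a <= nm g.
Proof.
move/limit_ofP => hu ha; apply/ler_addgt0Pr => e e0.
have e2 : 0 < e / 2 by rewrite divr_gt0.
have [N hN] := hu _ e2; have [M hM] := ha _ e2.
have := hN _ (leq_maxl N M); have := hM _ (leq_maxr N M).
set k := maxn N M => h1 h2.
have : nm (u k) <= nm (u k - g) + nm g by rewrite (le_trans _ (nmD _ _))// subrK.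
lra.
Qed.

(** Equality modulo null vectors in weak form: it amounts to distance 0 ([eqv_nmB]), and in H^2 to
    almost everywhere equality ([H2_ae]). *)
Definition eqv f g := forall h, ip f h = ip g h.

Lemma eqv_trans f g h : eqv f g -> eqv g h -> eqv f h.
Proof. by move=> a b k; rewrite a. Qed.

Lemma eqvD f g f' g' : eqv f g -> eqv f' g' -> eqv (f + f') (g + g').
Proof. by move=> a b k; rewrite !ipDl a b. Qed.

Lemma eqvN f g : eqv f g -> eqv (- f) (- g).
Proof. by move=> a k; rewrite !ipNl a. Qed.

Lemma eqvB f g f' g' : eqv f g -> eqv f' g' -> eqv (f - f') (g - g').
Proof. by move=> a b; apply: eqvD => //; apply: eqvN. Qed.

Lemma eqv_ripl f g h : eqv f g -> rip f h = rip g h.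
Proof. by rewrite /re_ip => ->. Qed.

Lemma eqv_nm f g : eqv f g -> nm f = nm g.
Proof.
by move=> a; rewrite /seminorm /sqnorm (eqv_ripl _ a) ripC (eqv_ripl _ a).
Qed.

Lemma eqv_nmB f g : eqv f g <-> nm (f - g) = 0.
Proof.
split=> [a|/eqP].
  by rewrite -nm0 -(subrr g); apply: eqv_nm => k; rewrite !ipBl a.
rewrite nm_eq0 => /eqP a h; apply/eqP.
by rewrite -subr_eq0 -ipBl ip_nsq0.
Qed.

End semi_inner_product.

Section self_adjoint_operators.
Variables (R : realType) (V : lmodType R[i]) (ip : semi_ip V).
Implicit Types (A B : V -> V) (f g h : V).
Local Notation rip := (re_ip ip).
Local Notation nsq := (sqnorm ip).
Local Notation nm := (seminorm ip).
Local Notation eqv := (eqv ip).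

(** Symmetry makes [A] linear up to [eqv] ([selfadjD], [selfadjZ]), which is all that an operator
    defined through arbitrary representatives can offer. *)
Definition selfadj A := forall f g, ip (A f) g = ip f (A g).

Definition compact_on A := forall u : nat -> V, (forall n, nm (u n) <= 1) ->
  exists (k : nat -> nat) g, {homo k : m n / (m < n)%N} /\
    limit_of ip (fun n => A (u (k n))) g.

Lemma homo_ltn_ge (k : nat -> nat) : {homo k : m n / (m < n)%N} ->
  forall n, (n <= k n)%N.
Proof. by move=> hk; elim=> // n ih; rewrite (leq_ltn_trans ih)// hk. Qed.

Lemma limit_of_subseq (k : nat -> nat) u g : {homo k : m n / (m < n)%N} ->
  limit_of ip u g -> limit_of ip (u \o k) g.
Proof.
move=> hk /limit_ofP hu; apply/limit_ofP => e /hu[N hN]; exists N => n Nn /=.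
by apply: hN; rewrite (leq_trans Nn)// homo_ltn_ge.
Qed.

Lemma limit_ofD u v f g : limit_of ip u f -> limit_of ip v g ->
  limit_of ip (u \+ v) (f + g).
Proof.
move=> /limit_ofP hu /limit_ofP hv; apply/limit_ofP => e e0.
have e2 : 0 < e / 2 by rewrite divr_gt0.
have [N hN] := hu _ e2; have [M hM] := hv _ e2.
exists (maxn N M) => n; rewrite geq_max => /andP[/hN ? /hM ?].
rewrite /= opprD addrACA (le_lt_trans (nmD _ _ _))//; lra.
Qed.

Section one_operator.
Variable A : V -> V.
Hypothesis sA : selfadj A.

Lemma selfadjD f g : eqv (A (f + g)) (A f + A g).
Proof. by move=> h; rewrite ipDl !sA ipDl. Qed.

Lemma selfadjZ c f : eqv (A (c *: f)) (c *: A f).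
Proof. by move=> h; rewrite ipZl !sA ipZl. Qed.

Lemma selfadjB f g : eqv (A (f - g)) (A f - A g).
Proof. by move=> h; rewrite ipBl !sA ipBl. Qed.

Lemma selfadj0 f : nm f = 0 -> nm (A f) = 0.
Proof.
move/eqP; rewrite nm_eq0 => /eqP f0; rewrite -(nm0 ip); apply: eqv_nm => h.
by rewrite sA ip_nsq0// ip0l.
Qed.

Lemma ripA_sym f g : rip (A f) g = rip (A g) f.
Proof. by rewrite [RHS]ripC /re_ip sA. Qed.

Lemma ripAD f g : rip (A (f + g)) (f + g) =
  rip (A f) f + 2 * rip (A f) g + rip (A g) g.
Proof.
rewrite (eqv_ripl _ (selfadjD _ _)) ripDl !ripDr (ripA_sym g f); ring.
Qed.

Lemma ripAZ (a : R) f : rip (A (a%:C *: f)) (a%:C *: f) = a ^+ 2 * rip (A f) f.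
Proof. by rewrite (eqv_ripl _ (selfadjZ _ _)) ripZl ripZr; ring. Qed.

(** Otherwise there are vectors [u n] in the unit ball whose images have norm above n, and no
    subsequence of the images converges. *)
Lemma compact_bounded : compact_on A ->
  exists2 K : R, 0 <= K & forall f, nm (A f) <= K * nm f.
Proof.
move=> cA; apply: contrapT => nK.
have : forall n : nat, exists f, nm f <= 1 /\ n%:R < nm (A f).
  move=> n; apply: contrapT => nf; apply: nK; exists n%:R => // f.
  rewrite leNgt; apply/negP => hf; apply: nf.
  have f0 : nm f != 0.
    by apply/eqP => f0; move: hf; rewrite selfadj0// f0 mulr0 ltxx.
  have fp : 0 < nm f by rewrite lt_neqAle eq_sym f0 nm_ge0.
  exists ((nm f)^-1%:C *: f).
  rewrite nmZ ger0_norm ?invr_ge0 ?nm_ge0// mulVf//; split=> //.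
  rewrite (eqv_nm (selfadjZ _ _)) nmZ ger0_norm ?invr_ge0 ?nm_ge0//.
  by rewrite mulrC ltr_pdivlMr.
move=> /choice[u hu].
have [k [g [hk /limit_ofP]]] := cA u (fun n => proj1 (hu n)).
move=> /(_ _ ltr01)[N hN].
have := hN _ (leq_maxl N (Num.truncn (1 + nm g)).+1).
set n := maxn _ _ => hn.
have h1 := proj2 (hu (k n)).
have h2 : nm (A (u (k n))) <= nm (A (u (k n)) - g) + nm g.
  by rewrite (le_trans _ (nmD _ _ _))// subrK.
have h3 : 1 + nm g < (k n)%:R.
  apply: (lt_le_trans (truncnS_gt _)).
  by rewrite ler_nat (leq_trans (leq_maxr N _))// homo_ltn_ge.
lra.
Qed.

Section top_eigenvector.
Variable S : set V.
Hypothesis S0 : S 0.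
Hypothesis SD : forall f g, S f -> S g -> S (f + g).
Hypothesis SZ : forall c f, S f -> S (c *: f).
Hypothesis SA : forall f, S f -> S (A f).
Hypothesis Slim : forall u g, (forall n, S (u n)) -> limit_of ip u g -> S g.
Hypothesis cA : compact_on A.

(* With [M] the supremum of the quadratic form over the unit ball of [S], the
   form of [B = M - A] is nonnegative on [S], so that [|B f|^2] is bounded by
   a multiple of the form of [B] at [f]; along a maximizing sequence [B f]
   thus tends to 0, and compactness of [A] produces an eigenvector. *)
Lemma top_eigenvector : exists (e : V) (l : R),
  [/\ 0 <= l, S e, forall h, ip (A e) h = l%:C * ip e h,
      nsq e = (0 < l)%R%:R & forall f, S f -> rip (A f) f <= l * nsq f].
Proof.
have [K K0 hK] := compact_bounded cA.
have hKq f : rip (A f) f <= K * nsq f.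
  rewrite (le_trans (ler_norm _))// (le_trans (rip_le _ _ _))//.
  by rewrite -nm_sqr expr2 mulrA ler_wpM2r ?nm_ge0.
pose E := [set r | exists f, [/\ S f, nm f <= 1 & r = rip (A f) f]].
have E0 : E 0.
  by exists 0; split=> //; rewrite ?nm0 // /re_ip sA ip0l.
have ubE : has_ubound E.
  exists K => _ [f [_ f1 ->]]; rewrite (le_trans (hKq f))// -nm_sqr.
  by rewrite ler_piMr// expr_le1// nm_ge0.
have sE : has_sup E by split=> //; exists 0.
set M := sup E.
have M0 : 0 <= M by exact: sup_upper_bound.
have hM f : S f -> rip (A f) f <= M * nsq f.
  move=> Sf; have [f0|f0] := eqVneq (nm f) 0.
    have : nsq f = 0 by apply/eqP; rewrite -nm_eq0 f0.
    by move=> e; rewrite e mulr0 /re_ip sA ip_nsq0.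
  have fp : 0 < nm f by rewrite lt_neqAle eq_sym f0 nm_ge0.
  have : rip (A ((nm f)^-1%:C *: f)) ((nm f)^-1%:C *: f) <= M.
    apply: sup_upper_bound => //; exists ((nm f)^-1%:C *: f); split=> //.
      exact: SZ.
    by rewrite nmZ ger0_norm ?invr_ge0 ?nm_ge0// mulVf.
  by rewrite ripAZ -nm_sqr exprVn mulrC ler_pdivrMr// exprn_gt0.
have [Mpos|] := ltP 0 M; last first.
  (* If the form is nonpositive on [S], the witness is eigenvalue 0 with vector 0. This is the
     padding used once the positive eigenvalues are exhausted. *)
  move=> Mle; exists 0, 0; split=> //; rewrite ?ltxx ?nsq0//.
  - by move=> h; rewrite sA !ip0l mulr0.
  - by move=> f /hM h; rewrite mul0r (le_trans h)// mulr_le0_ge0 ?nsqP.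
pose b f : R := M * nsq f - rip (A f) f.
pose B f := M%:C *: f - A f.
have MK : 0 < M + K by lra.
have hB f : S f -> nsq (B f) <= (M + K) * b f.
  move=> Sf; have SB : S (B f).
    by apply: SD; [exact: SZ|rewrite -scaleN1r; apply/SZ/SA].
  have hbB : b (B f) <= (M + K) * nsq (B f).
    have := hKq (- B f); rewrite nsqN => h1.
    have : - rip (A (B f)) (B f) <= K * nsq (B f).
      rewrite (le_trans (ler_norm _))// normrN (le_trans (rip_le _ _ _))//.
      by rewrite -nm_sqr expr2 mulrA ler_wpM2r ?nm_ge0.
    rewrite /b; lra.
  (* Nonnegativity of [b] at f - t B f, combined with [hbB], reads 2 t |B f|^2 - t^2 (M + K) |B f|^2
     <= b f; this t maximizes the left side. *)
  pose t := (M + K)^-1.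
  have Sh : S (f + (- t)%:C *: B f) by apply: SD => //; exact: SZ.
  have := hM _ Sh; rewrite ripAD ripAZ nsqD nsqZr ripZr ripZr.
  have e1 : M * rip f (B f) - rip (A f) (B f) = nsq (B f).
    by rewrite -ripZl -ripNl -ripDl.
  have tMK : t * (M + K) = 1 by rewrite mulVf// gt_eqF.
  have t0 : 0 < t by rewrite invr_gt0.
  have : t ^+ 2 * b (B f) <= t * nsq (B f).
    rewrite expr2 -mulrA; apply: ler_wpM2l; first exact: ltW.
    by rewrite -(ler_pM2l MK) mulrA [X in X * b _]mulrC tMK mul1r.
  rewrite /b => h1 h2.
  have : t * nsq (B f) <= M * nsq f - rip (A f) f.
    have e2 : t * nsq (B f) = t * (M * rip f (B f)) - t * rip (A f) (B f).
      by rewrite -e1 mulrBr.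
    move: h1 h2 e2; clearbody t; lra.
  by rewrite -(ler_pM2l MK) mulrA [X in X * nsq _]mulrC tMK mul1r.
pose r (n : nat) : R := n.+1%:R^-1.
have : forall n : nat, exists f, [/\ S f, nm f <= 1 & M - r n < rip (A f) f].
  move=> n; have n0 : 0 < r n by rewrite invr_gt0.
  have [_ [f [Sf f1 ->]] h] := sup_adherent n0 sE.
  by exists f.
move=> /choice[u hu].
have uS n : S (u n) by have [] := hu n.
have u1 n : nm (u n) <= 1 by have [] := hu n.
have uM n : M - r n < rip (A (u n)) (u n) by have [] := hu n.
have [k [g [hk hg]]] := cA u1.
have ub n : b (u n) <= r n.
  have : nsq (u n) <= 1 by rewrite -nm_sqr expr_le1// nm_ge0.
  rewrite /b => h; have := uM n.
  have : M * nsq (u n) <= M by rewrite ler_piMr.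
  lra.
have uB : limit_of ip (B \o u) 0.
  apply/limit_ofP => e e0.
  have e2 : 0 < e ^+ 2 / (M + K) by rewrite divr_gt0// exprn_gt0.
  pose N := Num.truncn (e ^+ 2 / (M + K))^-1; exists N => n Nn /=.
  rewrite subr0 -(@ltr_pXn2r _ 2) ?nnegrE ?nm_ge0 ?(ltW e0)// nm_sqr.
  rewrite (le_lt_trans (hB _ (uS n)))// mulrC -ltr_pdivlMr//.
  rewrite (le_lt_trans (ub n))// invf_plt ?posrE//.
  by rewrite (lt_le_trans (truncnS_gt _))// ler_nat.
have uM_g : limit_of ip (fun n => M%:C *: u (k n)) g.
  have := limit_ofD (limit_of_subseq hk uB) hg; rewrite add0r.
  by apply: cvg_trans; apply: near_eq_cvg; near=> n; rewrite /= /B subrK.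
exists ((nm g)^-1%:C *: g), M.
(* The limit is not null: the norm of the image dominates the form, which tends to M > 0 along the
   maximizing sequence. *)
have Mg : M <= nm g.
  apply: limit_of_le hg _ => e e0; exists (Num.truncn e^-1) => n Nn.
  have h1 : rip (A (u (k n))) (u (k n)) <= nm (A (u (k n))).
    rewrite (le_trans (ler_norm _))// (le_trans (rip_le _ _ _))//.
    by rewrite ler_piMr// nm_ge0.
  have := uM (k n).
  have : r (k n) <= e.
    rewrite ltW// invf_plt ?posrE// (lt_le_trans (truncnS_gt _))// ler_nat ltnS.
    by rewrite (leq_trans Nn)// homo_ltn_ge.
  lra.
have gp : 0 < nm g by rewrite (lt_le_trans Mpos).
split=> //.
- by apply: SZ; apply: Slim uM_g => n; exact: SZ.
- have : eqv (A g) (M%:C *: g).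
    apply/eqv_nmB; apply/eqP; rewrite eq_le nm_ge0 andbT.
    apply/ler_addgt0Pr => e e0; rewrite add0r.
    have MK1 : 0 < e / (K + M) by rewrite divr_gt0// addrC.
    move/limit_ofP : uM_g => /(_ _ MK1)[N1 h1].
    move/limit_ofP : hg => /(_ _ MK1)[N2 h2].
    have := h1 _ (leq_maxl N1 N2); have := h2 _ (leq_maxr N1 N2).
    set n := maxn _ _ => h4 h3.
    have -> : e = K * (e / (K + M)) + M * (e / (K + M)).
      by rewrite -mulrDl mulrC mulfVK// gt_eqF// addrC.
    apply: (le_trans (nm_dist _ _ (A (M%:C *: u (k n))) _)); apply: lerD.
      rewrite -(eqv_nm (selfadjB _ _)) (le_trans (hK _))// ler_wpM2l//.
      by rewrite nmBC ltW.
    rewrite (eqv_nm (eqvB (selfadjZ _ _) (fun=> erefl))) -scalerBr nmZ.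
    by rewrite ger0_norm// ler_wpM2l// ltW.
  move=> hAg h; rewrite (selfadjZ _ _ h) !ipZl hAg ipZl; ring.
- by rewrite Mpos -nm_sqr nmZ ger0_norm ?invr_ge0 ?nm_ge0// mulVf ?expr1n// gt_eqF.
Unshelve. all: by end_near. Qed.

End top_eigenvector.
End one_operator.
End self_adjoint_operators.

(** * Spectral theorem for compact self-adjoint operators *)

(** Only the positive spectrum is recorded. After the last positive eigenvalue [lam] is 0 and, by
    [spectral_orth], the [e n] are null vectors, so finitely and infinitely many eigenvalues are
    treated alike. Instead of completeness of the eigenvectors there is [spectral_max], the half of
    the min-max principle bounding the form on a subspace of finite codimension. *)
Record spectral (R : realType) (V : lmodType R[i]) (ip : semi_ip V)
    (A : V -> V) (lam : nat -> R) (e : nat -> V) : Prop := Spectral {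
  spectral_ge0 : forall n, 0 <= lam n;
  spectral_le : forall m n, (m <= n)%N -> lam n <= lam m;
  spectral_cvg0 : forall a, 0 < a -> exists n, lam n < a;
  spectral_eig : forall n h, ip (A (e n)) h = (lam n)%:C * ip (e n) h;
  spectral_orth : forall m n, ip (e m) (e n) = ((m == n) && (0 < lam m)%R)%:R;
  spectral_max : forall n f, (forall k, (k < n)%N -> ip f (e k) = 0) ->
    re_ip ip (A f) f <= lam n * sqnorm ip f }.

Section spectral_theorem.
Variables (R : realType) (V : lmodType R[i]) (ip : semi_ip V).
Implicit Types (f g h : V).
Local Notation rip := (re_ip ip).
Local Notation nsq := (sqnorm ip).
Local Notation nm := (seminorm ip).
Local Notation eqv := (eqv ip).

Lemma limit_of_orth u g f : limit_of ip u g -> (forall n, ip (u n) f = 0) ->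
  ip g f = 0.
Proof.
move=> hu u0.
have key h : (forall n, rip (u n) h = 0) -> rip g h = 0.
  move=> uh; apply/eqP; rewrite -normr_le0; apply/ler_addgt0Pr => a a0.
  rewrite add0r.
  have p0 : 0 < a / (nm h + 1) by rewrite divr_gt0// ltr_wpDl// nm_ge0.
  move/limit_ofP : hu => /(_ _ p0)[N /(_ _ (leqnn N)) hN].
  have -> : rip g h = rip (g - u N) h by rewrite ripDl ripNl uh subr0.
  rewrite (le_trans (rip_le _ _ _))// nmBC.
  move: hN; rewrite ltr_pdivlMr ?ltr_wpDl ?nm_ge0// => hN.
  have := nm_ge0 ip (u N - g); nra.
have h1 := key f; have h2 := key ((0 +i* 1) *: f).
have {}h1 : rip g f = 0 by apply: h1 => n; rewrite /re_ip u0.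
have {}h2 : rip g ((0 +i* 1) *: f) = 0.
  by apply: h2 => n; rewrite /re_ip ipZr u0 mulr0.
move: h1 h2; rewrite /re_ip ipZr; case: (ip g f) => a b /= -> h.
by apply/eqP; rewrite eq_complex /= eqxx /=; apply/eqP; lra.
Qed.

(** Iterates [top_eigenvector] on the orthogonal complement of the eigenvectors already found, which
    is invariant because [A] is symmetric. The eigenvalues tend to 0, since otherwise the images of
    an orthonormal sequence would stay a fixed distance apart. *)
Lemma exists_spectral A : selfadj ip A -> compact_on ip A ->
  exists lam e, spectral ip A lam e.
Proof.
move=> sA cA.
pose good (s : seq V) := forall e, e \in s -> exists l : R,
  forall h, ip (A e) h = l%:C * ip e h.
pose S (s : seq V) : set V := [set f | forall e, e \in s -> ip f e = 0].
pose P (s : seq V) (el : V * R) := [/\ 0 <= el.2, S s el.1,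
  forall h, ip (A el.1) h = el.2%:C * ip el.1 h,
  nsq el.1 = (0 < el.2)%R%:R & forall f, S s f -> rip (A f) f <= el.2 * nsq f].
(* Choice needs a step function defined on all lists; those not made of eigenvectors receive a dummy
   value. *)
have : forall s, exists el, good s -> P s el.
  move=> s; have [gs|ngs] := pselect (good s); last by exists (0, 0).
  have [||||||e [l h]] := @top_eigenvector R V ip A sA (S s); last 1 first.
  - by exists (e, l) => _.
  - by move=> e _; rewrite ip0l.
  - by move=> f g hf hg e es; rewrite ipDl hf// hg// addr0.
  - by move=> c f hf e es; rewrite ipZl hf// mulr0.
  - move=> f hf e es; rewrite sA; have [l hl] := gs _ es.
    by rewrite -ipJ hl conjcM ipJ hf// mulr0.
  - by move=> u g hu hg e es; apply: limit_of_orth hg _ => n; exact: hu.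
  - exact: cA.
move=> /choice[F hF].
pose fix E n := if n is n'.+1 then rcons (E n') (F (E n')).1 else [::].
pose e n := (F (E n)).1; pose lam n := (F (E n)).2.
have EP n x : x \in E n -> exists2 k, (k < n)%N & x = e k.
  elim: n x => // n ih x /=; rewrite mem_rcons inE => /predU1P[->|/ih[k kn ->]].
    by exists n.
  by exists k => //; rewrite (leq_trans kn).
have eE n k : (k < n)%N -> e k \in E n.
  elim: n => // n ih; rewrite ltnS leq_eqVlt /= mem_rcons inE => /predU1P[->|/ih ->].
    by rewrite eqxx.
  by rewrite orbT.
have goodE n : good (E n).
  elim: n => // n ih x /=; rewrite mem_rcons inE => /predU1P[->|/ih//].
  by have [_ _ h _ _] := hF _ ih; exists (lam n).
have hP n : P (E n) (e n, lam n).
  by rewrite /e /lam; case: (F _) (hF _ (goodE n)).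
have lam0 n : 0 <= lam n by have [] := hP n.
have orth m n : (m < n)%N -> ip (e n) (e m) = 0.
  by move=> mn; have [_ /(_ _ (eE _ _ mn))] := hP n.
have eig n h : ip (A (e n)) h = (lam n)%:C * ip (e n) h by have [_ _ /(_ h)] := hP n.
have ipE m n : ip (e m) (e n) = ((m == n) && (0 < lam m)%R)%:R.
  have [mn|mn|<-] := ltngtP m n => /=.
  - by rewrite -ipJ orth// conjc0.
  - by rewrite orth.
  - by rewrite ip_self; have [_ _ _ -> _] := hP m; case: ltP.
have lamS n : lam n.+1 <= lam n.
  (* [e n.+1] is also orthogonal to the shorter list [E n], so it competes in the maximum that
     defines [lam n]. *)
  have [_ hS _ hn _] := hP n.+1; have [_ _ _ _ /(_ (e n.+1))] := hP n.
  have -> : rip (A (e n.+1)) (e n.+1) = lam n.+1 * nsq (e n.+1).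
    by rewrite /re_ip eig cReZ.
  rewrite /= in hn; rewrite hn; have [l0|l0] := ltP 0 (lam n.+1).
    rewrite !mulr1 => h; apply: h => x xE; apply: hS.
    by rewrite /= mem_rcons inE xE orbT.
  by move=> _; rewrite (le_trans l0).
have lam_le m n : (m <= n)%N -> lam n <= lam m.
  move=> /subnK <-; elim: (n - m)%N => // k ih.
  by rewrite addSn (le_trans (lamS _)).
exists lam, e; split=> //; last first.
  move=> n f hf; have [_ _ _ _ /(_ f)] := hP n; apply=> x /EP[k kn ->].
  exact: hf.
move=> a a0; apply: contrapT => nn.
have la n : a <= lam n by rewrite leNgt; apply/negP => h; apply: nn; exists n.
have [|k [g [hk /limit_ofP hg]]] := cA e.
  move=> n; have [_ _ _ h _] := hP n; rewrite -(@expr_le1 _ 2)// ?nm_ge0//.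
  by rewrite nm_sqr h lern1 leq_b1.
have a2 : 0 < a / 2 by rewrite divr_gt0.
have [N hN] := hg _ a2.
have h1 := hN _ (leqnn _); have h2 := hN _ (leqnSn _).
set n := k N in h1; set m := k N.+1 in h2.
have nm_ : n != m by rewrite ltn_eqF// hk.
have : nm (A (e n) - A (e m)) < a.
  rewrite (le_lt_trans (nm_dist _ _ g _))// (nmBC _ g); lra.
have : a ^+ 2 <= nsq (A (e n) - A (e m)).
  rewrite nsqB.
  have q k' : nsq (A (e k')) = lam k' ^+ 2.
    have lk : 0 < lam k' by rewrite (lt_le_trans a0).
    rewrite /sqnorm /re_ip eig -ipJ eig conjcM ipJ conjc_real.
    by rewrite ipE eqxx lk mulr1 cReZ expr2.
  have -> : rip (A (e n)) (A (e m)) = 0.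
    by rewrite /re_ip eig -ipJ eig conjcM ipJ ipE (negbTE nm_) !mulr0.
  rewrite !q mulr0 subr0; have := la n; have := la m; nra.
rewrite -nm_sqr; have := nm_ge0 ip (A (e n) - A (e m)).
nra.
Qed.

End spectral_theorem.

Definition lincomb (R : realType) (V : lmodType R[i]) (e : nat -> V) (n : nat)
  (c : nat -> R[i]) := \sum_(k < n) c k *: e k.

Section spectral_consequences.
Variables (R : realType) (V : lmodType R[i]) (ip : semi_ip V).
Variables (A : V -> V) (lam : nat -> R) (e : nat -> V).
Hypothesis sA : selfadj ip A.
Hypothesis sp : spectral ip A lam e.
Implicit Types (f g h : V) (c : nat -> R[i]).
Local Notation rip := (re_ip ip).
Local Notation nsq := (sqnorm ip).
Local Notation nm := (seminorm ip).
Local Notation eqv := (eqv ip).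

Local Notation lin := (lincomb e).

Lemma ip_lin n c m : ip (lin n c) (e m) = c m * ((m < n)%N && (0 < lam m)%R)%:R.
Proof.
rewrite ip_suml; have [mn|nm_] := ltnP m n => /=; last first.
  rewrite mulr0 big1// => k _; rewrite ipZl (spectral_orth sp).
  by rewrite ltn_eqF ?mulr0// (leq_trans _ nm_).
rewrite (bigD1 (Ordinal mn))//= big1 ?addr0.
  by rewrite ipZl (spectral_orth sp) eqxx.
move=> k /eqP kn; rewrite ipZl (spectral_orth sp).
case: eqP => [km|]; rewrite ?mulr0//.
by exfalso; apply: kn; apply/val_inj.
Qed.

Lemma rip_lin n c f : rip f (lin n c) =
  \sum_(k < n) complex.Re ((c k)^*%C * ip f (e k)).
Proof. by rewrite /re_ip ip_sumr cRe_sum; apply: eq_bigr => k _; rewrite ipZr. Qed.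

Lemma nsq_lin n c : (forall k, (k < n)%N -> 0 < lam k) ->
  nsq (lin n c) = \sum_(k < n) cnorm2 (c k).
Proof.
move=> l0; rewrite /sqnorm rip_lin; apply: eq_bigr => k _.
by rewrite ip_lin ltn_ord l0//= mulr1 mulrC mulcJ.
Qed.

Lemma ripA_lin n c : rip (A (lin n c)) (lin n c) = \sum_(k < n) lam k * cnorm2 (c k).
Proof.
rewrite rip_lin; apply: eq_bigr => k _; rewrite sA -ipJ (spectral_eig sp).
rewrite conjcM ipJ conjc_real ip_lin ltn_ord /= mulrCA [_^*%C * _]mulrA.
rewrite [_^*%C * _]mulrC mulcJ cReZ; have [l0|l0] := ltP 0 (lam k).
  by rewrite mulr1.
suff -> : lam k = 0 by rewrite !mul0r.
by apply/eqP; rewrite eq_le l0 (spectral_ge0 sp).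
Qed.

Lemma eqvA_lin n c : eqv (A (lin n c)) (lin n (fun k => (lam k)%:C * c k)).
Proof.
move=> h; rewrite sA ip_suml ip_suml; apply: eq_bigr => k _.
by rewrite !ipZl -sA (spectral_eig sp); ring.
Qed.

(** Dividing coefficients by eigenvalues inverts [A] on a span of eigenvectors. With [nm_lin_div]
    this presents such a combination as an image [A g] with g under control, the form to which
    smallness of products applies. *)
Lemma eqvA_lin_div n c : (forall k, (k < n)%N -> 0 < lam k) ->
  eqv (A (lin n (fun k => c k / (lam k)%:C))) (lin n c).
Proof.
move=> l0; apply: eqv_trans (eqvA_lin _ _) _ => h; congr (ip _ h).
apply: eq_bigr => k _; congr (_ *: _); rewrite mulrC divfK// eq_complex /=.
by rewrite negb_and gt_eqF ?l0.
Qed.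

Lemma nm_lin_div n c t : 0 < t -> (forall k, (k < n)%N -> t <= lam k) ->
  nm (lin n (fun k => c k / (lam k)%:C)) <= nm (lin n c) / t.
Proof.
move=> t0 lt; have l0 k : (k < n)%N -> 0 < lam k by move/lt; exact: lt_le_trans.
rewrite -(@ler_pXn2r _ 2) ?nnegrE ?nm_ge0 ?divr_ge0 ?nm_ge0 ?(ltW t0)//.
rewrite expr_div_n !nm_sqr !nsq_lin// mulr_suml; apply: ler_sum => k _.
have -> : c k / (lam k)%:C = (lam k)^-1%:C * c k.
  by rewrite mulrC; congr (_ * _); rewrite fmorphV.
rewrite /cnorm2 cReZ cImZ !exprMn -mulrDr mulrC ler_wpM2l ?addr_ge0 ?sqr_ge0//.
by rewrite exprVn lef_pV2 ?posrE ?exprn_gt0 ?l0// lerXn2r ?nnegrE ?lt ?(ltW t0) ?(ltW (l0 _ _)).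
Qed.

(** [lam] decreases to 0, so its level set at s > 0 is a block of d consecutive indices. What is
    left of an eigenvector after projection onto this block is orthogonal to every [e n], and its
    form is s times its squared norm; [spectral_max] then makes it null. *)
Lemma eigenvectors_span (s : R) : 0 < s ->
  exists a d, (forall n, lam n = s <-> (a <= n < a + d)%N) /\
    forall f, (forall h, ip (A f) h = s%:C * ip f h) ->
      eqv f (\sum_(k < d) ip f (e (a + k)) *: e (a + k)).
Proof.
move=> s0; have lamP (P : pred R) : {homo P : x y / y <= x >-> x ==> y} ->
    (exists n, P (lam n)) -> exists a, forall n, P (lam n) = (a <= n)%N.
  move=> hP /ex_minnP[a Pa amin]; exists a => n; apply/idP/idP; first exact: amin.
  by move=> an; move/implyP : (hP _ _ (spectral_le sp an)); apply.
have [n0 hn0] := spectral_cvg0 sp s0.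
have [||a ha] := lamP (fun x => x <= s).
- by move=> x y yx; apply/implyP => /(le_trans yx).
- by exists n0; exact: ltW.
have [||b hb] := lamP (fun x => x < s).
- by move=> x y yx; apply/implyP; exact: le_lt_trans.
- by exists n0.
have ab : (a <= b)%N by rewrite -ha ltW// hb.
have hE n : lam n = s <-> (a <= n < a + (b - a))%N.
  rewrite subnKC// -ha ltnNge -hb -leNgt; split=> [->|/le_anti//].
  by rewrite lexx.
exists a, (b - a)%N; split=> // f hf.
set x := \sum_(k < _) _.
have orth n : ip (f - x) (e n) = 0.
  have [nE|nE] := eqVneq (lam n) s.
    have /andP[an nb] := (hE n).1 nE.
    rewrite ipBl /x ip_suml.
    have nk : (n - a < b - a)%N by lia.
    rewrite (bigD1 (Ordinal nk))//= big1 ?addr0.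
      by rewrite ipZl subnKC// (spectral_orth sp) eqxx nE s0 mulr1 subrr.
    move=> k /eqP kn; rewrite ipZl (spectral_orth sp).
    case: eqP => [km|]; rewrite ?mulr0//.
    by exfalso; apply: kn; apply/val_inj; rewrite /= -km addKn.
  have -> : ip (f - x) (e n) = ip f (e n).
    rewrite ipBl /x ip_suml big1 ?subr0// => k _.
    rewrite ipZl (spectral_orth sp); case: eqP => [kn|]; rewrite ?mulr0//.
    exfalso; move/eqP : nE; apply; apply/hE; rewrite -kn leq_addr /=.
    by rewrite ltn_add2l.
  (* Eigenvectors for distinct eigenvalues are orthogonal. *)
  have : (s - lam n)%:C * ip f (e n) = 0.
    rewrite rmorphB mulrBl -hf sA -[X in X - _]ipJ (spectral_eig sp) conjcM ipJ.
    by rewrite conjc_real subrr.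
  move/eqP; rewrite mulf_eq0 eq_complex /= eqxx andbT subr_eq0 eq_sym.
  by rewrite (negbTE nE) => /eqP.
apply/eqv_nmB/eqP; rewrite nm_eq0.
have orthC k : ip (e k) (f - x) = 0 by rewrite -ipJ orth conjc0.
have := spectral_max sp (fun k (_ : (k < n0)%N) => orth k).
have -> : rip (A (f - x)) (f - x) = s * nsq (f - x).
  have -> : rip (A (f - x)) (f - x) = rip (A f) (f - x) - rip (A x) (f - x).
    by rewrite (eqv_ripl _ (selfadjB sA _ _)) ripDl ripNl.
  have -> : rip (A f) (f - x) = s * rip f (f - x) by rewrite /re_ip hf cReZ.
  have -> : rip (A x) (f - x) = 0.
    rewrite /re_ip sA {1}/x ip_suml big1// => k _.
    by rewrite ipZl -sA (spectral_eig sp) orthC !mulr0.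
  have x0 : rip x (f - x) = 0.
    by rewrite /re_ip {1}/x ip_suml big1// => k _; rewrite ipZl orthC mulr0.
  by rewrite /sqnorm ripDl ripNl x0 !subr0.
have := nsqP ip (f - x); move: (nsq _) => q q0 h.
by rewrite eq_le q0 andbT; nra.
Qed.

End spectral_consequences.

(** * Eigenvalues of sums of almost orthogonal operators *)

(** A homogeneous system with more unknowns than equations. All codimension counts, and the
    invariance of the dimension of eigenspaces, rest on it. *)
Lemma kernel_comb (F : fieldType) (I J : finType) (M : J -> I -> F) :
  (#|I| < #|J|)%N ->
  exists c : J -> F, (exists j, c j != 0) /\ forall i, \sum_j c j * M j i = 0.
Proof.
move=> IJ; pose W := \matrix_(a < #|J|, b < #|I|) M (enum_val a) (enum_val b).
have : kermx W != 0.
  rewrite -mxrank_eq0 mxrank_ker subn_eq0 -ltnNge.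
  by rewrite (leq_ltn_trans (rank_leq_col _)).
case/rowV0Pn => v /sub_kermxP vW /rV0Pn[a va].
exists (fun j => v 0 (enum_rank j)); split; first by exists (enum_val a); rewrite enum_valK.
move=> i; have /matrixP/(_ 0 (enum_rank i)) := vW; rewrite !mxE => h; rewrite -[RHS]h.
rewrite (reindex _ (onW_bij _ (@enum_val_bij J))) /=.
by apply: eq_bigr => x _; rewrite enum_valK !mxE enum_rankK.
Qed.

Definition lin_fun (R : realType) (V W : lmodType R[i]) (phi : V -> W) :=
  forall c f g, phi (c *: f + g) = c *: phi f + phi g.

Lemma lin_fun_sum (R : realType) (V W : lmodType R[i]) (phi : V -> W) (I : finType)
    (c : I -> R[i]) (x : I -> V) : lin_fun phi ->
  phi (\sum_i c i *: x i) = \sum_i c i *: phi (x i).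
Proof.
move=> hphi; have phi0 : phi 0 = 0.
  by have := hphi (-1) 0 0; rewrite scaler0 addr0 scaleN1r addNr.
have phiD f g : phi (f + g) = phi f + phi g by have := hphi 1 f g; rewrite !scale1r.
rewrite (big_morph phi phiD phi0); apply: eq_bigr => i _.
by have := hphi (c i) (x i) 0; rewrite phi0 !addr0.
Qed.

Section spectral_truncation.
Variables (R : realType) (V : lmodType R[i]) (ip : semi_ip V).
Variables (A : V -> V) (lam : nat -> R) (e : nat -> V).
Hypothesis sA : selfadj ip A.
Hypothesis sp : spectral ip A lam e.
Implicit Types (f g h : V) (c : nat -> R[i]).
Local Notation rip := (re_ip ip).
Local Notation nsq := (sqnorm ip).
Local Notation nm := (seminorm ip).
Local Notation eqv := (eqv ip).
Local Notation lin := (lincomb e).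

Lemma spectral_threshold t : 0 < t -> exists K, forall n, (n < K)%N = (t < lam n).
Proof.
move=> /(spectral_cvg0 sp)[n0 hn0].
have /ex_minnP[K hK Kmin] : exists n, lam n <= t by exists n0; exact: ltW.
exists K => n; rewrite ltNge [LHS]ltnNge; congr (~~ _); apply/idP/idP; last exact: Kmin.
by move=> Kn; rewrite (le_trans (spectral_le sp Kn)).
Qed.

(** [x f] is the component of f along the finitely many eigenvectors with eigenvalue above t, and
    [g f] is its preimage under [A]. In the last clause the coefficients of index below i vanish,
    the remaining large eigenvalues are at most s, and the rest of f contributes at most
    [t * nsq f]. *)
Lemma spectral_truncation t : 0 < t -> exists x g : V -> V,
  [/\ lin_fun g, forall f, eqv (A (g f)) (x f), forall f, nm (g f) <= nm (x f) / t,
      forall f, rip f (x f) = nsq (x f) &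
      forall f i s, lam i <= s -> (forall k, (k < i)%N -> ip f (e k) = 0) ->
        rip (A f) f <= s * nsq (x f) + t * nsq f].
Proof.
move=> t0; have [K hK] := spectral_threshold t0.
have lt k : (k < K)%N -> t < lam k by rewrite hK.
have l0 k : (k < K)%N -> 0 < lam k by move/lt; exact: lt_trans.
pose co f k := ip f (e k).
exists (fun f => lin K (co f)), (fun f => lin K (fun k => co f k / (lam k)%:C)).
split.
- move=> c f g; rewrite /lincomb scaler_sumr -big_split; apply: eq_bigr => k _ /=.
  by rewrite /co ipDl ipZl mulrDl scalerDl scalerA mulrA.
- by move=> f; apply: (eqvA_lin_div sA sp).
- by move=> f; apply: (nm_lin_div sp) => // k /lt/ltW.
- move=> f; rewrite (nsq_lin sp)// rip_lin; apply: eq_bigr => k _.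
  by rewrite mulrC mulcJ.
move=> f i s lis fi.
pose x := lin K (co f); pose r := f - x.
have rE k : (k < K)%N -> ip r (e k) = 0.
  by move=> kK; rewrite ipBl (ip_lin sp) kK l0// mulr1 subrr.
have xr0 : rip x r = 0.
  rewrite /re_ip ip_suml big1// => k _.
  by rewrite ipZl -ipJ rE ?conjc0 ?mulr0.
have Axr0 : rip (A x) r = 0.
  rewrite /re_ip sA ip_suml big1// => k _.
  by rewrite ipZl -sA (spectral_eig sp) -[ip _ r]ipJ rE// conjc0 !mulr0.
have fE : f = x + r by rewrite addrC subrK.
clearbody r.
rewrite {1 2}fE (ripAD sA) Axr0 mulr0 addr0; apply: lerD.
  rewrite (ripA_lin sA sp) (nsq_lin sp)// mulr_sumr; apply: ler_sum => k _.
  have [ki|ik] := ltnP k i; first by rewrite /co fi// /cnorm2 /= expr0n /= addr0 !mulr0.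
  by rewrite ler_wpM2r ?cnorm2_ge0// (le_trans (spectral_le sp ik)).
rewrite (le_trans (spectral_max sp rE))//.
have : lam K <= t by rewrite leNgt -hK ltnn.
have : nsq r <= nsq f.
  by rewrite {1}fE nsqD xr0 mulr0 addr0 lerDr nsqP.
have := nsqP ip r; have := nsqP ip f; have := spectral_ge0 sp K; nra.
Qed.

End spectral_truncation.

Section orthogonal_sums.
Variables (R : realType) (V : lmodType R[i]) (ip : semi_ip V).
Variables (A B T : V -> V) (lamA lamB lamT : nat -> R) (eA eB eT : nat -> V).
Hypotheses (sA : selfadj ip A) (sB : selfadj ip B) (sT : selfadj ip T).
Hypotheses (spA : spectral ip A lamA eA) (spB : spectral ip B lamB eB).
Hypothesis (spT : spectral ip T lamT eT).
Hypothesis TE : forall f h, ip (T f) h = ip (A f) h + ip (B f) h.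
Implicit Types (f g h : V).
Local Notation rip := (re_ip ip).
Local Notation nsq := (sqnorm ip).
Local Notation nm := (seminorm ip).
Local Notation eqv := (eqv ip).

Variables (I : finType) (phi : I -> V -> R[i]) (eta : R).
Hypothesis phi_lin : forall x, lin_fun (phi x : V -> R[i]^o).
Hypothesis eta_ge0 : 0 <= eta.
Hypothesis small : forall f g, (forall x, phi x f = 0) ->
  `|rip (A f) (B g)| <= eta * nm f * nm g.

(* [fA] and [fB], the parts of [f] in the span of the eigenvectors of [A] and
   of [B] for eigenvalues above [t], lie in the ranges of [A] and of [B] and
   are therefore almost orthogonal. *)
Lemma sum_form_upper t s i j : 0 < t -> 0 <= s -> lamA i <= s -> lamB j <= s ->
  exists2 g : V -> V, lin_fun g &
  forall f, (forall k, (k < i)%N -> ip f (eA k) = 0) ->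
    (forall k, (k < j)%N -> ip f (eB k) = 0) -> (forall x, phi x (g f) = 0) ->
    rip (T f) f <= (s * (1 + eta / t ^+ 2) + 2 * t) * nsq f.
Proof.
move=> t0 s0 Ai Bj.
have [xA [gA [linA AgA gA_le xAE upA]]] := spectral_truncation sA spA t0.
have [xB [gB [_ BgB gB_le xBE upB]]] := spectral_truncation sB spB t0.
exists gA => // f fA fB fphi.
have hA := upA f _ _ Ai fA; have hB := upB f _ _ Bj fB.
have -> : rip (T f) f = rip (A f) f + rip (B f) f by rewrite /re_ip TE cReD.
set X := nsq (xA f) + nsq (xB f).
have X0 : 0 <= X by rewrite addr_ge0 ?nsqP.
have et : 0 <= eta / t ^+ 2 by rewrite divr_ge0// exprn_ge0// ltW.
(* [small] is applied to the two preimages, each at most the norm of its component divided by t,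
   whence t^2; then 2ab <= a^2 + b^2. *)
have cross : 2 * rip (xA f) (xB f) <= eta / t ^+ 2 * X.
  have -> : rip (xA f) (xB f) = rip (A (gA f)) (B (gB f)).
    by rewrite -(eqv_ripl _ (AgA f)) ripC -(eqv_ripl _ (BgB f)) ripC.
  have : rip (A (gA f)) (B (gB f)) <= eta / t ^+ 2 * (nm (xA f) * nm (xB f)).
    rewrite (le_trans (ler_norm _))// (le_trans (small _ fphi))//.
    have -> : eta / t ^+ 2 * (nm (xA f) * nm (xB f)) =
      eta * ((nm (xA f) / t) * (nm (xB f) / t)) by field; rewrite gt_eqF.
    by rewrite -mulrA ler_wpM2l// ler_pM ?nm_ge0.
  rewrite /X -!nm_sqr; move: (nm _) (nm _) (rip _ _) (eta / _) et => a b r u u0 h.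
  have := mulr_ge0 u0 (sqr_ge0 (a - b)); nra.
(* Cauchy-Schwarz gives X^2 <= nsq f * nsq (xA f + xB f), and the last factor exceeds X only by the
   cross term; division by X yields a perturbed Bessel inequality. *)
have XE : X = rip f (xA f + xB f) by rewrite ripDr xAE xBE.
have Xle : X <= (1 + eta / t ^+ 2) * nsq f.
  have [X_eq0|Xn0] := eqVneq X 0.
    by rewrite X_eq0 mulr_ge0 ?nsqP// addr_ge0.
  have Xp : 0 < X by rewrite lt_neqAle eq_sym Xn0.
  rewrite -(ler_pM2l Xp) -expr2 {1}XE (le_trans (rip_sqr_le _ _ _))// nsqD.
  have := nsqP ip f; rewrite -/X; have := cross; rewrite /X; nra.
have := nsqP ip f; have : s * X <= s * ((1 + eta / t ^+ 2) * nsq f) by rewrite ler_wpM2l.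
rewrite /X in hA hB *; lra.
Qed.

(** Were the eigenvalue at index n = i + j + #|I| larger, the span of the first n + 1 eigenvectors
    of [T] would contain a nonzero combination subject to the n conditions of [sum_form_upper], and
    the form of [T] there would be too large. *)
Lemma sum_eigenvalue_upper t s i j : 0 < t -> 0 <= s ->
  lamA i <= s -> lamB j <= s ->
  lamT (i + j + #|I|) <= s * (1 + eta / t ^+ 2) + 2 * t.
Proof.
move=> t0 s0 Ai Bj; have [g gl hg] := sum_form_upper t0 s0 Ai Bj.
set n := (_ + _)%N; set S := (X in _ <= X); rewrite leNgt; apply/negP => lt.
have S0 : 0 <= S.
  rewrite /S addr_ge0 ?mulr_ge0 ?(ltW t0)// addr_ge0// divr_ge0//.
  by rewrite exprn_ge0// ltW.
pose M (k : 'I_n.+1) (y : 'I_i + 'I_j + I) : R[i] := match y with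
  | inl (inl m) => ip (eT k) (eA m)
  | inl (inr m) => ip (eT k) (eB m)
  | inr x => phi x (g (eT k)) end.
have [|c [[k0 ck0] hc]] := @kernel_comb _ _ _ M.
  by rewrite !card_sum !card_ord.
pose c' k := oapp c 0 (insub k : option 'I_n.+1).
have cE (k : 'I_n.+1) : c' k = c k by rewrite /c' valK.
pose f := lincomb eT n.+1 c'.
have lT k : (k < n.+1)%N -> S < lamT k.
  by rewrite ltnS => /(spectral_le spT); exact: lt_le_trans.
have lT0 k : (k < n.+1)%N -> 0 < lamT k by move/lT; exact: le_lt_trans.
have fsum (psi : V -> R[i]^o) : lin_fun psi ->
    psi f = \sum_k c k * psi (eT k) :> R[i].
  move=> pl; rewrite /f /lincomb (lin_fun_sum _ _ pl).
  by apply: eq_bigr => k _; rewrite cE.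
have ipl h : lin_fun (fun x => ip x h : R[i]^o).
  by move=> a x y; rewrite ipDl ipZl.
have := hg f.
have f1 k : (k < i)%N -> ip f (eA k) = 0.
  by move=> ki; rewrite (fsum _ (ipl _)); exact: (hc (inl (inl (Ordinal ki)))).
have f2 k : (k < j)%N -> ip f (eB k) = 0.
  by move=> kj; rewrite (fsum _ (ipl _)); exact: (hc (inl (inr (Ordinal kj)))).
have f3 x : phi x (g f) = 0.
  have pg : lin_fun (phi x \o g : V -> R[i]^o).
    by move=> a y z; rewrite /= gl phi_lin.
  by have /= -> := fsum _ pg; exact: (hc (inr x)).
move=> /(_ f1 f2 f3); rewrite -/S leNgt => /negP; apply.
rewrite (ripA_lin sT spT) (nsq_lin spT)// mulr_sumr.
have cp : 0 < cnorm2 (c' k0) by rewrite lt_neqAle cnorm2_ge0 andbT eq_sym cnorm2_eq0 cE.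
rewrite (bigD1 k0)//= [X in _ < X](bigD1 k0)//= ltr_leD//.
  by rewrite ltr_pM2r// lT.
by apply: ler_sum => k _; rewrite ler_wpM2r ?cnorm2_ge0// ltW// lT.
Qed.

(** Coefficients on the first i eigenvectors of [A] and j of [B] give vectors a and b. Besides
    orthogonality of a + b to n eigenvectors of [T], the functionals [phi] are made to vanish on a,
    on b and on the preimage of a. These three families explain [3 * #|I|] and make every mixed term
    small. *)
Lemma sum_eigenvalue_lower s s' i j n : 0 < s -> 0 <= s' ->
  (forall k, (k < i)%N -> s < lamA k) -> (forall k, (k < j)%N -> s < lamB k) ->
  (n + 3 * #|I| < i + j)%N -> lamT n <= s' ->
  s - 3 * eta / s <= s' * (1 + eta / s ^+ 2).
Proof.
move=> s0 s'0 Ai Bj nij Tn.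
pose M (y' : 'I_i + 'I_j) (y : 'I_n + (I + (I + I))) : R[i] := match y', y with
  | inl k, inl m => ip (eA k) (eT m)
  | inr k, inl m => ip (eB k) (eT m)
  | inl k, inr (inl x) => phi x (eA k)
  | inl k, inr (inr (inl x)) => phi x (eA k) / (lamA k)%:C
  | inr k, inr (inr (inr x)) => phi x (eB k)
  | _, _ => 0 end.
have [|c [[k0 ck0] hc]] := @kernel_comb _ _ _ M.
  by rewrite !card_sum !card_ord; lia.
pose cA k := oapp (fun k => c (inl k)) 0 (insub k : option 'I_i).
pose cB k := oapp (fun k => c (inr k)) 0 (insub k : option 'I_j).
have cAE (k : 'I_i) : cA k = c (inl k) by rewrite /cA valK.
have cBE (k : 'I_j) : cB k = c (inr k) by rewrite /cB valK.
pose a := lincomb eA i cA; pose b := lincomb eB j cB.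
pose ga := lincomb eA i (fun k => cA k / (lamA k)%:C).
pose gb := lincomb eB j (fun k => cB k / (lamB k)%:C).
have A0 k : (k < i)%N -> 0 < lamA k by move/Ai; exact: lt_trans.
have B0 k : (k < j)%N -> 0 < lamB k by move/Bj; exact: lt_trans.
have Aga : eqv (A ga) a by exact: (eqvA_lin_div sA spA).
have Bgb : eqv (B gb) b by exact: (eqvA_lin_div sB spB).
have nga : nm ga <= nm a / s by apply: (nm_lin_div spA) => // k /Ai/ltW.
have ngb : nm gb <= nm b / s by apply: (nm_lin_div spB) => // k /Bj/ltW.
have phiE x m (e : nat -> V) d :
    phi x (lincomb e m d) = \sum_(k < m) d k * phi x (e k).
  by rewrite /lincomb (lin_fun_sum _ _ (phi_lin x)).
have phia x : phi x a = 0.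
  rewrite phiE; have := hc (inr (inl x)); rewrite big_sumType /=.
  rewrite [X in _ + X = _]big1 ?addr0 => [h|k _]; last by rewrite mulr0.
  by rewrite -[RHS]h; apply: eq_bigr => k _; rewrite cAE.
have phiga x : phi x ga = 0.
  rewrite phiE; have := hc (inr (inr (inl x))); rewrite big_sumType /=.
  rewrite [X in _ + X = _]big1 ?addr0 => [h|k _]; last by rewrite mulr0.
  by rewrite -[RHS]h; apply: eq_bigr => k _; rewrite cAE mulrAC mulrA.
have phib x : phi x b = 0.
  rewrite phiE; have := hc (inr (inr (inr x))); rewrite big_sumType /=.
  rewrite big1 ?add0r => [h|k _]; last by rewrite mulr0.
  by rewrite -[RHS]h; apply: eq_bigr => k _; rewrite cBE.
have fT k : (k < n)%N -> ip (a + b) (eT k) = 0.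
  move=> kn; have := hc (inl (Ordinal kn)); rewrite big_sumType /= ipDl !ip_suml => h.
  by rewrite -[RHS]h; congr (_ + _); apply: eq_bigr => m _; rewrite ipZl ?cAE ?cBE.
have nsqa : nsq a = \sum_(k < i) cnorm2 (cA k) by exact: (nsq_lin spA).
have nsqb : nsq b = \sum_(k < j) cnorm2 (cB k) by exact: (nsq_lin spB).
(* Positivity is read off the nonzero coefficient vector, since a + b itself is not yet known to be
   non-null. The final estimate is divided by this sum. *)
have Ypos : 0 < nsq a + nsq b.
  case: k0 ck0 => k ck0; [rewrite ltr_pwDl ?nsqP//|rewrite ltr_wpDl ?nsqP//].
    rewrite nsqa (bigD1 k)//= ltr_pwDl ?sumr_ge0// => [|m _]; last exact: cnorm2_ge0.
    by rewrite lt_neqAle cnorm2_ge0 andbT eq_sym cnorm2_eq0 cAE.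
  rewrite nsqb (bigD1 k)//= ltr_pwDl ?sumr_ge0// => [|m _]; last exact: cnorm2_ge0.
  by rewrite lt_neqAle cnorm2_ge0 andbT eq_sym cnorm2_eq0 cBE.
have Aaa : s * nsq a <= rip (A a) a.
  rewrite (ripA_lin sA spA) nsqa mulr_sumr; apply: ler_sum => k _.
  by rewrite ler_wpM2r ?cnorm2_ge0// ltW// Ai.
have Bbb : s * nsq b <= rip (B b) b.
  rewrite (ripA_lin sB spB) nsqb mulr_sumr; apply: ler_sum => k _.
  by rewrite ler_wpM2r ?cnorm2_ge0// ltW// Bj.
have es : 0 <= eta / s by rewrite divr_ge0// ltW.
have ess : 0 <= eta / s ^+ 2 by rewrite divr_ge0// exprn_ge0// ltW.
have he u v x : 0 <= u -> v <= x / s -> eta * u * v <= eta / s * (u * x).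
  move=> u0 vx; have -> : eta / s * (u * x) = eta * u * (x / s) by ring.
  by rewrite ler_wpM2l// mulr_ge0.
have he' u v x : 0 <= u -> v <= x / s -> eta * v * u <= eta / s * (x * u).
  by move=> u0 vx; rewrite mulrAC [x * u]mulrC he.
have Aab : `|rip (A a) b| <= eta / s * (nm a * nm b).
  rewrite ripC -(eqv_ripl _ Bgb) ripC (le_trans (small _ phia))//.
  exact: he (nm_ge0 _ _) ngb.
have Abb : `|rip (A b) b| <= eta / s * nsq b.
  rewrite ripC -(eqv_ripl _ Bgb) ripC (le_trans (small _ phib))//.
  by rewrite -nm_sqr expr2; exact: he (nm_ge0 _ _) ngb.
have Bba : `|rip (B b) a| <= eta / s * (nm a * nm b).
  rewrite ripC -(eqv_ripl _ Aga) (le_trans (small _ phiga))//.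
  exact: he' (nm_ge0 _ _) nga.
have Baa : `|rip (B a) a| <= eta / s * nsq a.
  rewrite ripC -(eqv_ripl _ Aga) (le_trans (small _ phiga))//.
  by rewrite -nm_sqr expr2; exact: he' (nm_ge0 _ _) nga.
have ab : `|rip a b| <= eta / s ^+ 2 * (nm a * nm b).
  rewrite -(eqv_ripl _ Aga) ripC -(eqv_ripl _ Bgb) ripC (le_trans (small _ phiga))//.
  have -> : eta / s ^+ 2 * (nm a * nm b) = eta * ((nm a / s) * (nm b / s)).
    by field; rewrite gt_eqF.
  by rewrite -mulrA ler_wpM2l// ler_pM ?nm_ge0.
have nmab : 2 * (nm a * nm b) <= nsq a + nsq b.
  by rewrite -!nm_sqr; have := sqr_ge0 (nm a - nm b); nra.
have := spectral_max spT fT.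
have -> : rip (T (a + b)) (a + b) = rip (A (a + b)) (a + b) + rip (B (a + b)) (a + b).
  by rewrite /re_ip TE cReD.
rewrite (ripAD sA) (ripAD sB) (ripA_sym sB a b) nsqD => main.
(* Of the factor 3, two units come from the mixed terms of [A] and of [B], each occurring twice and
   bounded through 2ab <= a^2 + b^2, and one from [rip (A b) b] and [rip (B a) a] together. *)
have {}main : s * (nsq a + nsq b) - 3 * (eta / s) * (nsq a + nsq b) <=
    s' * (1 + eta / s ^+ 2) * (nsq a + nsq b).
  have nab : nsq a + 2 * rip a b + nsq b <= (1 + eta / s ^+ 2) * (nsq a + nsq b).
    have := le_trans (ler_norm _) ab.
    have : eta / s ^+ 2 * (2 * (nm a * nm b)) <= eta / s ^+ 2 * (nsq a + nsq b).
      by rewrite ler_wpM2l.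
    lra.
  have h1 : lamT n * (nsq a + 2 * rip a b + nsq b) <=
      s' * ((1 + eta / s ^+ 2) * (nsq a + nsq b)).
    apply: le_trans (ler_wpM2l s'0 nab); rewrite ler_wpM2r//.
    by have := nsqP ip (a + b); rewrite nsqD.
  have h2 : eta / s * (2 * (nm a * nm b)) <= eta / s * (nsq a + nsq b).
    by rewrite ler_wpM2l.
  move: Aab Abb Bba Baa; rewrite !ler_norml => /andP[? _] /andP[? _] /andP[? _] /andP[? _].
  lra.
rewrite -(ler_pM2r Ypos) mulrBl -[3 * eta / s]mulrA; exact: main.
Qed.

End orthogonal_sums.

(** The conditions bear on the argument of [A] only. This makes the relation additive in [A]
    ([rapidD]): the families of conditions are united and the constants added. *)
Definition rapid (R : realType) (V : lmodType R[i]) (ip : semi_ip V)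
    (A B : V -> V) := forall q : nat, exists (C : R) (K : nat), 0 <= C /\
  forall N, (0 < N)%N -> exists (I : finType) (phi : I -> V -> R[i]^o),
    [/\ (#|I| <= K * N)%N, forall x, lin_fun (phi x) &
        forall f g, (forall x, phi x f = 0) ->
          `|re_ip ip (A f) (B g)| <= C / N%:R ^+ q * seminorm ip f * seminorm ip g].

(** * Limits superior and inferior of weighted eigenvalue sequences *)

Section limsup_liminf.
Variable R : realType.
Implicit Types (u : nat -> \bar R) (c : \bar R).

Lemma limn_esupE u : limn_esup u = ereal_inf (range (esups u)).
Proof. by rewrite limn_esup_lim; apply/cvg_lim => //; exact: cvg_esups_inf. Qed.

Lemma limn_einfE u : limn_einf u = ereal_sup (range (einfs u)).
Proof. by rewrite limn_einf_lim; apply/cvg_lim => //; exact: cvg_einfs_sup. Qed.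

Lemma limn_esup_lt u c : (limn_esup u < c)%E ->
  exists N, forall n, (N <= n)%N -> (u n <= c)%E.
Proof.
rewrite limn_esupE => /ereal_inf_lt[_ [N _ <-] h]; exists N => n Nn.
by apply: le_trans (ltW h); apply: ereal_sup_ubound; exists n.
Qed.

Lemma limn_esup_le u c : (exists N, forall n, (N <= n)%N -> (u n <= c)%E) ->
  (limn_esup u <= c)%E.
Proof.
move=> [N hN]; rewrite limn_esupE; apply: (@le_trans _ _ (esups u N)).
  by apply: ereal_inf_lbound; exists N.
by apply: ge_ereal_sup => _ [n /= Nn <-]; exact: hN.
Qed.

Lemma limn_einf_gt u c : (c < limn_einf u)%E ->
  exists N, forall n, (N <= n)%N -> (c <= u n)%E.
Proof.
rewrite limn_einfE => /ereal_sup_gt[_ [N _ <-] h]; exists N => n Nn.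
by apply: le_trans (ltW h) _; apply: ereal_inf_lbound; exists n.
Qed.

Lemma limn_einf_ge u c : (exists N, forall n, (N <= n)%N -> (c <= u n)%E) ->
  (c <= limn_einf u)%E.
Proof.
move=> [N hN]; rewrite limn_einfE; apply: (@le_trans _ _ (einfs u N)).
  by apply: le_ereal_inf_tmp => _ [n /= Nn <-]; exact: hN.
by apply: ereal_sup_ubound; exists N.
Qed.

End limsup_liminf.

Section sequence_asymptotics.
Variables (R : realType) (p : R).
Hypothesis p0 : 0 < p.
Implicit Types (x y t : R) (a b c : R).

Lemma powR_root t : 0 <= t -> (t `^ p^-1) `^ p = t.
Proof. by move=> t0; rewrite -powRrM mulVf ?gt_eqF// powRr1. Qed.

Lemma ltr_powRl x y : 0 <= x -> 0 <= y -> x `^ p < y `^ p -> x < y.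
Proof.
move=> x0 y0; apply: contraTT; rewrite -!leNgt => h.
by rewrite ge0_ler_powR// ltW.
Qed.

Lemma exists_nat_ge x : exists N : nat, forall n, (N <= n)%N -> x <= n%:R.
Proof.
exists (Num.truncn x).+1 => n Nn; rewrite (le_trans (ltW (truncnS_gt x)))//.
by rewrite ler_nat.
Qed.

(** m^2 = O(n) implies m = o(n): this makes the indices spent on linear conditions negligible. *)
Lemma sqr_nat_small (c v : R) : 0 < v -> exists N : nat, forall n m : nat, (N <= n)%N ->
  m%:R ^+ 2 <= c * n.+1%:R -> m%:R <= v * n.+1%:R.
Proof.
move=> v0; have [N hN] := exists_nat_ge (c / v ^+ 2).
exists N => n m Nn h.
have n0 : 0 < n.+1%:R :> R by [].
rewrite -(@ler_pXn2r _ 2) ?nnegrE ?mulr_ge0 ?(ltW v0) ?ler0n//.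
rewrite (le_trans h)// exprMn expr2 (expr2 n.+1%:R) mulrA -!expr2 ler_wpM2r ?ler0n//.
rewrite -ler_pdivrMl ?exprn_gt0// mulrC; apply: hN.
by rewrite (leq_trans Nn).
Qed.

Section upper.
Variables (lamA lamB lamT : nat -> R).
Hypotheses (lamA0 : forall n, 0 <= lamA n) (lamB0 : forall n, 0 <= lamB n).
Hypotheses (lamT0 : forall n, 0 <= lamT n).
Hypothesis lamT_le : forall m n, (m <= n)%N -> lamT n <= lamT m.
(** [m] stands for the number of linear conditions. Its bound makes it O(s^(-p/2)), negligible
    against s^(-p), the natural order of the number of eigenvalues above s. *)
Hypothesis compare : forall rho, 0 < rho < 1 -> exists c0 : R,
  forall s, 0 < s <= 1 -> exists m : nat, m%:R ^+ 2 * s `^ p <= c0 /\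
    forall i j, lamA i <= rho * s -> lamB j <= rho * s -> lamT (i + j + m) <= s.

(** Inverts the asymptotic bound: the level t^(1/p) is reached at an index of size a / t, up to the
    start [n0] of the bound. *)
Lemma first_small (lam : nat -> R) a n0 t : (forall n, 0 <= lam n) -> 0 <= a -> 0 < t ->
  (forall n, (n0 <= n)%N -> n.+1%:R * lam n `^ p <= a) ->
  exists2 i : nat, i%:R <= n0%:R + a / t & forall s, 0 <= s -> s `^ p = t -> lam i <= s.
Proof.
move=> l0 a0 t0 hlam; set x := a / t.
have x0 : 0 <= x by rewrite divr_ge0// ltW.
have xt : (Num.truncn x)%:R <= x by rewrite truncn_le.
have xt' : x < (Num.truncn x).+1%:R by exact: truncnS_gt.
exists (n0 + Num.truncn x)%N; first by rewrite natrD; lra.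
move=> s s0 st; rewrite ltW//; apply: ltr_powRl => //; rewrite st.
set i := (_ + _)%N; have := hlam i (leq_addr _ _).
have : x < i.+1%:R by rewrite (lt_le_trans xt')// ler_nat ltnS leq_addl.
rewrite /x ltr_pdivrMr// => h1 h2.
rewrite -(@ltr_pM2l _ i.+1%:R)//.
by rewrite (le_lt_trans h2).
Qed.

(** At index n the comparison is made at the level s with s^p = c / (n + 1). The indices that [lamA]
    and [lamB] need to fall to rho s add up to a fraction w < 1 of n + 1, up to constants; the
    remaining 1 - w is shared equally between m and the constants. *)
Lemma limsup_upper a b c : 0 <= a -> 0 <= b -> a + b < c ->
  (exists n0, forall n, (n0 <= n)%N -> n.+1%:R * lamA n `^ p <= a) ->
  (exists n0, forall n, (n0 <= n)%N -> n.+1%:R * lamB n `^ p <= b) ->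
  exists n0, forall n, (n0 <= n)%N -> n.+1%:R * lamT n `^ p <= c.
Proof.
move=> a0 b0 abc [nA hA] [nB hB].
have c0 : 0 < c by lra.
set th := (a + b) / c.
have th0 : 0 <= th by rewrite divr_ge0// ?addr_ge0// ltW.
have th1 : th < 1 by rewrite ltr_pdivrMr// mul1r.
(* [th'] lies strictly between (a + b) / c and 1, so that both its p-th root [rho] and the ratio w =
   th / th' are below 1. *)
pose th' := (th + 1) / 2.
have th'0 : 0 < th' by rewrite /th'; lra.
have th'1 : th' < 1 by rewrite /th'; lra.
have thth' : th < th' by rewrite /th'; lra.
pose rho := th' `^ p^-1.
have rho0 : 0 < rho by rewrite powR_gt0.
have rhop : rho `^ p = th' by rewrite powR_root// ltW.
have rho1 : rho < 1.
  by apply: ltr_powRl; rewrite ?(ltW rho0)// powR1 rhop.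
have [|c1 hc1] := compare (rho := rho); first by rewrite rho0.
set w := th / th'.
have w1 : w < 1 by rewrite ltr_pdivrMr// mul1r.
pose v := (1 - w) / 2.
have v0 : 0 < v by rewrite /v; lra.
have [N1 hN1] := exists_nat_ge c.
have [N2 hN2] := sqr_nat_small (c1 / c) v0.
have [N3 hN3] := exists_nat_ge ((nA%:R + nB%:R + 1) / v).
exists (maxn N1 (maxn N2 N3)) => n; rewrite !geq_max => /and3P[n1 n2 n3].
have nS : 0 < n.+1%:R :> R by [].
set y := c / n.+1%:R.
have y0 : 0 < y by rewrite divr_gt0.
have y1 : y <= 1 by rewrite ler_pdivrMr// mul1r hN1// (leq_trans n1).
pose s := y `^ p^-1.
have s0 : 0 < s by rewrite powR_gt0.
have sp : s `^ p = y by rewrite powR_root// ltW.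
have s1 : s <= 1.
  rewrite leNgt; apply/negP => h.
  have : 1 `^ p < s `^ p by rewrite gt0_ltr_powR// nnegrE// ltW.
  by rewrite powR1 sp ltNge y1.
have [|m [hm hU]] := hc1 s; first by rewrite s0.
have rsp : (rho * s) `^ p = th' * y by rewrite powRM ?(ltW rho0) ?(ltW s0)// rhop sp.
have ty0 : 0 < th' * y by rewrite mulr_gt0.
have [i hi Ai] := first_small lamA0 a0 ty0 hA.
have [j hj Bj] := first_small lamB0 b0 ty0 hB.
have rs0 : 0 <= rho * s by rewrite mulr_ge0 ?ltW.
have {}hU := hU i j (Ai _ rs0 rsp) (Bj _ rs0 rsp).
have hmv : m%:R <= v * n.+1%:R.
  apply: hN2 => //; move: hm; rewrite sp /y mulrA ler_pdivrMr// => hm.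
  by rewrite mulrAC ler_pdivlMr.
have ijm : (i + j + m <= n)%N.
  rewrite -ltnS -(ltr_nat R) !natrD.
  have e1 : a / (th' * y) + b / (th' * y) = w * n.+1%:R.
    by rewrite /w /th /y; field; rewrite !gt_eqF//= nat1r gt_eqF.
  have : (nA%:R + nB%:R + 1) / v <= n.+1%:R by rewrite hN3// (leq_trans n3).
  rewrite ler_pdivrMr// => e2.
  have : v * n.+1%:R + v * n.+1%:R + w * n.+1%:R = n.+1%:R.
    have vw : v + v + w = 1 by rewrite /v -splitr subrK.
    by rewrite -[RHS]mul1r -vw !mulrDl.
  by move: hmv e1 e2 hi hj; move: (v) (w) (a / _) (b / _) => x1 x2 x3 x4; clear; lra.
have := le_trans (lamT_le ijm) hU => Ts.
rewrite -ler_pdivlMl// mulrC -/y -sp ge0_ler_powR ?nnegrE ?(ltW p0) ?(ltW s0)//.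
Qed.

End upper.

Section lower.
Variables (lamA lamB lamT : nat -> R).
Hypotheses (lamA0 : forall n, 0 <= lamA n) (lamB0 : forall n, 0 <= lamB n).
Hypothesis lamA_le : forall m n, (m <= n)%N -> lamA n <= lamA m.
Hypothesis lamB_le : forall m n, (m <= n)%N -> lamB n <= lamB m.
Hypothesis compare : forall rho, 1 < rho -> exists c0 : R,
  forall s, 0 < s <= 1 -> exists m : nat, m%:R ^+ 2 * s `^ p <= c0 /\
    forall i j n, (forall k, (k < i)%N -> rho * s < lamA k) ->
      (forall k, (k < j)%N -> rho * s < lamB k) -> (n + m < i + j)%N -> s < lamT n.

(** The strict inequality [s < lam k] costs one index: i is the integer part of a / t minus 1, which
    together with truncation gives the 2. If that integer part is at most n0 + 1, then i = 0 and
    there is nothing to claim. *)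
Lemma last_large (lam : nat -> R) a n0 t : (forall n, 0 <= lam n) ->
  (forall m n, (m <= n)%N -> lam n <= lam m) -> 0 <= a -> 0 < t ->
  (forall n, (n0 <= n)%N -> a <= n.+1%:R * lam n `^ p) ->
  exists2 i : nat, a / t <= i%:R + n0%:R + 2 &
    forall s, 0 <= s -> s `^ p = t -> forall k, (k < i)%N -> s < lam k.
Proof.
move=> l0 lle a0 t0 hlam; set x := a / t.
have x0 : 0 <= x by rewrite divr_ge0// ltW.
have xt : (Num.truncn x)%:R <= x by rewrite truncn_le.
have xt' : x < (Num.truncn x).+1%:R by exact: truncnS_gt.
have [h|h] := leqP (Num.truncn x) n0.+1.
  exists 0%N => //; rewrite add0r ltW// (lt_le_trans xt')//.
  by rewrite -(natrD _ _ 2) ler_nat addn2 ltnS.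
case tE : (Num.truncn x) h xt xt' => [//|i] h xt xt'.
exists i; first by rewrite -natr1 -natr1 in xt' *; have := ler0n R n0; lra.
move=> s s0 st k ki; apply: (lt_le_trans _ (lle _ _ (_ : (k <= i.-1)%N))); last by lia.
apply: ltr_powRl => //; rewrite st.
have h2 : a <= i%:R * lam i.-1 `^ p.
  by have := hlam i.-1; rewrite prednK; [apply; lia|lia].
have i0 : 0 < i%:R :> R by rewrite ltr0n; lia.
rewrite -(ltr_pM2l i0) (lt_le_trans _ h2)// -ltr_pdivlMr// -/x.
by rewrite (lt_le_trans _ xt)// ltr_nat.
Qed.

(** Mirror image of [limsup_upper]: [th'] lies strictly between 1 and (a + b) / c, and the surplus w
    - 1 of indices pays for m and for the constants. *)
Lemma liminf_lower a b c : 0 <= a -> 0 <= b -> 0 < c -> c < a + b ->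
  (exists n0, forall n, (n0 <= n)%N -> a <= n.+1%:R * lamA n `^ p) ->
  (exists n0, forall n, (n0 <= n)%N -> b <= n.+1%:R * lamB n `^ p) ->
  exists n0, forall n, (n0 <= n)%N -> c <= n.+1%:R * lamT n `^ p.
Proof.
move=> a0 b0 c0 abc [nA hA] [nB hB].
set th := (a + b) / c.
have th1 : 1 < th by rewrite ltr_pdivlMr// mul1r.
pose th' := (th + 1) / 2.
have th'0 : 0 < th' by rewrite /th'; lra.
have th'1 : 1 < th' by rewrite /th'; lra.
have thth' : th' < th by rewrite /th'; lra.
pose rho := th' `^ p^-1.
have rho0 : 0 < rho by rewrite powR_gt0.
have rhop : rho `^ p = th' by rewrite powR_root// ltW.
have rho1 : 1 < rho.
  by apply: ltr_powRl; rewrite ?(ltW rho0)// powR1 rhop.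
have [c1 hc1] := compare rho1.
set w := th / th'.
have w1 : 1 < w by rewrite ltr_pdivlMr// mul1r.
pose v := (w - 1) / 2.
have v0 : 0 < v by rewrite /v; lra.
have [N1 hN1] := exists_nat_ge c.
have [N2 hN2] := sqr_nat_small (c1 / c) v0.
(* The 4 collects the two losses of 2 in [last_large]. *)
have [N3 hN3] := exists_nat_ge ((nA%:R + nB%:R + 4) / v).
exists (maxn N1 (maxn N2 N3)) => n; rewrite !geq_max => /and3P[n1 n2 n3].
have nS : 0 < n.+1%:R :> R by [].
set y := c / n.+1%:R.
have y0 : 0 < y by rewrite divr_gt0.
have y1 : y <= 1 by rewrite ler_pdivrMr// mul1r hN1// (leq_trans n1).
pose s := y `^ p^-1.
have s0 : 0 < s by rewrite powR_gt0.
have sp : s `^ p = y by rewrite powR_root// ltW.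
have s1 : s <= 1.
  rewrite leNgt; apply/negP => h.
  have : 1 `^ p < s `^ p by rewrite gt0_ltr_powR// nnegrE// ltW.
  by rewrite powR1 sp ltNge y1.
have [|m [hm hL]] := hc1 s; first by rewrite s0.
have rsp : (rho * s) `^ p = th' * y by rewrite powRM ?(ltW rho0) ?(ltW s0)// rhop sp.
have ty0 : 0 < th' * y by rewrite mulr_gt0.
have [i hi Ai] := last_large lamA0 lamA_le a0 ty0 hA.
have [j hj Bj] := last_large lamB0 lamB_le b0 ty0 hB.
have rs0 : 0 <= rho * s by rewrite mulr_ge0 ?ltW.
have {}hL := hL i j n (Ai _ rs0 rsp) (Bj _ rs0 rsp).
have hmv : m%:R <= v * n.+1%:R.
  apply: hN2 => //; move: hm; rewrite sp /y mulrA ler_pdivrMr// => hm.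
  by rewrite mulrAC ler_pdivlMr.
have {}hL : s < lamT n.
  apply: hL; rewrite -(ltr_nat R) !natrD.
  have e1 : a / (th' * y) + b / (th' * y) = w * n.+1%:R.
    by rewrite /w /th /y; field; rewrite !gt_eqF//= nat1r gt_eqF.
  have : (nA%:R + nB%:R + 4) / v <= n.+1%:R by rewrite hN3// (leq_trans n3).
  rewrite ler_pdivrMr// => e2.
  have : w * n.+1%:R = n.+1%:R + v * n.+1%:R + v * n.+1%:R.
    have -> : w = 1 + v + v by rewrite /v -addrA -splitr addrC subrK.
    by rewrite !mulrDl mul1r.
  rewrite -[in X in _ = X -> _]natr1.
  by move: hmv e1 e2 hi hj; move: (v) (w) (a / _) (b / _) => x1 x2 x3 x4; clear; lra.
rewrite -ler_pdivrMl// mulrC -/y -sp ge0_ler_powR ?nnegrE ?(ltW p0) ?(ltW s0)//.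
  by rewrite (le_trans (ltW s0))// ltW.
exact: ltW.
Qed.

End lower.
End sequence_asymptotics.

(** * Rapidly decaying products at a given spectral level *)

Section rapid_products.
Variables (R : realType) (V : lmodType R[i]) (ip : semi_ip V).
Implicit Types (A B C : V -> V).
Local Notation rip := (re_ip ip).
Local Notation nsq := (sqnorm ip).
Local Notation nm := (seminorm ip).

Lemma rapid0 B : rapid ip (fun=> 0) B.
Proof.
move=> q; exists 0, 0%N; split=> // N _; exists 'I_0, (fun _ _ => 0); split.
- by rewrite card_ord.
- by case.
- by move=> f g _; rewrite /re_ip ip0l normr0 !mul0r.
Qed.

Lemma rapidD A B C : rapid ip A C -> rapid ip B C ->
  rapid ip (fun f => A f + B f) C.
Proof.
move=> hA hB q; have [C1 [K1 [C10 {}hA]]] := hA q.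
have [C2 [K2 [C20 {}hB]]] := hB q.
exists (C1 + C2), (K1 + K2)%N; split; first exact: addr_ge0.
move=> N N0; have [I1 [phi1 [c1 l1 h1]]] := hA _ N0.
have [I2 [phi2 [c2 l2 h2]]] := hB _ N0.
exists (I1 + I2)%type, (fun x => match x with inl x => phi1 x | inr x => phi2 x end).
split=> [|[]//|f g hf]; first by rewrite card_sum mulnDl leq_add.
rewrite ripDl (le_trans (ler_normD _ _))// !mulrDl lerD//.
  by apply: h1 => x; exact: (hf (inl x)).
by apply: h2 => x; exact: (hf (inr x)).
Qed.

Lemma compact_on0 : compact_on ip (fun=> 0).
Proof.
move=> u _; exists id, 0; split=> //; apply/limit_ofP => e e0; exists 0%N => n _.
by rewrite subr0 nm0.
Qed.

Lemma compact_onD A B : compact_on ip A -> compact_on ip B ->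
  compact_on ip (fun f => A f + B f).
Proof.
move=> hA hB u hu; have [k [g [hk hg]]] := hA u hu.
have [k' [g' [hk' hg']]] := hB (u \o k) (fun n => hu (k n)).
exists (k \o k'), (g + g'); split; first by move=> m n mn; apply/hk/hk'.
exact: (limit_ofD (limit_of_subseq hk' hg) hg').
Qed.

Lemma compact_on_sum (I : Type) (A : I -> V -> V) (s : seq I) :
  (forall i, compact_on ip (A i)) -> compact_on ip (fun f => \sum_(i <- s) A i f).
Proof.
move=> cA; elim: s => [|i s ih].
  by under eq_fun do rewrite big_nil; exact: compact_on0.
by under eq_fun do rewrite big_cons; exact: compact_onD (cA i) ih.
Qed.

(* Choosing [N] of order [s^(-p/2)], the error is [O(s^2)] with a number of
   conditions that is negligible with respect to [s^(-p)]. *)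
Lemma rapid_scale A B (p kappa : R) : rapid ip A B -> 0 < p -> 0 < kappa ->
  exists c0 : R, forall s, 0 < s <= 1 ->
    exists (I : finType) (phi : I -> V -> R[i]^o) (eta : R),
    [/\ #|I|%:R ^+ 2 * s `^ p <= c0, forall x, lin_fun (phi x),
        0 <= eta <= kappa * s ^+ 2 &
        forall f g, (forall x, phi x f = 0) ->
          `|rip (A f) (B g)| <= eta * nm f * nm g].
Proof.
move=> hAB p0 k0.
(* Since p q / 2 >= 2, the number z = s^(p/2) satisfies z^q <= s^2 for s <= 1, while N of order b /
   z keeps N^2 s^p bounded. *)
pose q := (Num.truncn (4 / p)).+1.
have q4 : 2 <= p / 2 * q%:R.
  have : 4 / p < q%:R by exact: truncnS_gt.
  rewrite ltr_pdivrMr//; lra.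
have [C [K [C0 hC]]] := hAB q.
(* b >= 1 gives b <= b^q, so that C / N^q <= kappa z^q as soon as N >= b / z. *)
pose b := Num.max 1 (C / kappa).
have b1 : 1 <= b by rewrite le_max lexx.
have b0 : 0 < b by rewrite (lt_le_trans ltr01).
have bC : C <= b ^+ q * kappa.
  rewrite -ler_pdivrMr// (@le_trans _ _ b)//; first by rewrite le_max lexx orbT.
  exact: ler_eXnr.
exists ((K%:R * (b + 1)) ^+ 2) => s /andP[s0 s1].
pose z := s `^ (p / 2).
have z0 : 0 < z by rewrite powR_gt0.
have z1 : z <= 1.
  by rewrite -(powRr0 s) ger_powR ?s0// divr_ge0// ltW.
have zp : z ^+ 2 = s `^ p.
  by rewrite -powR_mulrn ?ltW// -powRrM divfK.
have zq : z ^+ q <= s ^+ 2.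
  by rewrite -!powR_mulrn ?(ltW z0) ?(ltW s0)// -powRrM ger_powR ?s0.
pose N := (Num.truncn (b / z)).+1.
have Nl : b / z <= N%:R by rewrite ltW// truncnS_gt.
have bz0 : 0 <= b / z by rewrite divr_ge0// ltW.
have Nu : N%:R <= (b + 1) / z.
  rewrite -natr1 mulrDl lerD ?truncn_le// div1r invr_ge1 ?unitf_gt0 ?z1//.
have [I [phi [cI lphi hphi]]] := hC N isT.
exists I, phi, (C / N%:R ^+ q); split=> //.
- rewrite -zp -exprMn lerXn2r ?nnegrE ?mulr_ge0 ?ler0n ?addr_ge0 ?(ltW z0) ?(ltW b0)//.
  rewrite -ler_pdivlMr// -mulrA (@le_trans _ _ (K * N)%:R)//; first by rewrite ler_nat.
  by rewrite natrM ler_wpM2l.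
- rewrite divr_ge0 ?exprn_ge0//= ler_pdivrMr ?exprn_gt0//.
  have : (b / z) ^+ q <= N%:R ^+ q by rewrite lerXn2r ?nnegrE.
  rewrite expr_div_n ler_pdivrMr ?exprn_gt0// => h.
  rewrite (le_trans bC)// (@le_trans _ _ (N%:R ^+ q * z ^+ q * kappa))//.
    by rewrite ler_wpM2r// ltW.
  have -> : kappa * s ^+ 2 * N%:R ^+ q = N%:R ^+ q * s ^+ 2 * kappa by ring.
  by rewrite ler_wpM2r ?(ltW k0)// ler_wpM2l// exprn_ge0.
Qed.

End rapid_products.

Section weighted_limits.
Variables (R : realType) (p : R).
Implicit Types lam : nat -> R.

Definition wlimsup lam := limn_esup (fun n => (n.+1%:R * lam n `^ p)%:E).
Definition wliminf lam := limn_einf (fun n => (n.+1%:R * lam n `^ p)%:E).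

Lemma wlimsup_ge0 lam : (0 <= wlimsup lam)%E.
Proof.
apply: le_trans (limn_einf_sup _); apply: limn_einf_ge; exists 0%N => n _.
by rewrite lee_fin mulr_ge0// powR_ge0.
Qed.

Lemma wliminf_ge0 lam : (0 <= wliminf lam)%E.
Proof.
apply: limn_einf_ge; exists 0%N => n _.
by rewrite lee_fin mulr_ge0// powR_ge0.
Qed.

Lemma wlimsup_eventually lam a : (wlimsup lam < a%:E)%E ->
  exists n0, forall n, (n0 <= n)%N -> n.+1%:R * lam n `^ p <= a.
Proof. by move/limn_esup_lt => [N hN]; exists N => n /hN; rewrite lee_fin. Qed.

Lemma wliminf_eventually lam a : (a%:E < wliminf lam)%E ->
  exists n0, forall n, (n0 <= n)%N ->
    Num.max a 0 <= n.+1%:R * lam n `^ p.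
Proof.
move/limn_einf_gt => [N hN]; exists N => n /hN; rewrite lee_fin ge_max => ->.
by rewrite mulr_ge0// powR_ge0.
Qed.

Lemma wlimsup_leD lamA lamB lamT :
  (forall a b c, 0 <= a -> 0 <= b -> a + b < c ->
    (exists n0, forall n, (n0 <= n)%N -> n.+1%:R * lamA n `^ p <= a) ->
    (exists n0, forall n, (n0 <= n)%N -> n.+1%:R * lamB n `^ p <= b) ->
    exists n0, forall n, (n0 <= n)%N -> n.+1%:R * lamT n `^ p <= c) ->
  (wlimsup lamT <= wlimsup lamA + wlimsup lamB)%E.
Proof.
move=> h; have := wlimsup_ge0 lamA; have := wlimsup_ge0 lamB.
have [->|Bfin] := eqVneq (wlimsup lamB) +oo%E.
  by move=> _ A0; rewrite addey ?leey// gt_eqF// (lt_le_trans _ A0)// ltNy0.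
have [->|Afin] := eqVneq (wlimsup lamA) +oo%E.
  by move=> B0 _; rewrite addye ?leey// gt_eqF// (lt_le_trans _ B0)// ltNy0.
case EA : (wlimsup lamA) Afin => [x| |]//; case EB : (wlimsup lamB) Bfin => [y| |]// _ _.
rewrite !lee_fin => y0 x0; apply/lee_addgt0Pr => e e0.
apply: limn_esup_le; have [|||||N hN] := h (x + e / 4) (y + e / 4) (x + y + e).
- lra.
- lra.
- lra.
- by apply: wlimsup_eventually; rewrite EA lte_fin; lra.
- by apply: wlimsup_eventually; rewrite EB lte_fin; lra.
by exists N => n /hN; rewrite -!EFinD lee_fin.
Qed.

Lemma wliminf_geD lamA lamB lamT :
  (forall a b c, 0 <= a -> 0 <= b -> 0 < c -> c < a + b ->
    (exists n0, forall n, (n0 <= n)%N -> a <= n.+1%:R * lamA n `^ p) ->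
    (exists n0, forall n, (n0 <= n)%N -> b <= n.+1%:R * lamB n `^ p) ->
    exists n0, forall n, (n0 <= n)%N -> c <= n.+1%:R * lamT n `^ p) ->
  (wliminf lamA + wliminf lamB <= wliminf lamT)%E.
Proof.
move=> h; rewrite leNgt; apply/negP => lt.
(* c lies above [wliminf lamT] and below a + b, where a and b are either below the respective limits
   or nonpositive, hence trivially valid. When one limit is infinite, the other summand can be 0. *)
have [c c0 [a [b [abc ha hb]]]] : exists2 c : R, (wliminf lamT < c%:E)%E &
    exists a b : R, [/\ c < a + b, (a%:E < wliminf lamA)%E \/ a <= 0 &
      (b%:E < wliminf lamB)%E \/ b <= 0].
  move: lt (wliminf_ge0 lamA) (wliminf_ge0 lamB) (wliminf_ge0 lamT).
  case: (wliminf lamT) => [z| |]//; case: (wliminf lamA) => [x| |]//;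
    case: (wliminf lamB) => [y| |]//= lt x0 y0 z0.
  - move: lt x0 y0; rewrite -EFinD !(lee_fin, lte_fin) => lt x0 y0.
    exists (z + (x + y - z) / 4); first by rewrite lte_fin; lra.
    exists (x - (x + y - z) / 4), (y - (x + y - z) / 4).
    by split; [lra|left; rewrite lte_fin; lra|left; rewrite lte_fin; lra].
  - exists (z + 1); first by rewrite lte_fin; lra.
    by exists 0, (z + 2); split; [lra|right|left; rewrite ltry].
  - exists (z + 1); first by rewrite lte_fin; lra.
    by exists (z + 2), 0; split; [lra|left; rewrite ltry|right].
  - exists (z + 1); first by rewrite lte_fin; lra.
    by exists (z + 2), 0; split; [lra|left; rewrite ltry|right].
have cpos : 0 < c by rewrite -lte_fin (le_lt_trans (wliminf_ge0 lamT)).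
have ev lam x : (x%:E < wliminf lam)%E \/ x <= 0 -> exists n0, forall n,
    (n0 <= n)%N -> Num.max x 0 <= n.+1%:R * lam n `^ p.
  case=> [|x0]; first exact: wliminf_eventually.
  by exists 0%N => n _; rewrite ge_max (le_trans x0) ?mulr_ge0 ?powR_ge0.
have abc' : c < Num.max a 0 + Num.max b 0.
  by rewrite (lt_le_trans abc)// lerD// le_max lexx.
have [||N hN] := h _ _ _ _ _ cpos abc' (ev _ _ ha) (ev _ _ hb).
- by rewrite le_max lexx orbT.
- by rewrite le_max lexx orbT.
have : (c%:E <= wliminf lamT)%E.
  by apply: limn_einf_ge; exists N => n /hN; rewrite lee_fin.
by rewrite leNgt c0.
Qed.

End weighted_limits.

Section sum_asymptotics.
Variables (R : realType) (V : lmodType R[i]) (ip : semi_ip V) (p : R).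
Hypothesis p0 : 0 < p.
Implicit Types (A B T : V -> V).

Lemma sum_two_asymptotics A B T lamA lamB lamT eA eB eT :
  selfadj ip A -> selfadj ip B -> selfadj ip T ->
  spectral ip A lamA eA -> spectral ip B lamB eB -> spectral ip T lamT eT ->
  (forall f h, ip (T f) h = ip (A f) h + ip (B f) h) -> rapid ip A B ->
  (wlimsup p lamT <= wlimsup p lamA + wlimsup p lamB)%E /\
  (wliminf p lamA + wliminf p lamB <= wliminf p lamT)%E.
Proof.
move=> sA sB sT spA spB spT TE rAB; split.
  apply: wlimsup_leD => a b c a0 b0 abc; apply: limsup_upper => //.
  - exact: spectral_ge0 spA.
  - exact: spectral_ge0 spB.
  - exact: spectral_ge0 spT.
  - exact: spectral_le spT.
  (* With t = d s and kappa = d^2 (1 - rho) / 2, the bound of [sum_eigenvalue_upper] at level rho s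
     is at most s - s (1 - rho)^2 / 2. *)
  move=> rho /andP[rho0 rho1]; pose d := (1 - rho) / 4.
  have d0 : 0 < d by rewrite /d; lra.
  have k0 : 0 < d ^+ 2 * ((1 - rho) / 2) by rewrite mulr_gt0 ?exprn_gt0//; lra.
  have [c0 hc0] := rapid_scale rAB p0 k0; exists c0 => s hs.
  have [I [phi [eta [cI lphi /andP[eta0 eta1] hphi]]]] := hc0 _ hs.
  have /andP[s0 s1] := hs.
  exists #|I|; split=> // i j Ai Bj.
  have ds0 : 0 < d * s by rewrite mulr_gt0.
  have rs0 : 0 <= rho * s by rewrite mulr_ge0 ?ltW.
  have := sum_eigenvalue_upper sA sB sT spA spB spT TE lphi eta0 hphi ds0 rs0 Ai Bj.
  move=> /le_trans; apply.
  have : eta / (d * s) ^+ 2 <= (1 - rho) / 2.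
    rewrite ler_pdivrMr ?exprn_gt0// (le_trans eta1)//.
    by rewrite le_eqVlt; apply/orP; left; apply/eqP; ring.
  move=> h; have : rho * s * (1 + eta / (d * s) ^+ 2) <= rho * s * (1 + (1 - rho) / 2).
    by rewrite ler_wpM2l// lerD2l.
  move=> h2.
  have h3 : rho * s * (1 + (1 - rho) / 2) + 2 * (d * s) <= s.
    have -> : rho * s * (1 + (1 - rho) / 2) + 2 * (d * s) =
      s - s * ((1 - rho) ^+ 2 / 2) by rewrite /d; field.
    by rewrite gerBl mulr_ge0 ?divr_ge0 ?sqr_ge0 ?(ltW s0).
  by apply: le_trans h3; rewrite lerD2r.
apply: wliminf_geD => a b c a0 b0 c0 abc; apply: liminf_lower => //.
- exact: spectral_ge0 spA.
- exact: spectral_ge0 spB.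
- exact: spectral_le spA.
- exact: spectral_le spB.
(* Three errors eta / (rho s) and one error s eta / (rho s)^2, each at most (rho - 1) s / 5, stay
   below the gap (rho - 1) s. The 9 is the square of the 3 in [3 * #|I|]. *)
move=> rho rho1; have k0 : 0 < (rho - 1) / 5 by lra.
have [c1 hc1] := rapid_scale rAB p0 k0; exists (9 * c1) => s hs.
have [I [phi [eta [cI lphi /andP[eta0 eta1] hphi]]]] := hc1 _ hs.
have /andP[s0 s1] := hs.
exists (3 * #|I|)%N; split=> [|i j n Ai Bj nij].
  by rewrite natrM exprMn -mulrA -[3%:R ^+ 2]natrX ler_wpM2l.
rewrite ltNge; apply/negP => Tn.
have rs0 : 0 < rho * s by rewrite mulr_gt0; lra.
have := sum_eigenvalue_lower sA sB spA spB spT TE lphi eta0 hphi rs0 (ltW s0) Ai Bj nij Tn.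
have h1 : eta / (rho * s) <= (rho - 1) / 5 * s.
  rewrite ler_pdivrMr// (le_trans eta1)// expr2.
  have -> : (rho - 1) / 5 * s * (rho * s) = (rho - 1) / 5 * (s * s) * rho by ring.
  by rewrite ler_peMr ?(ltW rho1)// mulr_ge0 ?(ltW k0)// mulr_ge0 ?(ltW s0).
have h2 : s * (eta / (rho * s) ^+ 2) <= (rho - 1) / 5 * s.
  have -> : s * (eta / (rho * s) ^+ 2) = eta / (rho * s) / rho.
    by field; rewrite !gt_eqF//; lra.
  have r0 : 0 < rho by lra.
  by rewrite ler_pdivrMr// (le_trans h1)// ler_peMr ?(ltW rho1)// mulr_ge0 ?(ltW k0) ?(ltW s0).
have : (rho - 1) * s > 0 by rewrite mulr_gt0//; lra.
lra.
Qed.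

Lemma wlim_zero T lam e : (forall f h, ip (T f) h = 0) -> spectral ip T lam e ->
  wlimsup p lam = 0%E.
Proof.
move=> T0 sp; apply/eqP; rewrite eq_le wlimsup_ge0 andbT.
apply: limn_esup_le; exists 0%N => n _; rewrite lee_fin.
suff -> : lam n = 0 by rewrite powR0 ?mulr0// gt_eqF.
apply/eqP; rewrite eq_le (spectral_ge0 sp) andbT leNgt; apply/negP => l0.
have := spectral_eig sp n (e n); rewrite T0 (spectral_orth sp) eqxx l0 mulr1 => -[h].
by rewrite -h ltxx in l0.
Qed.

(** Induction on the list: the partial sum [T'] is again symmetric and compact, so it has a spectral
    sequence of its own, and its product with the next operator is rapid by additivity in the first
    argument. *)
Lemma sum_asymptotics (I : eqType) (A : I -> V -> V) (lam : I -> nat -> R)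
    (e : I -> nat -> V) :
  (forall i, selfadj ip (A i)) -> (forall i, compact_on ip (A i)) ->
  (forall i, spectral ip (A i) (lam i) (e i)) ->
  (forall i j, i != j -> rapid ip (A i) (A j)) ->
  forall (s : seq I) T lamT eT, uniq s -> selfadj ip T -> spectral ip T lamT eT ->
  (forall f h, ip (T f) h = \sum_(i <- s) ip (A i f) h) ->
  (wlimsup p lamT <= \sum_(i <- s) wlimsup p (lam i))%E /\
  (\sum_(i <- s) wliminf p (lam i) <= wliminf p lamT)%E.
Proof.
move=> sA cA spA rA; elim=> [|i s ih] T lamT eT.
  move=> _ sT spT TE; rewrite !big_nil; split; last exact: wliminf_ge0.
  by rewrite (wlim_zero _ spT)// => f h; rewrite TE big_nil.
move=> /= /andP[is_ us] sT spT TE; rewrite !big_cons.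
pose T' f := \sum_(j <- s) A j f.
have T'E f h : ip (T' f) h = \sum_(j <- s) ip (A j f) h by rewrite ip_suml.
have sT' : selfadj ip T'.
  by move=> f g; rewrite T'E ip_sumr; apply: eq_bigr => j _; rewrite sA.
have cT' : compact_on ip T' := compact_on_sum s cA.
have rT' : rapid ip T' (A i).
  rewrite /T'; elim: (s) is_ => [|j s' ihs].
    by move=> _; under eq_fun do rewrite big_nil; exact: rapid0.
  rewrite inE negb_or => /andP[ij /ihs h].
  by under eq_fun do rewrite big_cons; apply: rapidD => //; apply: rA; rewrite eq_sym.
have [lam' [e' sp']] := exists_spectral sT' cT'.
have [h1 h2] := ih _ _ _ us sT' sp' T'E.
have [|k1 k2] := sum_two_asymptotics sT' (sA i) sT sp' (spA i) spT _ rT'.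
  by move=> f h; rewrite TE big_cons T'E addrC.
split.
  by apply: le_trans k1 _; rewrite [leRHS](addeC (wlimsup p (lam i))); exact: (leeD2r _ h1).
by apply: le_trans _ k2; rewrite [leLHS](addeC (wliminf p (lam i))); exact: (leeD2r _ h2).
Qed.

End sum_asymptotics.

(** * Square integrable functions on the circle *)

Section square_integrable.
Context d (T : measurableType d) (R : realType) (P : probability T R).
Implicit Types (f g : T -> R).

Lemma Lfun2P f : (f \in Lfun P 2%:E) <->
  measurable_fun setT f /\ P.-integrable setT (EFin \o (fun x => f x ^+ 2)).
Proof.
split=> [h|[mf /integrableP[_ fy]]].
  split; last exact: Lfun2_integrable_sqr.
  by move: h => /[!inE] /andP[/[!inE]].
rewrite inE; apply/andP; split; rewrite inE//= /finite_norm unlock /Lnorm.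
rewrite poweR_lty//; apply: le_lt_trans fy.
by under [leRHS]eq_integral => x _ do rewrite /= normrX -powR_mulrn//.
Qed.

Lemma Lfun2_meas f : f \in Lfun P 2%:E -> measurable_fun setT f.
Proof. by move/Lfun2P => []. Qed.

Lemma Lfun2D f g : f \in Lfun P 2%:E -> g \in Lfun P 2%:E ->
  (fun x => f x + g x) \in Lfun P 2%:E.
Proof.
move=> /Lfun2P[mf If] /Lfun2P[mg Ig]; apply/Lfun2P; split.
  exact: measurable_funD.
apply: (@le_integrable _ _ _ _ _ _ _ (EFin \o (fun x => 2 * f x ^+ 2 + 2 * g x ^+ 2))) => //.
- by apply/measurable_EFinP; apply: measurable_funX; exact: measurable_funD.
- move=> x _ /=; rewrite lee_fin ger0_norm ?sqr_ge0//.
  have := sqr_ge0 (f x); have := sqr_ge0 (g x); have := sqr_ge0 (f x - g x).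
  by move=> h hg hf; rewrite ger0_norm; nra.
rewrite (_ : _ \o _ = (fun x => 2%:E * (f x ^+ 2)%:E + 2%:E * (g x ^+ 2)%:E)%E)//.
by apply: integrableD => //; apply: integrableZl.
Qed.

Lemma Lfun2_mul_bounded f g (C : R) : measurable_fun setT f ->
  {ae P, forall x, `|f x| <= C} -> g \in Lfun P 2%:E ->
  (fun x => f x * g x) \in Lfun P 2%:E.
Proof.
move=> mf fC /Lfun2P[mg /integrableP[_ Ig]]; apply/Lfun2P; split.
  exact: measurable_funM.
have mfg : measurable_fun setT (EFin \o (fun x => (f x * g x) ^+ 2)).
  by apply/measurable_EFinP; apply: measurable_funX; exact: measurable_funM.
apply/integrableP; split=> //.
apply: (@le_lt_trans _ _ (\int[P]_x ((C ^+ 2)%:E * `|(g x ^+ 2)%:E|))%E).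
  apply: ae_ge0_le_integral => //.
  - exact: measurableT_comp.
  - by move=> x _; rewrite mule_ge0// lee_fin sqr_ge0.
  - apply: emeasurable_funM; first exact: measurable_cst.
    by apply: measurableT_comp => //; apply/measurable_EFinP; exact: measurable_funX.
  apply: filterS fC => x fx _ /=; rewrite lee_fin !ger0_norm ?sqr_ge0//.
  rewrite exprMn ler_wpM2r ?sqr_ge0// -[f x ^+ 2]real_normK ?num_real//.
  by rewrite lerXn2r ?nnegrE// (le_trans _ fx).
rewrite ge0_integralZl//; last 2 first.
- by apply: measurableT_comp => //; apply/measurable_EFinP; exact: measurable_funX.
- by rewrite lee_fin sqr_ge0.
by rewrite lte_mul_pinfty// lee_fin sqr_ge0.
Qed.

Lemma Lfun2Z (a : R) g : g \in Lfun P 2%:E -> (fun x => a * g x) \in Lfun P 2%:E.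
Proof.
move=> h; apply: (@Lfun2_mul_bounded (cst a) g `|a|) => //.
exact: aeW.
Qed.

Lemma Lfun2B f g : f \in Lfun P 2%:E -> g \in Lfun P 2%:E ->
  (fun x => f x - g x) \in Lfun P 2%:E.
Proof.
move=> hf /(Lfun2Z (-1)) hg; have := Lfun2D hf hg.
by under eq_fun do rewrite mulN1r.
Qed.

Lemma Lfun2_mul_integrable f g : f \in Lfun P 2%:E -> g \in Lfun P 2%:E ->
  P.-integrable setT (EFin \o (fun x => f x * g x)).
Proof. by move=> hf hg; apply/Lfun1_integrable; exact: Lfun2_mul_Lfun1. Qed.

(* Along a sequence that is Cauchy in [L^2] at a geometric rate, the series of
   increments has a finite integral, hence converges almost everywhere. *)
Lemma riesz_fischer (u : nat -> T -> R) :
  (forall n, u n \in Lfun P 2%:E) ->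
  (forall n m, (n <= m)%N ->
    (\int[P]_x ((u m x - u n x) ^+ 2)%:E <= ((4^-1) ^+ n)%:E)%E) ->
  exists2 f, f \in Lfun P 2%:E & forall n,
    (\int[P]_x ((u n x - f x) ^+ 2)%:E <= ((4^-1) ^+ n)%:E)%E.
Proof.
move=> u2 hu; have mu n := Lfun2_meas (u2 n).
pose w n x := `|u n.+1 x - u n x|.
have mw n : measurable_fun setT (EFin \o w n).
  by apply/measurable_EFinP; apply: measurableT_comp => //; exact: measurable_funB.
have iw n : (\int[P]_x (w n x)%:E <= ((2^-1) ^+ n)%:E)%E.
  (* The inequality y <= 1 / (2a) + a y^2 / 2 with a = 2^n turns the L^2 bound 4^-n into the L^1
     bound 2^-n, the total mass being 1. *)
  pose a : R := 2 ^+ n; have a0 : 0 < a by rewrite exprn_gt0.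
  have am : measurable_fun setT (EFin \o (fun x => (u n.+1 x - u n x) ^+ 2)).
    by apply/measurable_EFinP; apply: measurable_funX; exact: measurable_funB.
  apply: (@le_trans _ _ (\int[P]_x ((a^-1 / 2)%:E +
      (a / 2)%:E * ((u n.+1 x - u n x) ^+ 2)%:E))%E).
    apply: ge0_le_integral => //.
    - by move=> x _; rewrite lee_fin normr_ge0.
    - exact: mw.
    - apply: emeasurable_funD; first exact: measurable_cst.
      by apply: emeasurable_funM => //; exact: measurable_cst.
    move=> x _; rewrite -EFinM -EFinD lee_fin /w.
    rewrite -[_ ^+ 2]real_normK ?num_real//; move: (Num.norm _) => y.
    have : 0 <= a / 2 * (y - a^-1) ^+ 2 by rewrite mulr_ge0 ?sqr_ge0// divr_ge0// ltW.
    have -> : a / 2 * (y - a^-1) ^+ 2 = a / 2 * y ^+ 2 - y + a^-1 / 2.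
      by field; rewrite gt_eqF.
    lra.
  rewrite ge0_integralD//; last 3 first.
  - by move=> x _; rewrite lee_fin divr_ge0// invr_ge0 ltW.
  - by move=> x _; rewrite -EFinM lee_fin mulr_ge0 ?sqr_ge0// divr_ge0// ltW.
  - by apply: emeasurable_funM => //; exact: measurable_cst.
  rewrite integral_cst// [X in (_ * X + _)%E](_ : _ = 1%E); last exact: probability_setT.
  rewrite mule1 ge0_integralZl//; last 2 first.
  - by move=> x _; rewrite lee_fin sqr_ge0.
  - by rewrite lee_fin divr_ge0// ltW.
  apply: (@le_trans _ _ ((a^-1 / 2)%:E + (a / 2)%:E * ((4^-1) ^+ n)%:E)%E).
    by rewrite leeD2l// lee_wpmul2l ?hu// lee_fin divr_ge0// ltW.
  rewrite -EFinM -EFinD lee_fin.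
  have -> : (4^-1 : R) ^+ n = a^-1 * a^-1.
    by rewrite /a -exprVn -exprMn; congr (_ ^+ _); lra.
  have -> : (2^-1 : R) ^+ n = a^-1 by rewrite /a exprVn.
  rewrite le_eqVlt; apply/orP; left; apply/eqP; field.
  by rewrite gt_eqF.
pose G x := (\sum_(n <oo) (w n x)%:E)%E.
have w0 n x : setT x -> (0 <= (w n x)%:E)%E by rewrite lee_fin normr_ge0.
have IG : P.-integrable setT G.
  apply/integrableP; split; first by apply: ge0_emeasurable_sum => [k x Dx _|k _]; [exact: w0|exact: mw].
  rewrite (eq_integral G) => [|x _]; last first.
    by rewrite gee0_abs//; apply: nneseries_ge0 => n _ _; exact: w0.
  rewrite integral_nneseries//; apply: (@le_lt_trans _ _ 2%:E); last by rewrite ltry.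
  apply: lime_le; first by apply: is_cvg_nneseries => n _ _; apply: integral_ge0 => x Dx; exact: w0.
  apply: nearW => n; apply: (@le_trans _ _ (\sum_(0 <= k < n) ((2^-1) ^+ k)%:E)%E).
    by apply: lee_sum => k _; exact: iw.
  rewrite sumEFin lee_fin; have -> : \sum_(0 <= k < n) (2^-1 : R) ^+ k = 2 - 2 * 2^-1 ^+ n.
    elim: n => [|n ih]; first by rewrite big_geq// expr0; lra.
    by rewrite big_nat_recr//= ih exprS; lra.
  by rewrite gerBl mulr_ge0// exprn_ge0.
(* The upper limit is defined and measurable everywhere, and it is the limit wherever the series of
   increments converges. *)
pose f x := fine (limn_esup (fun n => (u n x)%:E)).
have mf : measurable_fun setT f.
  apply: measurableT_comp => //; apply: measurable_fun_limn_esup => n.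
  exact/measurable_EFinP.
have cvgf : {ae P, forall x, u n x @[n --> \oo] --> f x}.
  have := integrable_ae measurableT IG; apply: filterS => x /(_ Logic.I) Gfin.
  have : cvgn (series (telescope (u ^~ x))).
    apply: normed_cvg; apply: nondecreasing_is_cvgn.
      apply/nondecreasing_seqP => n; rewrite /= /series /= big_nat_recr//= lerDl.
      exact: normr_ge0.
    exists (fine (G x)) => _ [n _ <-]; rewrite -lee_fin fineK// /series /= -sumEFin.
    exact: nneseries_lim_ge.
  rewrite telescopeK => /(is_cvgD (is_cvg_cst (u 0%N x))).
  have -> : (cst (u 0%N x) + [sequence u n x - u 0%N x]_n)%R = u ^~ x.
    by apply/funext => n; rewrite fctE /= subrKC.
  move=> cu.
  have ul : (u n x)%:E @[n --> \oo] --> (limn (u ^~ x))%:E.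
    by apply: cvg_EFin; [exact: nearW|exact: cu].
  by rewrite /f (cvg_limn_einf_sup ul).2.
have bound n : (\int[P]_x ((u n x - f x) ^+ 2)%:E <= ((4^-1) ^+ n)%:E)%E.
  pose h m x := ((u n x - u m x) ^+ 2)%:E.
  have mh m : measurable_fun setT (h m).
    by apply/measurable_EFinP; apply: measurable_funX; exact: measurable_funB.
  have -> : (\int[P]_x ((u n x - f x) ^+ 2)%:E = \int[P]_x limn_einf (h ^~ x))%E.
    apply: ge0_ae_eq_integral => //.
    - by apply/measurable_EFinP; apply: measurable_funX; exact: measurable_funB.
    - apply: measurableT_comp => //; apply: measurable_fun_limn_esup => m.
      exact: measurableT_comp.
    - by move=> x _; rewrite lee_fin sqr_ge0.
    - by move=> x _; apply: limn_einf_ge; exists 0%N => m _; rewrite lee_fin sqr_ge0.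
    apply: filterS cvgf => x cx _.
    have : h m x @[m --> \oo] --> ((u n x - f x) ^+ 2)%:E.
      apply: cvg_EFin; first exact: nearW.
      rewrite (_ : _ \o _ = (fun m => (u n x - u m x) * (u n x - u m x)))//.
      by rewrite expr2; apply: cvgM; apply: cvgB => //; exact: cvg_cst.
    by move/cvg_limn_einf_sup => [-> _].
  (* Fatou's lemma transfers the Cauchy bound to the limit; the lower limit is estimated at the
     indices [maxn n m], where that bound applies. *)
  apply: (le_trans (fatou P measurableT mh _)).
    by move=> m x _; rewrite lee_fin sqr_ge0.
  rewrite limn_einf_lim; apply: lime_le; first exact: is_cvg_einfs.
  apply: nearW => m; apply: ge_ereal_inf; exists (\int[P]_x h (maxn n m) x)%E.
    by exists (maxn n m) => //=; exact: leq_maxr.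
  apply: le_trans (hu _ _ (leq_maxl n m)); rewrite le_eqVlt; apply/orP; left.
  by apply/eqP/eq_integral => x _; rewrite /h -sqrrN opprB.
exists f => //.
have mD : measurable_fun setT (fun x => u 0%N x - f x) by exact: measurable_funB.
have hD : (fun x => u 0%N x - f x) \in Lfun P 2%:E.
  apply/Lfun2P; split=> //; apply/integrableP; split.
    by apply/measurable_EFinP; exact: measurable_funX.
  under eq_integral => x _ do rewrite gee0_abs ?lee_fin ?sqr_ge0//.
  by rewrite (le_lt_trans (bound 0%N))// ltry.
have -> : f = (fun x => u 0%N x - (u 0%N x - f x)).
  by apply/funext => x; rewrite subKr.
exact: Lfun2B.
Qed.

End square_integrable.

Section circle_square_integrable.
Variable R : realType.
Local Notation mu := (circle_measure R).
Local Notation fun_circle := (circle R -> R[i]).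
Implicit Types (f g w : fun_circle).

Definition cintegrable f :=
  mu.-integrable setT (EFin \o (fun z => complex.Re (f z))) /\
  mu.-integrable setT (EFin \o (fun z => complex.Im (f z))).

Lemma cint_eq f g : f =1 g -> circle_integral f = circle_integral g.
Proof. by move=> fg; congr (_ +i* _); apply: eq_Rintegral => z _; rewrite fg. Qed.

Lemma cintD f g : cintegrable f -> cintegrable g ->
  circle_integral (fun z => f z + g z) = circle_integral f + circle_integral g.
Proof.
move=> [f1 f2] [g1 g2]; rewrite /circle_integral.
under eq_Rintegral do rewrite cReD.
under [X in _ +i* X]eq_Rintegral do rewrite cImD.
by rewrite !RintegralD.
Qed.

Lemma cintZ c f : cintegrable f ->
  circle_integral (fun z => c * f z) = c * circle_integral f.
Proof.
move=> [f1 f2]; rewrite /circle_integral.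
under eq_Rintegral do rewrite cReM.
under [X in _ +i* X]eq_Rintegral do rewrite cImM.
have I1 (a : R) (h : circle R -> R) : mu.-integrable setT (EFin \o h) ->
    mu.-integrable setT (EFin \o (fun z => a * h z)).
  move=> hh; rewrite (_ : _ \o _ = (fun z => a%:E * (h z)%:E)%E)//.
  exact: integrableZl.
rewrite RintegralB ?RintegralD ?RintegralZl//; do ?exact: I1.
by case: c.
Qed.

Lemma cintJ f : cintegrable f ->
  circle_integral (fun z => (f z)^*%C) = (circle_integral f)^*%C.
Proof.
move=> [f1 f2]; rewrite /circle_integral /=.
under eq_Rintegral do rewrite cReJ.
under [X in _ +i* X]eq_Rintegral do rewrite cImJ -mulN1r.
by rewrite RintegralZl// mulN1r.
Qed.

Lemma cLfun2D f g : cLfun 2%:E f -> cLfun 2%:E g -> cLfun 2%:E (f + g).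
Proof.
move=> [f1 f2] [g1 g2]; split.
  by under eq_fun do rewrite cReD; exact: Lfun2D.
by under eq_fun do rewrite cImD; exact: Lfun2D.
Qed.

Lemma cLfun2_mulJ f g : cLfun 2%:E f -> cLfun 2%:E g ->
  cintegrable (fun z => f z * (g z)^*%C).
Proof.
move=> [f1 f2] [g1 g2]; split.
  have := integrableD measurableT (Lfun2_mul_integrable f1 g1) (Lfun2_mul_integrable f2 g2).
  by congr (mu.-integrable _ _); apply/funext => z /=; rewrite cReM cReJ cImJ mulrN opprK.
have := integrableB measurableT (Lfun2_mul_integrable f2 g1) (Lfun2_mul_integrable f1 g2).
congr (mu.-integrable _ _); apply/funext => z /=.
by rewrite cImM cReJ cImJ mulrN addrC.
Qed.

Lemma inner_addl f g h : cLfun 2%:E f -> cLfun 2%:E g -> cLfun 2%:E h ->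
  inner (f + g) h = inner f h + inner g h.
Proof.
move=> f2 g2 h2; rewrite /inner -cintD; [|exact: cLfun2_mulJ|exact: cLfun2_mulJ].
by apply: cint_eq => z; rewrite -mulrDl.
Qed.

Lemma inner_scalel c f h : cLfun 2%:E f -> cLfun 2%:E h ->
  inner (c *: f) h = c * inner f h.
Proof.
move=> f2 h2; rewrite /inner -cintZ; last exact: cLfun2_mulJ.
by apply: cint_eq => z; rewrite mulrA.
Qed.

Lemma innerJ f g : cLfun 2%:E f -> cLfun 2%:E g -> (inner f g)^*%C = inner g f.
Proof.
move=> f2 g2; rewrite /inner -cintJ; last exact: cLfun2_mulJ.
by apply: cint_eq => z; rewrite conjcM conjcK mulrC.
Qed.

Lemma inner_ge0 f : 0 <= complex.Re (inner f f).
Proof. by apply: Rintegral_ge0 => z _; rewrite mulcJ /= addr_ge0 ?sqr_ge0. Qed.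

Definition cmeasurable f := measurable_fun setT (fun z => complex.Re (f z)) /\
  measurable_fun setT (fun z => complex.Im (f z)).

Lemma cLfun2_meas f : cLfun 2%:E f -> cmeasurable f.
Proof. by move=> [/Lfun2_meas f1 /Lfun2_meas f2]. Qed.

Lemma cmeasurable_cnorm2 f : cmeasurable f ->
  measurable_fun setT (EFin \o (fun z => cnorm2 (f z))).
Proof.
move=> [f1 f2]; apply/measurable_EFinP; apply: measurable_funD; exact: measurable_funX.
Qed.

Lemma innerE f : cLfun 2%:E f ->
  ((complex.Re (inner f f))%:E = \int[mu]_z (cnorm2 (f z))%:E)%E.
Proof.
move=> f2; have [h _] := cLfun2_mulJ f2 f2.
rewrite /inner /circle_integral /= /Rintegral fineK; last exact: integrable_fin_num.
by apply: eq_integral => z _; rewrite mulcJ.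
Qed.

Lemma cLfun2P f : cLfun 2%:E f <->
  cmeasurable f /\ (\int[mu]_z (cnorm2 (f z))%:E < +oo)%E.
Proof.
split=> [f2|[[f1 f2] fy]].
  by split; [exact: cLfun2_meas|rewrite -innerE// ltry].
have sq (r : circle R -> R) : measurable_fun setT r ->
    (forall z, r z ^+ 2 <= cnorm2 (f z)) -> r \in Lfun mu 2%:E.
  move=> mg gf; apply/Lfun2P; split=> //; apply/integrableP; split.
    by apply/measurable_EFinP; exact: measurable_funX.
  apply: le_lt_trans fy; apply: ge0_le_integral => //.
  - by apply: measurableT_comp => //; apply/measurable_EFinP; exact: measurable_funX.
  - exact: cmeasurable_cnorm2.
  - by move=> z _ /=; rewrite lee_fin ger0_norm ?sqr_ge0.
by split; apply: sq => // z; rewrite /cnorm2 ?lerDl ?lerDr sqr_ge0.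
Qed.

Lemma cmeasurableM f g : cmeasurable f -> cmeasurable g ->
  cmeasurable (fun z => f z * g z).
Proof.
move=> [f1 f2] [g1 g2]; split.
  by under eq_fun do rewrite cReM; apply: measurable_funB; exact: measurable_funM.
by under eq_fun do rewrite cImM; apply: measurable_funD; exact: measurable_funM.
Qed.

Lemma cmeasurableD f g : cmeasurable f -> cmeasurable g ->
  cmeasurable (fun z => f z + g z).
Proof.
move=> [f1 f2] [g1 g2]; split.
  by under eq_fun do rewrite cReD; exact: measurable_funD.
by under eq_fun do rewrite cImD; exact: measurable_funD.
Qed.

Lemma cmeasurable_cst c : cmeasurable (cst c).
Proof. by split; exact: measurable_cst. Qed.

Lemma cLfun2_mul_bounded (C : R) w f : cmeasurable w ->
  {ae mu, forall z, cnorm2 (w z) <= C ^+ 2} -> cLfun 2%:E f ->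
  cLfun 2%:E (fun z => w z * f z) /\
  complex.Re (inner (fun z => w z * f z) (fun z => w z * f z)) <=
    C ^+ 2 * complex.Re (inner f f).
Proof.
move=> mw wC f2; have /cLfun2P[mf fy] := f2.
have mwf := cmeasurableM mw mf.
have le : (\int[mu]_z (cnorm2 (w z * f z))%:E <= (C ^+ 2)%:E * \int[mu]_z (cnorm2 (f z))%:E)%E.
  rewrite -ge0_integralZl//; last 3 first.
  - exact: cmeasurable_cnorm2.
  - by move=> z _; rewrite lee_fin cnorm2_ge0.
  - by rewrite lee_fin sqr_ge0.
  apply: ae_ge0_le_integral => //.
  - by move=> z _; rewrite lee_fin cnorm2_ge0.
  - exact: cmeasurable_cnorm2.
  - by move=> z _; rewrite -EFinM lee_fin mulr_ge0 ?cnorm2_ge0 ?sqr_ge0.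
  - by apply: emeasurable_funM; [exact: measurable_cst|exact: cmeasurable_cnorm2].
  by apply: filterS wC => z wz _; rewrite -EFinM lee_fin cnorm2M ler_wpM2r ?cnorm2_ge0.
have wf2 : cLfun 2%:E (fun z => w z * f z).
  apply/cLfun2P; split=> //; apply: le_lt_trans le _.
  by rewrite lte_mul_pinfty// lee_fin sqr_ge0.
by split=> //; rewrite -lee_fin EFinM !innerE.
Qed.

Lemma cLfun2Z c f : cLfun 2%:E f -> cLfun 2%:E (c *: f).
Proof.
move=> f2; have [|h _] := @cLfun2_mul_bounded (Num.sqrt (cnorm2 c)) (cst c) f
  (cmeasurable_cst c) _ f2; last exact: h.
by apply: aeW => z /=; rewrite sqr_sqrtr ?cnorm2_ge0.
Qed.

Lemma cLfun2_0 : cLfun 2%:E (0 : fun_circle).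
Proof. by apply/cLfun2P; split; [exact: cmeasurable_cst|rewrite integral0_eq// => z _; rewrite /cnorm2 /= expr0n /= addr0]. Qed.

Lemma inner_eq0 f : cLfun 2%:E f -> complex.Re (inner f f) = 0 <-> f = 0 %[ae mu].
Proof.
move=> f2; have /cLfun2P[mf fy] := f2; have mn := cmeasurable_cnorm2 mf.
have -> : complex.Re (inner f f) = 0 <-> (\int[mu]_z `|(cnorm2 (f z))%:E| = 0)%E.
  rewrite (eq_integral (fun z => (cnorm2 (f z))%:E)) => [|z _]; last first.
    by rewrite gee0_abs// lee_fin cnorm2_ge0.
  by rewrite -innerE//; split=> [->//|[]].
split=> [/(ae_eq_integral_abs mu measurableT mn)|h].
  apply: filterS => z /(_ Logic.I)/= [] /eqP; rewrite cnorm2_eq0 => /eqP-> //.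
apply/(ae_eq_integral_abs mu measurableT mn); apply: filterS h => z /(_ Logic.I) fz _ /=.
by rewrite fz /cnorm2 /= expr0n /= addr0.
Qed.

End circle_square_integrable.

Definition sqint (R : realType) : {pred circle R -> R[i]} :=
  [pred f | `[< cLfun 2%:E f >]].
Arguments sqint R : clear implicits.

Lemma sqintP (R : realType) (f : circle R -> R[i]) : f \in sqint R <-> cLfun 2%:E f.
Proof. by split=> /asboolP. Qed.

Lemma sqint_submod_closed (R : realType) : submod_closed (sqint R).
Proof.
split=> [|c f g /sqintP f2 /sqintP g2]; apply/sqintP; first exact: cLfun2_0.
by apply: cLfun2D => //; exact: cLfun2Z.
Qed.

HB.instance Definition _ (R : realType) :=
  GRing.isSubmodClosed.Build _ _ (sqint R) (@sqint_submod_closed R).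

(** Functions, not classes: the module structure is inherited from all functions and pointwise
    computation remains available. *)
Record L2 (R : realType) := MkL2 { L2fun :> circle R -> R[i]; _ : L2fun \in sqint R }.

HB.instance Definition _ (R : realType) := [isSub for @L2fun R].
HB.instance Definition _ (R : realType) := [Choice of L2 R by <:].
HB.instance Definition _ (R : realType) := [SubChoice_isSubLmodule of L2 R by <:].

Section L2_inner_product.
Variable R : realType.
Local Notation mu := (circle_measure R).
Implicit Types f g h : L2 R.

Lemma L2P f : cLfun 2%:E f.
Proof. by apply/sqintP; case: f. Qed.

Definition toL2 (f : circle R -> R[i]) (f2 : cLfun 2%:E f) : L2 R :=
  MkL2 ((sqintP f).2 f2).

Lemma L2_addl f g h : inner (f + g) h = inner f h + inner g h.
Proof. exact: inner_addl (L2P _) (L2P _) (L2P _). Qed.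

Lemma L2_scalel c f h : inner (c *: f) h = c * inner f h.
Proof. exact: inner_scalel (L2P _) (L2P _). Qed.

Lemma L2_conj f g : (inner f g)^*%C = inner g f.
Proof. exact: innerJ (L2P _) (L2P _). Qed.

Definition L2ip := SemiIP L2_addl L2_scalel L2_conj (fun f => inner_ge0 f).
End L2_inner_product.
Arguments L2ip R : clear implicits.

Section L2_completeness.
Variable R : realType.
Local Notation ip := (L2ip R).
Local Notation nsq := (sqnorm ip).
Local Notation nm := (seminorm ip).

(** Real and imaginary parts are completed separately by [riesz_fischer]; the factor 2 adds their
    two bounds. *)
Lemma L2_complete_geometric (F : nat -> L2 R) :
  (forall n m, (n <= m)%N -> nsq (F m - F n) <= (4^-1) ^+ n) ->
  exists f, forall n, nsq (F n - f) <= 2 * (4^-1) ^+ n.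
Proof.
move=> hF; pose mu := circle_measure R.
have hh (r : R[i] -> R) : (forall z, r z ^+ 2 <= cnorm2 z) ->
    (forall z y, r (z - y) = r z - r y) ->
    (forall n, (fun z => r (F n z)) \in Lfun mu 2%:E) ->
    exists2 s : circle R -> R, s \in Lfun mu 2%:E & forall n,
      (\int[mu]_x ((r (F n x) - s x) ^+ 2)%:E <= ((4^-1) ^+ n)%:E)%E.
  move=> rle rB r2; apply: riesz_fischer => // n m nm_.
  apply: (@le_trans _ _ (nsq (F m - F n))%:E); last by rewrite lee_fin hF.
  have /cLfun2P[mD _] := L2P (F m - F n).
  rewrite [(nsq _)%:E]innerE; last exact: L2P.
  apply: ge0_le_integral => //.
  - by move=> z _; rewrite lee_fin sqr_ge0.
  - apply/measurable_EFinP; apply: measurable_funX; apply: measurable_funB;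
      exact: Lfun2_meas (r2 _).
  - exact: cmeasurable_cnorm2.
  - by move=> z _; rewrite lee_fin -rB.
have [||n|s1 s1L h1] := hh (@complex.Re R).
- by move=> z; rewrite lerDl sqr_ge0.
- by move=> z y; rewrite cReD cReN.
- by have [] := L2P (F n).
have [||n|s2 s2L h2] := hh (@complex.Im R).
- by move=> z; rewrite lerDr sqr_ge0.
- by move=> z y; rewrite cImD cImN.
- by have [] := L2P (F n).
have fL : cLfun 2%:E (fun z => s1 z +i* s2 z) by split.
exists (toL2 fL) => n; rewrite -lee_fin [(nsq _)%:E]innerE; last exact: L2P.
have m1 : measurable_fun setT (fun z => complex.Re (F n z) - s1 z).
  by apply: measurable_funB; [have [] := cLfun2_meas (L2P (F n))|exact: Lfun2_meas s1L].
have m2 : measurable_fun setT (fun z => complex.Im (F n z) - s2 z).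
  by apply: measurable_funB; [have [] := cLfun2_meas (L2P (F n))|exact: Lfun2_meas s2L].
have -> : (\int[mu]_z (cnorm2 ((F n - toL2 fL) z))%:E = \int[mu]_z
    (((complex.Re (F n z) - s1 z) ^+ 2)%:E + ((complex.Im (F n z) - s2 z) ^+ 2)%:E))%E.
  by apply: eq_integral => z _; rewrite /cnorm2 cReD cImD cReN cImN EFinD.
rewrite ge0_integralD//; last 4 first.
- by move=> z _; rewrite lee_fin sqr_ge0.
- by apply/measurable_EFinP; exact: measurable_funX.
- by move=> z _; rewrite lee_fin sqr_ge0.
- by apply/measurable_EFinP; exact: measurable_funX.
by rewrite mulrDl mul1r EFinD leeD.
Qed.

Lemma L2_complete (F : nat -> L2 R) :
  (forall e, 0 < e -> exists N, forall n m, (N <= n)%N -> (N <= m)%N -> nm (F n - F m) < e) ->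
  exists f, limit_of ip F f.
Proof.
move=> hF.
have half_gt0 k : 0 < (2^-1 : R) ^+ k by rewrite exprn_gt0.
have : forall k, exists N, forall n m, (N <= n)%N -> (N <= m)%N ->
    nm (F n - F m) < (2^-1) ^+ k by move=> k; exact: hF.
move=> /choice[N hN].
(* Monotone ranks along which the sequence has rate 2^-k in norm, that is 4^-k for squares, as
   [L2_complete_geometric] requires. *)
pose K := fix K k := if k is k'.+1 then maxn (N k) (K k') else N 0%N.
have NK k : (N k <= K k)%N by case: k => //= k; exact: leq_maxl.
have Kmono k l : (k <= l)%N -> (K k <= K l)%N.
  move=> /subnK <-; elim: (l - k)%N => // d ih.
  by rewrite addSn (leq_trans ih)//= leq_maxr.
have sq4 k : (4^-1 : R) ^+ k = ((2^-1) ^+ k) ^+ 2.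
  by rewrite -exprM mulnC exprM; congr (_ ^+ _); rewrite expr2; lra.
have [|f hf] := @L2_complete_geometric (F \o K).
  move=> n m nm_; rewrite -nm_sqr sq4 lerXn2r ?nnegrE ?nm_ge0 ?(ltW (half_gt0 _))//.
  by rewrite ltW// hN// (leq_trans (NK n))// Kmono.
exists f; apply/limit_ofP => e e0.
have [k hk] : exists k, (2^-1 : R) ^+ k < e / 4.
  have [k hk] := exists_nat_ge (4 / e + 1); exists k.
  have k4 : 4 / e < k%:R by have := hk _ (leqnn _); lra.
  rewrite exprVn invf_plt ?posrE ?exprn_gt0 ?divr_gt0// invf_div (lt_trans k4)//.
  by rewrite -natrX ltr_nat ltn_expl.
exists (K k) => n Kn; rewrite (le_lt_trans (nm_dist _ _ (F (K k)) _))//.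
have h1 : nm (F n - F (K k)) < (2^-1) ^+ k by rewrite hN// (leq_trans (NK k)).
have h2 : nm (F (K k) - f) <= 2 * (2^-1) ^+ k.
  rewrite -(@ler_pXn2r _ 2) ?nnegrE ?nm_ge0 ?mulr_ge0 ?(ltW (half_gt0 _))// nm_sqr exprMn -sq4.
  by rewrite (le_trans (hf k))// ler_wpM2r ?exprn_ge0 ?invr_ge0//; lra.
lra.
Qed.

End L2_completeness.

(** * Integration over the circle and its reflection *)

Section circle_integrals.
Variable R : realType.
Local Notation mu := (circle_measure R).
Local Notation leb := (@lebesgue_measure R).
Local Notation arc := (`]- pi, pi]%classic : set R).
Implicit Types F : circle R -> \bar R.

Let mpi : measurable (arc : set (measurableTypeR R)).
Proof. exact: measurable_itv. Qed.

Lemma measurable_comp_expi F : measurable_fun setT F ->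
  measurable_fun setT (fun t : measurableTypeR R => F (expi t)).
Proof. by move=> mF; apply: measurableT_comp mF (@measurable_expi R). Qed.

Lemma ge0_circle_integralE F : measurable_fun setT F -> (forall z, 0 <= F z)%E ->
  (\int[mu]_z F z = ((2 * pi)^-1)%:E * \int[leb]_(t in arc) F (expi t))%E.
Proof.
move=> mF F0; rewrite /circle_measure ge0_integral_mscale//; congr (_ * _)%E.
rewrite -[LHS]/(\int[pushforward (mrestr leb mpi) (@expi R)]_z F z)%E.
rewrite ge0_integral_pushforward//=; last exact: measurable_expi.
rewrite preimage_setT.
have mFe := measurable_comp_expi mF.
rewrite (@ge0_negligible_integral _ _ _ (mrestr leb mpi) setT (~` arc))//=; last 2 first.
- exact: measurableC.
- by rewrite -[LHS]/(leb (~` arc `&` arc)) setICl measure0.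
rewrite setTD setCK; apply: eq_measure_integral => A mA Aarc.
by rewrite -[LHS]/(leb (A `&` arc)) setIidl.
Qed.

Lemma circle_integrable_comp (f : circle R -> R) : mu.-integrable setT (EFin \o f) ->
  leb.-integrable arc (fun t => (f (expi t))%:E).
Proof.
move=> /integrableP[mf fy]; apply/integrableP; split.
  exact: measurable_funS (measurable_comp_expi mf).
move: fy; rewrite ge0_circle_integralE//; last exact: measurableT_comp.
apply: contraTT; rewrite -!leNgt !leye_eq => /eqP ->.
by rewrite gt0_muley// lte_fin invr_gt0 mulr_gt0 ?pi_gt0.
Qed.

Lemma circle_RintegralE (f : circle R -> R) : mu.-integrable setT (EFin \o f) ->
  \int[mu]_z f z = (2 * pi)^-1 * \int[leb]_(t in arc) f (expi t).
Proof.
move=> fi; have /integrableP[mf _] := fi; have fi' := circle_integrable_comp fi.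
rewrite /Rintegral (integralE mu) (integralE leb).
rewrite (ge0_circle_integralE (measurable_funepos mf))//.
rewrite (ge0_circle_integralE (measurable_funeneg mf))//.
pose g (t : measurableTypeR R) := (f (expi t))%:E.
have -> : (\int[leb]_(t in arc) (EFin \o f)^\+ (expi t) = \int[leb]_(t in arc) g^\+ t)%E.
  by apply: eq_integral => t _; rewrite !funeposE.
have -> : (\int[leb]_(t in arc) (EFin \o f)^\- (expi t) = \int[leb]_(t in arc) g^\- t)%E.
  by apply: eq_integral => t _; rewrite !funenegE.
have h1 : (\int[leb]_(t in arc) g^\+ t)%E \is a fin_num.
  by have := integrable_pos_fin_num mpi fi'.
have h2 : (\int[leb]_(t in arc) g^\- t)%E \is a fin_num.
  by have := integrable_neg_fin_num mpi fi'.
by rewrite -(fineK h1) -(fineK h2) -!EFinM -!EFinB /= mulrBr.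
Qed.

End circle_integrals.

Section circle_reflection.
Variable R : realType.
Local Notation mu := (circle_measure R).
Local Notation leb := (@lebesgue_measure R).
Local Notation conj := (@circle_conj R).

Lemma circle_conj_expi (t : R) : circle_conj (expi t) = expi (- t).
Proof. by apply/val_inj; rewrite /= cosN sinN. Qed.

Lemma circle_conjK : involutive conj.
Proof. by move=> z; apply/val_inj; rewrite /= conjcK. Qed.

Lemma continuous_circle_conj : continuous conj.
Proof.
apply: (@continuous_comp_initial _ _ _ (@circle_val R) conj) => z.
have hc : continuous (fun x : R[i]^o => x^*%C : R[i]^o).
  move=> x U /nbhs_ballP[e e0 hU]; apply/nbhs_ballP; exists e => // y xy; apply: hU.
  move: xy; rewrite -!ball_normE /ball_ /=.
  suff -> : `|x^*%C - y^*%C| = `|x - y| by [].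
  rewrite -conjcN -conjcD !normc_def; congr ((Num.sqrt _)%:C).
  by case: (x - y) => a b /=; rewrite sqrrN.
have hz : {for z, continuous (@circle_val R)} by exact: initial_continuous.
exact: (continuous_comp hz (hc _)).
Qed.

Lemma measurable_circle_conj : measurable_fun setT conj.
Proof.
apply: (measurability (@circle_open R)) => // _ [U oU <-].
rewrite setTI; apply: sub_sigma_algebra.
by move/continuousP : continuous_circle_conj; apply.
Qed.

(** In the angle, conjugation is t -> -t, which preserves Lebesgue measure and exchanges the period
    open at -pi with the one open at pi; the endpoints are negligible. *)
Lemma ge0_circle_integral_conj (F : circle R -> \bar R) :
  measurable_fun setT F -> (forall z, 0 <= F z)%E ->
  (\int[mu]_z F (circle_conj z) = \int[mu]_z F z)%E.
Proof.
move=> mF F0; rewrite !ge0_circle_integralE//; last first.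
  exact: measurableT_comp mF measurable_circle_conj.
congr (_ * _)%E; have mFe := measurable_comp_expi mF.
under eq_integral => t _ do rewrite circle_conj_expi.
have mN : measurable_fun setT (-%R : measurableTypeR R -> measurableTypeR R).
  exact: oppr_measurable.
have := @ge0_integral_pushforward _ _ (measurableTypeR R) (measurableTypeR R) R
  -%R mN leb (`[- pi, pi[)%classic (fun t => F (expi t)).
rewrite opp_preimage_itvbndbnd /= opprK => <-//; last first.
  exact: measurable_funS mFe.
rewrite [RHS]integral_itv_obnd_cbnd; last exact: measurable_funS mFe.
rewrite -[RHS]integral_itv_bndo_bndc; last exact: measurable_funS mFe.
apply: eq_measure_integral => A mA _; exact: lebesgue_measureN.
Qed.

Lemma circle_integrable_conj (f : circle R -> R) : mu.-integrable setT (EFin \o f) ->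
  mu.-integrable setT (EFin \o (f \o conj)).
Proof.
move=> /integrableP[mf fy]; apply/integrableP; split.
  exact: measurableT_comp mf measurable_circle_conj.
rewrite -[X in (X < _)%E]/(\int[mu]_z (abse \o (EFin \o f)) (circle_conj z))%E.
have mabs : measurable_fun setT (abse \o (EFin \o f)) by exact: measurableT_comp.
by rewrite (ge0_circle_integral_conj mabs) => [|z]; [exact: fy|exact: abse_ge0].
Qed.

Lemma circle_Rintegral_conj (f : circle R -> R) : mu.-integrable setT (EFin \o f) ->
  \int[mu]_z f (circle_conj z) = \int[mu]_z f z.
Proof.
move=> fi; have /integrableP[mf _] := fi.
rewrite /Rintegral (integralE _ _ (fun z => (f (circle_conj z))%:E)) [in RHS]integralE.
rewrite -(ge0_circle_integral_conj (measurable_funepos mf))//.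
rewrite -(ge0_circle_integral_conj (measurable_funeneg mf))//.
by congr (fine (_ - _)); apply: eq_integral => z _; rewrite ?funeposE ?funenegE.
Qed.

End circle_reflection.

(** * Fourier series and the Hardy space *)

Lemma sum_ord_split (W : nmodType) (F : nat -> W) (n m : nat) : (n <= m)%N ->
  \sum_(k < m) F k = \sum_(k < n) F k + \sum_(k < m - n) F (n + k)%N.
Proof.
move=> /subnKC; move: (m - n)%N => p <-.
by rewrite big_split_ord.
Qed.

Section orthonormal_sequences.
Variables (R : realType) (V : lmodType R[i]) (ip : semi_ip V) (X : nat -> V).
Hypothesis orth : forall i j, ip (X i) (X j) = (i == j)%:R.
Implicit Types (f g h : V) (d : nat -> R[i]).
Local Notation rip := (re_ip ip).
Local Notation nsq := (sqnorm ip).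
Local Notation nm := (seminorm ip).

Definition fsum f n := \sum_(k < n) ip f (X k) *: X k.

Lemma ip_lincomb_orth n d k : ip (lincomb X n d) (X k) = if (k < n)%N then d k else 0.
Proof.
rewrite /lincomb ip_suml; case: ltnP => kn; last first.
  by rewrite big1// => j _; rewrite ipZl orth ltn_eqF ?mulr0// (leq_trans _ kn).
rewrite (bigD1 (Ordinal kn))//= ipZl orth eqxx mulr1 big1 ?addr0// => j /eqP jk.
by rewrite ipZl orth; case: eqP => [e|]; rewrite ?mulr0//; case: jk; exact/val_inj.
Qed.

Lemma fsum_orth f n k : (k < n)%N -> ip (f - fsum f n) (X k) = 0.
Proof. by move=> kn; rewrite ipBl (ip_lincomb_orth n (fun k => ip f (X k))) kn subrr. Qed.

Lemma nsq_lincomb n d : nsq (lincomb X n d) = \sum_(k < n) cnorm2 (d k).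
Proof.
rewrite /sqnorm /re_ip {2}/lincomb ip_sumr cRe_sum; apply: eq_bigr => k _.
by rewrite ipZr ip_lincomb_orth ltn_ord mulrC mulcJ.
Qed.

Lemma fsum_pythagoras f n d :
  nsq (f - lincomb X n d) = nsq (f - fsum f n) + nsq (fsum f n - lincomb X n d).
Proof.
have -> : f - lincomb X n d = (f - fsum f n) + (fsum f n - lincomb X n d).
  by rewrite addrA subrK.
have -> : fsum f n - lincomb X n d = lincomb X n (fun k => ip f (X k) - d k).
  by rewrite -sumrB; apply: eq_bigr => k _; rewrite scalerBl.
rewrite nsqD (_ : rip _ _ = 0) ?mulr0 ?addr0//.
rewrite /re_ip ip_sumr big1// => k _; rewrite ipZr fsum_orth ?mulr0//.
Qed.

Lemma fsum_best f n d : nsq (f - fsum f n) <= nsq (f - lincomb X n d).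
Proof. by rewrite fsum_pythagoras lerDl nsqP. Qed.

Lemma bessel f n : \sum_(k < n) cnorm2 (ip f (X k)) <= nsq f.
Proof.
have := fsum_pythagoras f n (fun=> 0).
have -> : lincomb X n (fun=> 0) = 0 by rewrite /lincomb big1// => k _; rewrite scale0r.
rewrite !subr0 => ->; rewrite (nsq_lincomb n (fun k => ip f (X k))).
by rewrite lerDr nsqP.
Qed.

(** The squared distance of two partial sums is a block of the series of squared coefficients, whose
    partial sums increase to a supremum that Bessel's inequality makes finite. *)
Lemma fsum_cauchy f e : 0 < e -> exists N, forall n m, (N <= n)%N -> (N <= m)%N ->
  nm (fsum f n - fsum f m) < e.
Proof.
move=> e0; pose E := range (fun n => \sum_(k < n) cnorm2 (ip f (X k))).
have sE : has_sup E.
  by split; [exists (\sum_(k < 0) cnorm2 (ip f (X k))), 0%N|exists (nsq f) => _ [n _ <-]; exact: bessel].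
have e2 : 0 < e ^+ 2 by rewrite exprn_gt0.
have [_ [N _ <-] hN] := sup_adherent e2 sE; exists N.
have key n m : (N <= n <= m)%N -> nm (fsum f m - fsum f n) < e.
  move=> /andP[Nn nm_].
  rewrite -(@ltr_pXn2r _ 2) ?nnegrE ?nm_ge0 ?(ltW e0)// nm_sqr.
  have -> : fsum f m - fsum f n =
      lincomb X m (fun k => if (k < n)%N then 0 else ip f (X k)).
    have Em d : lincomb X m d =
        lincomb X n d + \sum_(k < m - n) d (n + k)%N *: X (n + k)%N.
      exact: (sum_ord_split (fun k => d k *: X k) nm_).
    rewrite -[fsum f m]/(lincomb X m (fun k => ip f (X k))) !Em addrAC subrr add0r.
    rewrite [lincomb X n _]big1 ?add0r => [|k _]; last by rewrite ltn_ord scale0r.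
    by apply: eq_bigr => k _; rewrite ltnNge leq_addr.
  have : \sum_(k < m) cnorm2 (ip f (X k)) <= sup E by apply: sup_upper_bound => //; exists m.
  have mono : \sum_(k < N) cnorm2 (ip f (X k)) <= \sum_(k < n) cnorm2 (ip f (X k)).
    rewrite (sum_ord_split (fun k => cnorm2 (ip f (X k))) Nn) lerDl; apply: sumr_ge0 => k _; exact: cnorm2_ge0.
  have -> : \sum_(k < m) cnorm2 (ip f (X k)) = \sum_(k < n) cnorm2 (ip f (X k)) +
      nsq (lincomb X m (fun k => if (k < n)%N then 0 else ip f (X k))).
    have Es (d : nat -> R) : \sum_(k < m) d k = \sum_(k < n) d k + \sum_(k < m - n) d (n + k)%N.
      exact: (sum_ord_split d nm_).
    rewrite nsq_lincomb (Es (fun k => cnorm2 (ip f (X k)))).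
    rewrite (Es (fun k => cnorm2 (if (k < n)%N then 0 else ip f (X k)))).
    rewrite [X in _ = _ + (X + _)]big1 ?add0r.
      by congr (_ + _); apply: eq_bigr => k _; rewrite ltnNge leq_addr.
    by move=> k _; rewrite ltn_ord /cnorm2 /= expr0n /= addr0.
  by move: hN mono; set a := \sum_(k < N) _; set b := \sum_(k < n) _; lra.
move=> n m Nn Nm; have [nm_|/ltnW mn] := leqP n m; last by rewrite key// Nm.
by rewrite nmBC key// Nn.
Qed.

Lemma coef_cvg0 f e : 0 < e -> exists N, forall n, (N <= n)%N -> cnorm2 (ip f (X n)) < e.
Proof.
move=> e0; have s0 : 0 < Num.sqrt e by rewrite sqrtr_gt0.
have [N hN] := fsum_cauchy f s0; exists N => n Nn.
have := hN n.+1 n (leq_trans Nn (leqnSn _)) Nn.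
rewrite -(@ltr_pXn2r _ 2) ?nnegrE ?nm_ge0 ?(ltW s0)// nm_sqr sqr_sqrtr ?(ltW e0)//.
by rewrite /fsum big_ord_recr /= addrAC subrr add0r nsqZ -[nsq _]/(complex.Re (ip _ _)) orth eqxx mulr1.
Qed.

End orthonormal_sequences.

Section characters.
Variable R : realType.
Local Notation mu := (circle_measure R).
Implicit Types (k j : int) (z : circle R) (t : R).

Lemma cnorm2_circle z : cnorm2 (sval z) = 1.
Proof.
case: z => z /= /eqP; rewrite normc_def => -[h].
by rewrite /cnorm2 -[LHS]sqr_sqrtr ?h ?expr1n// addr_ge0 ?sqr_ge0.
Qed.

Lemma circle_neq0 z : sval z != 0.
Proof. by rewrite -cnorm2_eq0 cnorm2_circle oner_neq0. Qed.

Lemma conjc_unit (x : R[i]) : cnorm2 x = 1 -> x^*%C = x^-1.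
Proof.
move=> x1; have x0 : x != 0 by rewrite -cnorm2_eq0 x1 oner_neq0.
by apply: (mulfI x0); rewrite mulfV// mulcJ -/(cnorm2 x) x1.
Qed.

Definition chi k z : R[i] := sval z ^ k.

Lemma cnorm2_chi k z : cnorm2 (chi k z) = 1.
Proof.
have hn (n : nat) : cnorm2 (sval z ^+ n) = 1.
  elim: n => [|n ih]; first by rewrite expr0 /cnorm2 /= expr1n expr0n addr0.
  by rewrite exprS cnorm2M ih cnorm2_circle mulr1.
case: k => n; rewrite /chi /exprz //=; have h := hn n.+1.
by rewrite -conjc_unit// /cnorm2 cReJ cImJ sqrrN.
Qed.

Lemma chiD j k z : chi (j + k) z = chi j z * chi k z.
Proof. by rewrite /chi expfzDr// circle_neq0. Qed.

Lemma chi0 z : chi 0 z = 1.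
Proof. by []. Qed.

Lemma chiN k z : chi (- k) z = (chi k z)^*%C.
Proof. by rewrite conjc_unit ?cnorm2_chi// /chi invr_expz. Qed.

Lemma chi_conj k z : chi k (circle_conj z) = chi (- k) z.
Proof. by rewrite /chi /= conjc_unit ?cnorm2_circle// exprz_inv. Qed.

Lemma chi_mulJ j k z : chi j z * (chi k z)^*%C = chi (j - k) z.
Proof. by rewrite -chiN -chiD. Qed.

Lemma chi_expi k t : chi k (expi t) = cos (k%:~R * t) +i* sin (k%:~R * t).
Proof.
have hn (n : nat) : sval (expi t) ^+ n = cos (n%:R * t) +i* sin (n%:R * t).
  elim: n => [|n ih]; first by rewrite expr0 mul0r cos0 sin0.
  rewrite exprS ih -natr1 mulrDl mul1r [_ + t]addrC cosD sinD /=.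
  by apply/eqP; rewrite eq_complex /= eqxx /= addrC.
case: k => n; first by rewrite /chi -exprnP hn -pmulrn.
by rewrite NegzE chiN /chi -exprnP hn mulrNz mulNr cosN sinN -pmulrn.
Qed.

Lemma cmeasurable_continuous (f : circle R -> R[i]) :
  continuous (fun z => complex.Re (f z)) -> continuous (fun z => complex.Im (f z)) ->
  cmeasurable f.
Proof.
have h (r : circle R -> R) : continuous r -> measurable_fun setT r.
  move=> cr; apply: (measurability _ (RGenOpens.measurableE R)) => // _ [_ [a [b ->]] <-].
  rewrite setTI; apply: sub_sigma_algebra.
  by move/continuousP : cr; apply; exact: interval_open.
by move=> c1 c2; split; exact: h.
Qed.

Lemma cmeasurable_chi k : cmeasurable (chi k).
Proof.
have m1 : cmeasurable (fun z : circle R => sval z).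
  have h (r : R[i] -> R) : (forall x y, `|r x - r y|%:C <= `|x - y|) ->
      continuous (fun z : circle R => r (circle_val z)).
    move=> hr z; have hz : {for z, continuous (@circle_val R)} by exact: initial_continuous.
    have hc : {for circle_val z, continuous (r : R[i]^o -> R)}.
      move=> U /nbhs_ballP[e e0 hU]; apply/nbhs_ballP; exists e%:C; first by rewrite /= ltcR.
      move=> y xy; apply: hU; move: xy; rewrite -!ball_normE /ball_ /= => xy.
      by rewrite -ltcR (le_lt_trans (hr _ _)).
    exact: (continuous_comp hz hc).
  apply: cmeasurable_continuous.
    apply: (h (@complex.Re R)) => x y; rewrite -cReN -cReD normc_def lecR.
    by rewrite -sqrtr_sqr ler_wsqrtr// lerDl sqr_ge0.
  apply: (h (@complex.Im R)) => x y; rewrite -cImN -cImD normc_def lecR.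
  by rewrite -sqrtr_sqr ler_wsqrtr// lerDr sqr_ge0.
have hn (n : nat) : cmeasurable (fun z : circle R => sval z ^+ n).
  elim: n => [|n ih]; first exact: (cmeasurable_cst 1).
  by under eq_fun do rewrite exprS; exact: cmeasurableM.
case: k => n; first exact: hn.
rewrite NegzE; have [c1 c2] := hn n.+1; split.
  by under eq_fun do rewrite chiN cReJ; exact: c1.
by under eq_fun do rewrite chiN cImJ; apply: measurableT_comp => //; exact: c2.
Qed.

Lemma cLfun2_bounded (C : R) (w : circle R -> R[i]) : cmeasurable w ->
  {ae mu, forall z, cnorm2 (w z) <= C ^+ 2} -> cLfun 2%:E w.
Proof.
move=> mw wC; have c1 : cLfun 2%:E (cst 1 : circle R -> R[i]).
  apply/cLfun2P; split; first exact: cmeasurable_cst.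
  under eq_integral do rewrite /cnorm2 /= expr1n expr0n /= addr0.
  by rewrite integral_cst// mul1e (le_lt_trans (probability_le1 _ _))// ltry.
have [h _] := cLfun2_mul_bounded mw wC c1.
by move: h; congr (cLfun _ _); apply/funext => z; rewrite mulr1.
Qed.

Lemma cLfun2_chi k : cLfun 2%:E (chi k).
Proof.
apply: (@cLfun2_bounded 1); first exact: cmeasurable_chi.
by apply: aeW => z; rewrite cnorm2_chi expr1n.
Qed.

End characters.

Section arc_integrals.
Variable R : realType.
Local Notation leb := (@lebesgue_measure R).
Local Notation arc := (`]- pi, pi]%classic : set R).
Implicit Types (u v : R -> R) (t : R).

Lemma pi_lt : - pi < pi :> R.
Proof. by rewrite gtrN// pi_gt0. Qed.

Lemma arc_cc_integral u : measurable_fun setT u ->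
  \int[leb]_(t in arc) u t = \int[leb]_(t in `[- pi, pi]) u t.
Proof.
move=> mu; rewrite /Rintegral integral_itv_obnd_cbnd//.
by apply/measurable_EFinP; exact: measurable_funS mu.
Qed.

Lemma arc_integral_deriv u : (forall t, derivable u t 1) -> continuous (derive1 u) ->
  u pi = u (- pi) -> \int[leb]_(t in arc) (derive1 u) t = 0.
Proof.
move=> du cu upi; have mu' : measurable_fun setT (derive1 u) by exact: continuous_measurable_fun.
have cont : continuous u.
  by move=> t; apply: differentiable_continuous; apply/derivable1_diffP.
rewrite arc_cc_integral// /Rintegral (@continuous_FTC2 _ (derive1 u) u).
- by rewrite upi -EFinB subrr.
- exact: pi_lt.
- exact: continuous_subspaceT.
- split=> [t _||]; first exact: du.
    exact: cvg_at_right_filter (cont _).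
  exact: cvg_at_left_filter (cont _).
- by [].
Qed.

Lemma is_derive_cosM (a t : R) : is_derive t 1 (fun x => cos (a * x)) (- a * sin (a * t)).
Proof.
have h : is_derive t 1 (fun x : R => a * x) a.
  by apply: is_derive_eq; rewrite /GRing.scale /= mulr1.
have := @is_derive1_comp R (@cos R) (fun x => a * x) t _ _ (is_derive_cos (a * t)) h.
by rewrite mulrC mulrN mulNr.
Qed.

Lemma is_derive_sinM (a t : R) : is_derive t 1 (fun x => sin (a * x)) (a * cos (a * t)).
Proof.
have h : is_derive t 1 (fun x : R => a * x) a.
  by apply: is_derive_eq; rewrite /GRing.scale /= mulr1.
have := @is_derive1_comp R (@sin R) (fun x => a * x) t _ _ (is_derive_sin (a * t)) h.
by rewrite mulrC.
Qed.

Lemma derive1_is u (du : R -> R) : (forall t, is_derive t 1 u (du t)) -> (derive1 u) = du.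
Proof. by move=> h; apply/funext => t; rewrite derive1E; apply: derive_val. Qed.

Lemma continuous_is u (du : R -> R) : (forall t, is_derive t 1 u (du t)) -> continuous u.
Proof. by move=> h t; apply: differentiable_continuous; apply/derivable1_diffP. Qed.

Lemma sin_kpi (k : int) : sin (k%:~R * pi) = 0 :> R.
Proof.
have hn (n : nat) : sin (n%:R * pi) = 0 :> R.
  elim: n => [|n ih]; first by rewrite mul0r sin0.
  by rewrite -natr1 mulrDl mul1r sinDpi ih oppr0.
by case: k => n; rewrite ?NegzE ?mulrNz ?mulNr ?sinN -pmulrn hn ?oppr0.
Qed.

Lemma arc_integral_cos (k : int) : k != 0 -> \int[leb]_(t in arc) cos (k%:~R * t) = 0.
Proof.
move=> k0; pose u t : R := k%:~R^-1 * sin (k%:~R * t).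
have k0' : k%:~R != 0 :> R by rewrite intr_eq0.
have hu t : is_derive t 1 u (cos (k%:~R * t)).
  have hs := is_derive_sinM k%:~R t.
  by apply: is_derive_eq; rewrite /GRing.scale /= mulrA mulVf// mul1r.
rewrite -(derive1_is hu); apply: arc_integral_deriv.
- by move=> t; have [] := hu t.
- by rewrite (derive1_is hu); apply: continuous_is => t; exact: is_derive_cosM.
- by rewrite /u mulrN sinN sin_kpi oppr0.
Qed.

Lemma arc_integral_sin (k : int) : \int[leb]_(t in arc) sin (k%:~R * t) = 0.
Proof.
have [->|k0] := eqVneq k 0.
  rewrite (_ : (fun t => _) = cst 0) ?Rintegral_cst ?mul0r//.
  by apply/funext => t; rewrite mul0r sin0.
pose u t : R := - k%:~R^-1 * cos (k%:~R * t).
have k0' : k%:~R != 0 :> R by rewrite intr_eq0.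
have hu t : is_derive t 1 u (sin (k%:~R * t)).
  have hs := is_derive_cosM k%:~R t.
  by apply: is_derive_eq; rewrite /GRing.scale /= mulrA mulrNN mulVf// mul1r.
rewrite -(derive1_is hu); apply: arc_integral_deriv.
- by move=> t; have [] := hu t.
- by rewrite (derive1_is hu); apply: continuous_is => t; exact: is_derive_sinM.
- by rewrite /u mulrN cosN.
Qed.

Lemma cintegrable_L2 (f : circle R -> R[i]) : cLfun 2%:E f -> cintegrable f.
Proof.
move=> f2; have := cLfun2_mulJ f2 (cLfun2_chi R 0).
by congr cintegrable; apply/funext => z; rewrite chi0 conjc1 mulr1.
Qed.

Lemma circle_integral_chi (k : int) : circle_integral (chi k) = (k == 0)%:R :> R[i].
Proof.
have [c1 c2] := cintegrable_L2 (cLfun2_chi R k).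
rewrite /circle_integral !circle_RintegralE//.
have [k0|k0] := eqVneq k 0.
  have hl : fine (@lebesgue_measure R arc) = pi + pi.
    by rewrite lebesgue_measure_itv /= lte_fin pi_lt /= opprK.
  rewrite k0 /= !Rintegral_cst// mul0r mulr0 mul1r (_ : fine _ = pi + pi); last exact: hl.
  have p0 : pi != 0 :> R by rewrite gt_eqF ?pi_gt0.
  have hp (P : R) : P != 0 -> (2 * P)^-1 * (P + P) = 1 by move=> P0; field.
  rewrite hp//.
under eq_Rintegral do rewrite chi_expi /=.
under [X in _ +i* (_ * X)]eq_Rintegral do rewrite chi_expi /=.
by rewrite arc_integral_cos// arc_integral_sin !mulr0.
Qed.

Lemma inner_chi (j k : int) : inner (chi j) (chi k) = (j == k)%:R :> R[i].
Proof.
rewrite /inner -[(j == k)]subr_eq0 -circle_integral_chi; apply: cint_eq => z.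
by rewrite chi_mulJ.
Qed.

Definition Chi (k : int) : L2 R := toL2 (cLfun2_chi R k).

Lemma ip_Chi j k : L2ip R (Chi j) (Chi k) = (j == k)%:R.
Proof. exact: inner_chi. Qed.

End arc_integrals.

Section hardy_space.
Variable R : realType.
Local Notation mu := (circle_measure R).
Local Notation ip := (L2ip R).
Local Notation nsq := (sqnorm ip).
Local Notation nm := (seminorm ip).
Local Notation X := (fun k : nat => Chi R (Posz k)).
Implicit Types (f g h : L2 R).

Let orthX i j : ip (X i) (X j) = (i == j)%:R.
Proof. exact: ip_Chi. Qed.

Lemma L2_sumE n (F : 'I_n -> L2 R) z : (\sum_k F k) z = \sum_k F k z.
Proof. by apply: (big_morph (fun f : L2 R => f z)). Qed.

Lemma poly_funE (q : {poly R[i]}) :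
  poly_fun q = lincomb X (size q) (fun k => q`_k) :> (circle R -> R[i]).
Proof.
apply/funext => z; rewrite /lincomb L2_sumE /poly_fun horner_coef.
by apply: eq_bigr => k _.
Qed.

Lemma poly_fun_poly n (d : nat -> R[i]) :
  poly_fun (\poly_(k < n) d k) = lincomb X n d :> (circle R -> R[i]).
Proof.
apply/funext => z; rewrite /lincomb L2_sumE /poly_fun horner_poly.
by apply: eq_bigr => k _.
Qed.

(** Among polynomials of degree below n the section [fsum] is the closest to f, so approximability
    by polynomials is the same as convergence of these sections. *)
Lemma hardy_limit f : hardy2 f <-> limit_of ip (fsum ip X f) f.
Proof.
split=> [[_ hf]|/limit_ofP hf]; last first.
  split=> [|e e0]; first exact: L2P.
  have [N /(_ _ (leqnn N)) hN] := hf _ e0.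
  exists (\poly_(k < N) ip f (X k)); rewrite poly_fun_poly.
  by rewrite -[X in X < _]/(nm (f - fsum ip X f N)) nmBC.
apply/limit_ofP => e e0; have [q] := hf _ e0; rewrite poly_funE.
rewrite -[X in X < _]/(nm (f - lincomb X (size q) (fun k => q`_k))) => hq.
exists (size q) => n qn; rewrite nmBC; apply: le_lt_trans hq.
rewrite -(@ler_pXn2r _ 2) ?nnegrE ?nm_ge0// !nm_sqr.
pose d k := if (k < size q)%N then q`_k else 0.
have -> : lincomb X (size q) (fun k => q`_k) = lincomb X n d.
  rewrite /lincomb (sum_ord_split (fun k => d k *: X k) qn).
  rewrite [X in _ = _ + X]big1 ?addr0.
    by apply: eq_bigr => k _; rewrite /d ltn_ord.
  by move=> k _; rewrite /d ltnNge leq_addr scale0r.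
exact: fsum_best.
Qed.

Lemma projection_exists f : exists g, hardy2 g /\
  forall k : nat, ip (f - g) (X k) = 0.
Proof.
have [g hg] := L2_complete (fsum_cauchy orthX f).
have gX k : ip (f - g) (X k) = 0.
  apply: (@limit_of_orth _ _ ip (fun n => f - fsum ip X f (n + k.+1))).
    apply/limit_ofP => e e0; move/limit_ofP : hg => /(_ _ e0)[N hN].
    exists N => n Nn; rewrite opprB addrC subrKA nmBC.
    by rewrite hN// (leq_trans Nn)// leq_addr.
  by move=> n; apply: fsum_orth => //; rewrite addnS ltnS leq_addl.
exists g; split=> //; apply/hardy_limit.
suff -> : fsum ip X g = fsum ip X f by [].
apply/funext => n; apply: eq_bigr => k _; congr (_ *: _); apply/eqP.
by rewrite -subr_eq0 -oppr_eq0 opprB -ipBl gX.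
Qed.

(** H^2 as the double orthogonal complement of the monomials; in this form closure properties and
    vanishing inner products are immediate. For the converse the test vector is f - g, with g the
    projection of f. *)
Lemma hardy_orth f : hardy2 f <->
  forall h, (forall k : nat, ip h (X k) = 0) -> ip f h = 0.
Proof.
split=> [/hardy_limit hf h hX|hf].
  apply: limit_of_orth hf _ => n; rewrite ip_suml big1// => k _.
  by rewrite ipZl -[ip _ h]ipJ hX conjc0 mulr0.
have [g [gH gX]] := projection_exists f.
have fg : nsq (f - g) = 0.
  rewrite /sqnorm /re_ip ipBl hf//.
  move/hardy_limit : gH => hg; rewrite (_ : ip g (f - g) = 0) ?subrr//.
  apply: limit_of_orth hg _ => n; rewrite ip_suml big1// => k _.
  by rewrite ipZl -[ip _ (f - g)]ipJ gX conjc0 mulr0.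
split=> [|e e0]; first exact: L2P.
have [q] := (proj2 gH) _ e0; rewrite poly_funE => hq; exists q; rewrite poly_funE.
rewrite -[X in X < _]/(nm (f - lincomb X (size q) (fun k => q`_k))).
have {}hq : nm (g - lincomb X (size q) (fun k => q`_k)) < e := hq.
apply: le_lt_trans hq; rewrite (le_trans (nm_dist _ _ g _))//.
by have /eqP-> : nm (f - g) == 0 by [rewrite nm_eq0 fg]; rewrite add0r.
Qed.

Lemma hardy2L (f : circle R -> R[i]) : hardy2 f -> cLfun 2%:E f.
Proof. by case. Qed.

Lemma hardy2D (c : R[i]) (f g : circle R -> R[i]) :
  hardy2 f -> hardy2 g -> hardy2 (c *: f + g).
Proof.
move=> hf hg; pose f' := toL2 (hardy2L hf); pose g' := toL2 (hardy2L hg).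
apply: (proj2 (hardy_orth (c *: f' + g'))) => h hX; rewrite ipDl ipZl.
by rewrite (proj1 (hardy_orth f') hf h hX) (proj1 (hardy_orth g') hg h hX) mulr0 addr0.
Qed.

Lemma hardy2_0 : hardy2 (0 : circle R -> R[i]).
Proof. by apply: (proj2 (hardy_orth 0)) => h _; rewrite ip0l. Qed.

(** Where no projection exists, [xget] returns its default 0, which is in [hardy2]; so [hankel w]
    maps every function into H^2. *)
Lemma Pplus_hardy (f : circle R -> R[i]) : hardy2 (Pplus f).
Proof.
rewrite /Pplus; set S := (X in xget _ X).
have [/(xgetPex 0)[]//|nS] := pselect (exists u, S u).
rewrite xgetPN; first exact: hardy2_0.
by move=> u Su; apply: nS; exists u.
Qed.

Lemma Pplus_orth (F h : circle R -> R[i]) : cLfun 2%:E F -> hardy2 h ->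
  inner (F - Pplus F) h = 0.
Proof.
move=> F2; have [g [gH gX]] := projection_exists (toL2 F2).
have : exists u, [set u : circle R -> R[i] | hardy2 u /\
      forall v, hardy2 v -> inner (F - u) v = 0] u.
  exists g; split=> // k hk; pose k' := toL2 (hardy2L hk).
  rewrite -[LHS]/(ip (toL2 F2 - g) k') -ipJ.
  by rewrite (proj1 (hardy_orth k') hk _ gX) conjc0.
by move=> /(xgetPex 0) [_]; apply.
Qed.

End hardy_space.

Definition hardy (R : realType) : {pred circle R -> R[i]} := [pred f | `[< hardy2 f >]].
Arguments hardy R : clear implicits.

Lemma hardyP (R : realType) (f : circle R -> R[i]) : f \in hardy R <-> hardy2 f.
Proof. by split=> /asboolP. Qed.

Lemma hardy_submod_closed (R : realType) : submod_closed (hardy R).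
Proof.
split=> [|c f g /hardyP fH /hardyP gH]; apply/hardyP; first exact: hardy2_0.
exact: hardy2D.
Qed.

HB.instance Definition _ (R : realType) :=
  GRing.isSubmodClosed.Build _ _ (hardy R) (@hardy_submod_closed R).

Record H2 (R : realType) := MkH2 { H2fun :> circle R -> R[i]; _ : H2fun \in hardy R }.

HB.instance Definition _ (R : realType) := [isSub for @H2fun R].
HB.instance Definition _ (R : realType) := [Choice of H2 R by <:].
HB.instance Definition _ (R : realType) := [SubChoice_isSubLmodule of H2 R by <:].

(** * Hankel operators on the Hardy space *)

Section hankel_operators.
Variable R : realType.
Local Notation mu := (circle_measure R).
Local Notation fun_circle := (circle R -> R[i]).
Implicit Types (f g h : H2 R).

Lemma H2P f : hardy2 f.
Proof. by apply/hardyP; case: f. Qed.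

Definition toH2 (f : fun_circle) (fH : hardy2 f) : H2 R := MkH2 ((hardyP f).2 fH).

Definition H2L2 f : L2 R := toL2 (hardy2L (H2P f)).

Lemma H2_addl f g h : inner (f + g) h = inner f h + inner g h.
Proof. exact: inner_addl (hardy2L (H2P _)) (hardy2L (H2P _)) (hardy2L (H2P _)). Qed.

Lemma H2_scalel c f h : inner (c *: f) h = c * inner f h.
Proof. exact: inner_scalel (hardy2L (H2P _)) (hardy2L (H2P _)). Qed.

Lemma H2_conj f g : (inner f g)^*%C = inner g f.
Proof. exact: innerJ (hardy2L (H2P _)) (hardy2L (H2P _)). Qed.

Definition H2ip := SemiIP H2_addl H2_scalel H2_conj (fun f => inner_ge0 f).

(** [hankel w] as a self-map of the module [H2 R]; the underlying function is [hankel w f] by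
    conversion. *)
Definition opH (w : fun_circle) (f : H2 R) : H2 R := toH2 (Pplus_hardy (fun z => w z * reflection f z)).

Definition bounded_by (C : R) (w : fun_circle) :=
  cmeasurable w /\ {ae mu, forall z, cnorm2 (w z) <= C ^+ 2}.

Lemma cLfun_oo_bounded (w : fun_circle) : cLfun +oo%E w ->
  exists2 C, 0 <= C & bounded_by C w.
Proof.
have h (r : circle R -> R) : r \in Lfun mu +oo%E ->
    measurable_fun setT r /\ exists M, {ae mu, forall z, `|r z| <= M}.
  move=> /[!inE] /andP[/[!inE]/= mr]; rewrite /finite_norm unlock /Lnorm.
  have m0 : (0 < circle_measure R setT)%E by rewrite circle_measure_setT.
  case: ifPn => [_ /ess_supr_bounded[M hM]|/negP[]//].
  by split=> //; exists M.
move=> [/h[m1 [M1 h1]] /h[m2 [M2 h2]]].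
exists (`|M1| + `|M2|); first by rewrite addr_ge0.
split=> //; apply: filterS2 h1 h2 => z h1 h2.
have k1 : complex.Re (w z) ^+ 2 <= `|M1| ^+ 2.
  rewrite -real_normK ?num_real// lerXn2r ?nnegrE//.
  exact: le_trans h1 (ler_norm _).
have k2 : complex.Im (w z) ^+ 2 <= `|M2| ^+ 2.
  rewrite -real_normK ?num_real// lerXn2r ?nnegrE//.
  exact: le_trans h2 (ler_norm _).
have : 0 <= `|M1| * `|M2| by rewrite mulr_ge0.
rewrite /cnorm2; nra.
Qed.

Lemma cLfun2_reflection (f : fun_circle) : cLfun 2%:E f -> cLfun 2%:E (reflection f) /\
  complex.Re (inner (reflection f) (reflection f)) = complex.Re (inner f f).
Proof.
move=> f2; have /cLfun2P[mf fy] := f2.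
have e : (\int[mu]_z (cnorm2 (reflection f z))%:E = \int[mu]_z (cnorm2 (f z))%:E)%E.
  apply: (ge0_circle_integral_conj (cmeasurable_cnorm2 mf)) => z.
  by rewrite lee_fin cnorm2_ge0.
have Wf2 : cLfun 2%:E (reflection f).
  apply/cLfun2P; rewrite e; split=> //; have [m1 m2] := mf.
  by split; [exact: measurableT_comp m1 (@measurable_circle_conj R)|
             exact: measurableT_comp m2 (@measurable_circle_conj R)].
by split=> //; apply: EFin_inj; rewrite !innerE.
Qed.

Lemma cLfun2_hankel C (w f : fun_circle) : bounded_by C w -> cLfun 2%:E f ->
  cLfun 2%:E (fun z => w z * reflection f z) /\
  complex.Re (inner (fun z => w z * reflection f z) (fun z => w z * reflection f z))
    <= C ^+ 2 * complex.Re (inner f f).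
Proof.
move=> [mw wC] /cLfun2_reflection[Wf <-].
exact: cLfun2_mul_bounded.
Qed.

Lemma ip_opH C w f g : bounded_by C w ->
  H2ip (opH w f) g = inner (fun z => w z * reflection f z) g.
Proof.
move=> bw; have [F2 _] := cLfun2_hankel bw (hardy2L (H2P f)).
have := Pplus_orth F2 (H2P g).
have P2 := hardy2L (Pplus_hardy (fun z => w z * reflection f z)).
rewrite -[LHS]/(L2ip R (toL2 F2 - toL2 P2) (H2L2 g)) ipBl => /eqP.
by rewrite subr_eq0 => /eqP h; symmetry; exact: h.
Qed.

(** The change of variable z -> conj z carries the reflection from f to g and evaluates the symbol
    at conj z, where by the symmetry condition it is the conjugate of its value at z. *)
Lemma opH_selfadj C w : bounded_by C w -> symmetric_symbol w -> selfadj H2ip (opH w).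
Proof.
move=> bw sw f g; rewrite (ip_opH f g bw) -[RHS](ipJ H2ip) (ip_opH g f bw).
have [F2 _] := cLfun2_hankel bw (hardy2L (H2P f)).
have [G2 _] := cLfun2_hankel bw (hardy2L (H2P g)).
have f2 := hardy2L (H2P f); have g2 := hardy2L (H2P g).
rewrite innerJ// /inner.
have [c1 c2] := cLfun2_mulJ f2 G2; have [d1 d2] := cLfun2_mulJ F2 g2.
have [m1 m2] := cmeasurableM (cLfun2_meas F2) (cLfun2_meas g2).
have ae_e : {ae mu, forall z, w z * reflection f z * (g z)^*%C =
    (f (circle_conj z) * (w (circle_conj z) * reflection g (circle_conj z))^*%C)}.
  apply: filterS sw => z wz; rewrite /reflection /= circle_conjK conjcM -wz conjcK.
  by rewrite mulrCA mulrA.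
have key (r : R[i] -> R) :
    mu.-integrable setT (EFin \o (fun z => r (f z * (w z * reflection g z)^*%C))) ->
    mu.-integrable setT (EFin \o (fun z => r (w z * reflection f z * (g z)^*%C))) ->
    \int[mu]_z r (w z * reflection f z * (g z)^*%C) =
    \int[mu]_z r (f z * (w z * reflection g z)^*%C).
  move=> i1 i2; rewrite -(circle_Rintegral_conj i1); congr fine.
  apply: ae_eq_integral => //.
  - by case/integrableP : i2.
  - by case/integrableP : (circle_integrable_conj i1).
  - by apply: filterS ae_e => z -> _.
by congr (_ +i* _); [exact: (key (@complex.Re R))|exact: (key (@complex.Im R))].
Qed.

End hankel_operators.

(** * Trigonometric approximation of smooth functions *)

Section smooth_functions.
Variable R : realType.
Implicit Types (u v : R -> R) (U : set R) (t : R).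

(** n-fold differentiability on [U]; continuity of the derivative of order n comes from [Ck n.+1].
    Being pointwise in [U], the property glues over unions ([Ck_setU]). *)
Fixpoint Ck (n : nat) U u : Prop := if n is n'.+1 then
  (forall t, U t -> derivable u t 1) /\ Ck n' U (derive1 u) else True.

Lemma is_derive_derive1 u t : derivable u t 1 -> is_derive t 1 u (derive1 u t).
Proof. by move=> /derivableP; rewrite derive1E. Qed.

Lemma derivable_continuous u t : derivable u t 1 -> {for t, continuous u}.
Proof. by move=> du; apply: differentiable_continuous; apply/derivable1_diffP. Qed.

Lemma Ck_continuous n u : Ck n.+1 setT u -> continuous u.
Proof. by move=> [du _] t; apply: derivable_continuous; apply: du. Qed.

Definition periodic2pi u := forall t, u (t + 2 * pi) = u t.

Lemma periodic_derive1 u : periodic2pi u -> periodic2pi (derive1 u).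
Proof.
move=> pu t; rewrite /derive1.
suff -> : (fun h : R => h^-1 *: (u (h + (t + 2 * pi)) - u (t + 2 * pi))) =
  (fun h => h^-1 *: (u (h + t) - u t)) by [].
by apply/funext => h; rewrite addrA !pu.
Qed.

Lemma periodic_pi u : periodic2pi u -> u pi = u (- pi).
Proof. by move=> /(_ (- pi)) <-; congr (u _); ring. Qed.

End smooth_functions.

Section fourier_coefficients.
Variable R : realType.
Local Notation leb := (@lebesgue_measure R).
Local Notation arc := (`]- pi, pi]%classic : set R).
Implicit Types (u v : R -> R) (k : int).

Definition fcos u k : R := \int[leb]_(t in arc) (u t * cos (k%:~R * t)).
Definition fsin u k : R := \int[leb]_(t in arc) (u t * sin (k%:~R * t)).

Lemma arc_integrable u : continuous u -> leb.-integrable arc (EFin \o u).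
Proof.
move=> cu; have : leb.-integrable `[- pi, pi] (EFin \o u).
  apply: continuous_compact_integrable; first exact: segment_compact.
  exact: continuous_subspaceT.
apply: integrableS => //.
by move=> t /=; rewrite !in_itv /= => /andP[/ltW -> ->].
Qed.

Lemma continuous_cosM (a : R) : continuous (fun t : R => cos (a * t)).
Proof. by apply: continuous_is => t; exact: is_derive_cosM. Qed.

Lemma continuous_sinM (a : R) : continuous (fun t : R => sin (a * t)).
Proof. by apply: continuous_is => t; exact: is_derive_sinM. Qed.

Lemma continuous_mul u v : continuous u -> continuous v ->
  continuous (fun t => u t * v t).
Proof. by move=> cu cv t; apply: cvgM; [exact: cu|exact: cv]. Qed.

Lemma coef_by_parts u k : Ck 2 setT u -> periodic2pi u ->
  k%:~R * fcos u k = - fsin (derive1 u) k /\ k%:~R * fsin u k = fcos (derive1 u) k.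
Proof.
move=> hu pu; have [du hu'] := hu.
have cu := Ck_continuous hu; have cu' := @Ck_continuous _ 0 _ hu'.
have cc := @continuous_cosM k%:~R; have cs := @continuous_sinM k%:~R.
have ds (t : R) : is_derive t 1 (fun x => u x * sin (k%:~R * x))
    (derive1 u t * sin (k%:~R * t) + k%:~R * (u t * cos (k%:~R * t))).
  have h1 := is_derive_derive1 (du t Logic.I); have h2 := is_derive_sinM k%:~R t.
  by apply: is_derive_eq; rewrite /GRing.scale /=; ring.
have dc (t : R) : is_derive t 1 (fun x => u x * cos (k%:~R * x))
    (derive1 u t * cos (k%:~R * t) - k%:~R * (u t * sin (k%:~R * t))).
  have h1 := is_derive_derive1 (du t Logic.I); have h2 := is_derive_cosM k%:~R t.
  by apply: is_derive_eq; rewrite /GRing.scale /=; ring.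
have iuc := arc_integrable (continuous_mul cu cc).
have ius := arc_integrable (continuous_mul cu cs).
have iu'c := arc_integrable (continuous_mul cu' cc).
have iu's := arc_integrable (continuous_mul cu' cs).
have kint (w : R -> R) : leb.-integrable arc (EFin \o w) ->
    leb.-integrable arc (EFin \o (fun t => k%:~R * w t)).
  move=> iw; rewrite (_ : _ \o _ = (fun t => (k%:~R)%:E * (w t)%:E)%E)//.
  exact: integrableZl.
have marc : measurable (arc : set (measurableTypeR R)) by exact: measurable_itv.
have upi := periodic_pi pu.
split.
  have : \int[leb]_(t in arc) derive1 (fun x => u x * sin (k%:~R * x)) t = 0.
    apply: arc_integral_deriv; first by move=> t; have [] := ds t.
      rewrite (derive1_is ds) => t; apply: cvgD; first exact: continuous_mul.
      by apply: cvgM; [exact: cvg_cst|exact: continuous_mul].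
    by rewrite mulrN sinN sin_kpi oppr0 !mulr0.
  rewrite (derive1_is ds) RintegralD//; last exact: kint.
  by rewrite RintegralZl// => h; apply/eqP; rewrite -subr_eq0 opprK addrC; apply/eqP/h.
have : \int[leb]_(t in arc) derive1 (fun x => u x * cos (k%:~R * x)) t = 0.
  apply: arc_integral_deriv; first by move=> t; have [] := dc t.
    rewrite (derive1_is dc) => t; apply: cvgB; first exact: continuous_mul.
    by apply: cvgM; [exact: cvg_cst|exact: continuous_mul].
  by rewrite mulrN cosN upi.
rewrite (derive1_is dc) RintegralB//; last exact: kint.
by rewrite RintegralZl// => h; apply/eqP; rewrite eq_sym -subr_eq0; apply/eqP/h.
Qed.

(** Each integration by parts gains a factor 1 / |k|. One derivative is reserved for continuity of
    the last integrand, so m + 1 derivatives give order m. *)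
Lemma coef_decay m u : Ck m.+1 setT u -> periodic2pi u -> exists2 C : R, 0 <= C &
  forall k, k != 0 -> `|fcos u k| <= C / `|k%:~R| ^+ m /\ `|fsin u k| <= C / `|k%:~R| ^+ m.
Proof.
elim: m u => [|m ih] u hu pu.
  have cu := Ck_continuous hu.
  have marc : measurable (arc : set (measurableTypeR R)) by exact: measurable_itv.
  exists (\int[leb]_(t in arc) `|u t|); first by apply: Rintegral_ge0.
  have iu : leb.-integrable arc (EFin \o (fun t => `|u t|)).
    by apply: arc_integrable => t; apply: cvg_norm; exact: cu.
  have bound (w : R -> R) : continuous w -> (forall t, `|w t| <= 1) ->
      `|\int[leb]_(t in arc) (u t * w t)| <= \int[leb]_(t in arc) `|u t|.
    move=> cw w1; have iuw := arc_integrable (continuous_mul cu cw).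
    rewrite (le_trans (le_normr_Rintegral _ _))//.
    apply: le_Rintegral => //.
      by apply: arc_integrable => t; apply: cvg_norm; exact: continuous_mul.
    by move=> t _; rewrite normrM ler_piMr.
  move=> k k0; rewrite expr0 divr1; split; apply: bound.
  - exact: continuous_cosM.
  - by move=> t; rewrite ler_norml cos_geN1 cos_le1.
  - exact: continuous_sinM.
  - by move=> t; rewrite ler_norml sin_geN1 sin_le1.
have [du hu'] := hu.
have [C C0 hC] := ih _ hu' (periodic_derive1 pu).
exists C => // k k0; have [h1 h2] := hC k k0.
have [e1 e2] := @coef_by_parts u k (conj du (conj (proj1 hu') Logic.I)) pu.
have k0' : 0 < `|k%:~R : R| by rewrite normr_gt0 intr_eq0.
have kn : k%:~R != 0 :> R by rewrite intr_eq0.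
have step (x y : R) : k%:~R * x = y -> `|y| <= C / `|k%:~R| ^+ m ->
    `|x| <= C / `|k%:~R| ^+ m.+1.
  move=> xy hy; have -> : x = y / k%:~R by rewrite -xy mulrAC mulfV// mul1r.
  rewrite normrM normfV exprSr invfM mulrA.
  by rewrite ler_wpM2r// invr_ge0 normr_ge0.
by split; [apply: (step _ _ e1); rewrite normrN|exact: (step _ _ e2)].
Qed.

End fourier_coefficients.

(** * Chord estimates and pointwise convergence of Fourier series *)

Section circle_parametrization.
Variable R : realType.
Implicit Types (t x : R) (z : circle R).

Lemma expiD t x : sval (expi (t + x)) = sval (expi t) * sval (expi x).
Proof.
by rewrite /= cosD sinD; apply/eqP; rewrite eq_complex /= eqxx /= addrC.
Qed.

Lemma expi_surj z : exists2 t, - pi <= t <= pi & z = expi t.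
Proof.
case zE : (sval z) (cnorm2_circle z) => [a b]; rewrite /cnorm2 /= => ab.
have a1 : -1 <= a <= 1.
  by have := sqr_ge0 b; rewrite -ler_norml -(@expr_le1 _ 2)// real_normK ?num_real//; lra.
have [/andP[t0 tpi] ct] := acos_def a1.
have st : sin (acos a) = `|b| by rewrite sin_acos// -sqrtr_sqr; congr Num.sqrt; lra.
have [b0|b0] := leP 0 b.
  exists (acos a); first by rewrite tpi (le_trans _ t0)// oppr_le0 pi_ge0.
  by apply/val_inj; rewrite /= [LHS]zE ct st ger0_norm.
exists (- acos a); first by rewrite lerNl opprK tpi/= (le_trans _ (pi_ge0 R))// oppr_le0.
by apply/val_inj; rewrite /= [LHS]zE cosN sinN ct st ltr0_norm// opprK.
Qed.

Lemma expi_surj_at t z : exists2 x, - pi <= x <= pi & z = expi (t + x).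
Proof.
have hz : `|sval z * (sval (expi t))^*%C| == 1 :> R[i].
  by rewrite normrM normcJ (eqP (svalP z)) (eqP (svalP (expi t))) mulr1.
pose z' : circle R := exist (fun y : R[i] => `|y| == 1) _ hz.
have [x x1 ex] := expi_surj z'; exists x => //; apply/val_inj.
have e1 : sval z * (sval (expi t))^*%C = sval (expi x) by rewrite -ex.
rewrite [RHS]expiD -e1 mulrCA [sval (expi t) * _]mulcJ.
by rewrite -/(cnorm2 (sval (expi t))) cnorm2_circle mulr1.
Qed.

Lemma cnorm2_chord t x : cnorm2 (sval (expi (t + x)) - sval (expi t)) = 2 - 2 * cos x.
Proof.
rewrite expiD -[X in _ - X]mulr1 -mulrBr cnorm2M cnorm2_circle mul1r /cnorm2 /=.
rewrite subr0; have := cos2Dsin2 x; move: (cos x) (sin x) => c s h.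
have -> : s ^+ 2 = 1 - c ^+ 2 by rewrite -h; ring.
ring.
Qed.

Lemma bounded_circle (U : circle R -> R) : continuous (fun t => U (expi t)) ->
  exists M, forall z, `|U z| <= M.
Proof.
move=> cU; have [||c _ hc] := @EVT_max R (fun t => `|U (expi t)|) (- pi) pi.
- by rewrite ltW// pi_lt.
- by apply: continuous_subspaceT => t; apply: cvg_norm; exact: cU.
exists `|U (expi c)| => z; have [t tpi ->] := expi_surj z.
by apply: hc; rewrite in_itv.
Qed.

Lemma derivable_lipschitz_at (u : R -> R) t : derivable u t 1 ->
  exists2 d, 0 < d & exists K, forall x, `|x| < d -> (u (t + x) - u t) ^+ 2 <= K * x ^+ 2.
Proof.
move=> /cvg_ex[l /= /cvgrPdist_lt/(_ 1 ltr01)].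
move=> /nbhs_ballP[d d0 hd]; exists d => //; exists ((`|l| + 1) ^+ 2) => x xd.
have [->|x0] := eqVneq x 0.
  by rewrite addr0 subrr !expr0n /= mulr0.
have /hd : ball (0 : R) d x by rewrite -ball_normE /ball_ /= sub0r normrN.
move=> /(_ x0) /=; rewrite [x *: 1]mulr1 [x + t]addrC => h.
have {}h : `|x^-1 * (u (t + x) - u t)| <= `|l| + 1.
  have -> : x^-1 * (u (t + x) - u t) = l - (l - x^-1 *: (u (t + x) - u t)).
    by rewrite subKr.
  by rewrite (le_trans (ler_normB _ _))// lerD2l ltW.
rewrite -(real_normK (num_real (u (t + x) - u t))) -(real_normK (num_real x)) -exprMn.
rewrite lerXn2r ?nnegrE ?mulr_ge0 ?addr_ge0//.
by move: h; rewrite normrM normfV mulrC ler_pdivrMr ?normr_gt0.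
Qed.

Lemma sin_sqr_lower : exists2 d : R, 0 < d & forall x, `|x| < d -> x ^+ 2 <= 4 * sin x ^+ 2.
Proof.
have [ds es] : is_derive (0 : R) 1 (@sin R) 1 by rewrite -[X in is_derive _ _ _ X]cos0; exact: is_derive_sin.
have : h^-1 *: (sin (h *: 1 + 0) - sin (0 : R)) @[h --> 0^'] --> (1 : R).
  by rewrite -[X in _ --> X]es; exact: ds.
have h2 : (0 : R) < 1 / 2 by rewrite divr_gt0.
move=> /cvgrPdist_lt/(_ _ h2) /nbhs_ballP[d d0 hd]; exists d => // x xd.
have [->|x0] := eqVneq x 0; first by rewrite sin0 !expr0n /= mulr0.
have /hd : ball (0 : R) d x by rewrite -ball_normE /ball_ /= sub0r normrN.
move=> /(_ x0) /=; rewrite [x *: 1]mulr1 addr0 sin0 subr0 => h.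
have {}h : 1 / 2 <= `|x^-1 * sin x|.
  rewrite (le_trans _ (ler_norm _))//; move: h; rewrite ltr_norml => /andP[_].
  rewrite /GRing.scale /=; lra.
rewrite -(real_normK (num_real x)) -(real_normK (num_real (sin x))).
have -> : (4 : R) = 2 ^+ 2 by rewrite expr2; lra.
rewrite -exprMn lerXn2r ?nnegrE ?mulr_ge0//.
move: h; rewrite normrM normfV [`|x|^-1 * _]mulrC ler_pdivlMr ?normr_gt0//; lra.
Qed.

(** Near z0 differentiability bounds the difference by the angle, and the sine bounds the angle by
    the chord. At angular distance d or more the chord is bounded below and boundedness of U
    suffices. The two terms of B correspond to these cases. *)
Lemma chord_lipschitz (U : circle R -> R) : (forall t, derivable (fun t => U (expi t)) t 1) ->
  forall z0, exists2 B, 0 <= B & forall z,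
    (U z - U z0) ^+ 2 <= B * cnorm2 (sval z - sval z0).
Proof.
move=> dU z0; have [t _ ->] := expi_surj z0.
have [|M hM] := @bounded_circle U; first by move=> x; exact: derivable_continuous.
have [d1 d10 [K hK]] := derivable_lipschitz_at (dU t).
have [d2 d20 hs] := sin_sqr_lower.
pose d := Num.min d1 (Num.min d2 pi).
have d0 : 0 < d by rewrite !lt_min d10 d20 pi_gt0.
have dpi : d <= pi by rewrite !ge_min lexx !orbT.
have eta0 : 0 < 2 - 2 * cos d.
  have : cos d < cos 0 by rewrite ltr_cos ?in_itv /= ?lexx ?pi_ge0// (ltW d0) dpi.
  by rewrite cos0; lra.
have M0 : 0 <= M by exact: le_trans (normr_ge0 _) (hM (expi t)).
exists (4 * `|K| + 4 * M ^+ 2 / (2 - 2 * cos d)).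
  by rewrite addr_ge0 ?mulr_ge0// ?invr_ge0 ?(ltW eta0)// exprn_ge0.
move=> z; have [x xpi ->] := expi_surj_at t z.
rewrite cnorm2_chord; set C := 2 - 2 * cos x.
have CE : C = (1 - cos x) ^+ 2 + sin x ^+ 2.
  by rewrite /C; have := cos2Dsin2 x; move: (cos x) (sin x) => c s; lra.
have C0 : 0 <= C by rewrite CE addr_ge0 ?sqr_ge0.
have P1 : 0 <= 4 * `|K| * C by rewrite !mulr_ge0.
have P2 : 0 <= 4 * M ^+ 2 / (2 - 2 * cos d) * C.
  by rewrite !mulr_ge0// ?invr_ge0 ?(ltW eta0)// exprn_ge0.
rewrite mulrDl; have [xd|dx] := ltP `|x| d.
  have x1 : `|x| < d1 by rewrite (lt_le_trans xd)// ge_min lexx.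
  have x2 : `|x| < d2 by rewrite (lt_le_trans xd)// !ge_min lexx orbT.
  have h1 := hK _ x1; have h2 := hs _ x2.
  have : K * x ^+ 2 <= `|K| * (4 * C).
    rewrite (le_trans (ler_norm _))// normrM ler_wpM2l// ger0_norm ?sqr_ge0//.
    by rewrite (le_trans h2)// ler_wpM2l// CE lerDr sqr_ge0.
  lra.
have : 4 * M ^+ 2 <= 4 * M ^+ 2 / (2 - 2 * cos d) * C.
  rewrite -mulrA ler_peMr ?mulr_ge0 ?exprn_ge0// mulrC ler_pdivlMr// mul1r /C.
  have -> : cos x = cos `|x| by case: ler0P => _ //; rewrite cosN.
  have : cos `|x| <= cos d.
    rewrite leNgt ltr_cos ?in_itv /= ?(ltW d0)// -?leNgt//.
    by rewrite normr_ge0 ler_norml.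
  lra.
have : (U (expi (t + x)) - U (expi t)) ^+ 2 <= 4 * M ^+ 2.
  have -> : 4 * M ^+ 2 = (M + M) ^+ 2 by ring.
  rewrite -(real_normK (num_real (_ - _))) lerXn2r ?nnegrE ?addr_ge0//.
  by rewrite (le_trans (ler_normB _ _))// lerD.
lra.
Qed.

End circle_parametrization.

Section complex_modulus.
Variable R : realType.
Implicit Types (x y : R[i]) (a : R).

Definition cabs x : R := Num.sqrt (cnorm2 x).

Lemma cabs_ge0 x : 0 <= cabs x.
Proof. exact: sqrtr_ge0. Qed.

Lemma cabs_sqr x : cabs x ^+ 2 = cnorm2 x.
Proof. by rewrite sqr_sqrtr ?cnorm2_ge0. Qed.

Lemma cabsD x y : cabs (x + y) <= cabs x + cabs y.
Proof.
have h z : cabs z = ComplexField.Normc.normc z by case: z.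
by rewrite !h; exact: le_normcD.
Qed.

Lemma cabsN x : cabs (- x) = cabs x.
Proof. by rewrite /cabs /cnorm2 cReN cImN !sqrrN. Qed.

Lemma cabsM x y : cabs (x * y) = cabs x * cabs y.
Proof. by rewrite /cabs cnorm2M sqrtrM ?cnorm2_ge0. Qed.

Lemma cabs0 : cabs 0 = 0.
Proof. by rewrite /cabs /cnorm2 /= expr0n /= addr0 sqrtr0. Qed.

Lemma cabs_real a : cabs a%:C = `|a|.
Proof. by rewrite /cabs /cnorm2 /= expr0n /= addr0 sqrtr_sqr. Qed.

Lemma cabs_sum n (F : 'I_n -> R[i]) : cabs (\sum_k F k) <= \sum_k cabs (F k).
Proof.
elim/big_rec2 : _ => [|k r s _ h]; first by rewrite cabs0.
by rewrite (le_trans (cabsD _ _))// lerD2l.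
Qed.

Lemma cabs_chi k (z : circle R) : cabs (chi k z) = 1.
Proof. by rewrite /cabs cnorm2_chi sqrtr1. Qed.

(** Expresses inversion through the measurable function [powR], and remains true at 0, where both
    sides are 0. *)
Lemma cinvE x : x^-1 = x^*%C * (cnorm2 x `^ (-1))%:C.
Proof.
rewrite powR_inv1 ?cnorm2_ge0//; have [->|x0] := eqVneq x 0.
  by rewrite invr0 conjc0 mul0r.
apply: (mulfI x0); rewrite mulfV// mulrA mulcJ -/(cnorm2 x) -rmorphM mulfV//.
by rewrite cnorm2_eq0.
Qed.

End complex_modulus.

Section pointwise_inversion.
Variable R : realType.
Variable U : circle R -> R.
Hypothesis dU : forall t, derivable (fun t => U (expi t)) t 1.
Implicit Types (z : circle R).

(** The circle carries the topology of the plane, so differentiability in the angle is converted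
    through the chord estimate. *)
Lemma circle_continuous : continuous U.
Proof.
move=> z0; have [B B0 hB] := chord_lipschitz dU z0.
move=> A /nbhs_ballP[e e0 hA].
have hz : {for z0, continuous (@circle_val R)} by exact: initial_continuous.
have B1 : 0 < B + 1 by rewrite ltr_pwDr.
have d0 : (0 : R[i]) < (e / Num.sqrt (B + 1))%:C by rewrite ltcR divr_gt0// sqrtr_gt0.
have hU : nbhs (circle_val z0) [set y | `|circle_val z0 - y| < (e / Num.sqrt (B + 1))%:C].
  by apply/nbhs_ballP; exists (e / Num.sqrt (B + 1))%:C => // y; rewrite -ball_normE.
have hn : nbhs z0 ((@circle_val R) @^-1` [set y | `|circle_val z0 - y| < (e / Num.sqrt (B + 1))%:C]) by exact: hz hU.
rewrite /= nbhs_simpl; apply: filterS hn => z /=; rewrite -normrN opprB.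
rewrite normc_def ltcR ltr_pdivlMr ?sqrtr_gt0// => hlt.
apply: hA; rewrite -ball_normE /ball_ /= distrC -sqrtr_sqr; apply: le_lt_trans hlt.
rewrite -sqrtrM ?cnorm2_ge0// ler_wsqrtr// (le_trans (hB z))// mulrC.
by rewrite ler_wpM2l ?cnorm2_ge0// lerDl.
Qed.


Lemma cmeasurable_real (u : circle R -> R) : measurable_fun setT u ->
  cmeasurable (fun z => (u z)%:C).
Proof. by move=> mu; split=> //; exact: measurable_cst. Qed.

Lemma measurable_circle_derivable : measurable_fun setT U.
Proof.
have [h _] : cmeasurable (fun z => (U z)%:C) by
  apply: cmeasurable_continuous => /=; [exact: circle_continuous|exact: cst_continuous].
exact: h.
Qed.

Lemma cLfun2_real : cLfun 2%:E (fun z => (U z)%:C).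
Proof.
have [|M hM] := @bounded_circle R U; first by move=> x; exact: derivable_continuous.
have mU := cmeasurable_real measurable_circle_derivable.
apply: (@cLfun2_bounded R M _ mU).
apply: aeW => z; rewrite {1}/cnorm2 /= expr0n /= addr0 -(real_normK (num_real (U z))).
have M0 := le_trans (normr_ge0 _) (hM z).
by rewrite lerXn2r ?nnegrE ?hM.
Qed.

Let FU := toL2 cLfun2_real.

(** [Negz k] is -(k + 1), so the 2n frequencies run from -n to n - 1; on this range differences T k
    - T (k + 1) telescope to T (-n) - T n. *)
Definition fourier_partial (n : nat) z : R[i] := \sum_(k < n)
  (L2ip R FU (Chi R (Posz k)) * chi (Posz k) z +
   L2ip R FU (Chi R (Negz k)) * chi (Negz k) z).

Lemma fourier_partialS n z : fourier_partial n.+1 z = fourier_partial n z +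
  (L2ip R FU (Chi R (Posz n)) * chi (Posz n) z +
   L2ip R FU (Chi R (Negz n)) * chi (Negz n) z).
Proof. by rewrite /fourier_partial big_ord_recr. Qed.

(* Chernoff's argument: U(z) - U(z0) = (z - z0) g(z) with g bounded, so that the
   partial sums at z0 telescope into Fourier coefficients of g. *)
Lemma fourier_partial_cvg z0 e : 0 < e ->
  exists N, forall n, (N <= n)%N -> cabs (fourier_partial n z0 - (U z0)%:C) < e.
Proof.
move=> e0; have [B B0 hB] := chord_lipschitz dU z0.
(* g is bounded by [chord_lipschitz]. At z0 the inverse is 0, and (z - z0) g(z) = U(z) - U(z0) still
   holds there. *)
pose g z := (U z - U z0)%:C * (sval z - sval z0)^-1.
have m1 : cmeasurable (fun z : circle R => sval z - sval z0).
  exact: (cmeasurableD (cmeasurable_chi R 1) (cmeasurable_cst (- sval z0))).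
have [m1r m1i] := m1.
have mg : cmeasurable g.
  have gE z : g z = (U z - U z0)%:C *
     ((sval z - sval z0)^*%C * (cnorm2 (sval z - sval z0) `^ (-1))%:C).
    by rewrite /g cinvE.
  rewrite (funext gE); apply: cmeasurableM.
    apply: cmeasurable_real; apply: measurable_funB; last exact: measurable_cst.
    exact: measurable_circle_derivable.
  apply: cmeasurableM.
    split; first by under eq_fun do rewrite cReJ; exact: m1r.
    by under eq_fun do rewrite cImJ; apply: measurableT_comp => //; exact: m1i.
  apply: cmeasurable_real; have /measurable_EFinP mn := cmeasurable_cnorm2 m1.
  exact: (measurableT_comp (@measurable_powR R (-1)) mn).
have gB : {ae circle_measure R, forall z, cnorm2 (g z) <= Num.sqrt B ^+ 2}.
  apply: aeW => z; rewrite sqr_sqrtr// cnorm2M.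
  have [->|zz0] := eqVneq (sval z) (sval z0).
    by rewrite subrr invr0 {2}/cnorm2 /= expr0n /= addr0 mulr0.
  have n0 : 0 < cnorm2 (sval z - sval z0).
    by rewrite lt_def cnorm2_ge0 cnorm2_eq0 subr_eq0 zz0.
  have -> : cnorm2 (sval z - sval z0)^-1 = (cnorm2 (sval z - sval z0))^-1.
    apply: (mulfI (lt0r_neq0 n0)); rewrite -cnorm2M mulfV ?subr_eq0// mulfV ?lt0r_neq0//.
    by rewrite /cnorm2 /= expr1n expr0n /= addr0.
  by rewrite ler_pdivrMr// {1}/cnorm2 /= expr0n /= addr0.
have g2 := cLfun2_bounded mg gB.
have c1 : {ae circle_measure R, forall z : circle R, cnorm2 (chi 1 z) <= 1 ^+ 2}.
  by apply: aeW => z; rewrite cnorm2_chi expr1n.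
have [M2 _] := cLfun2_mul_bounded (cmeasurable_chi R 1) c1 g2.
pose G := toL2 g2; pose M := toL2 M2; pose gh k := L2ip R G (Chi R k).
have rel : FU - (U z0)%:C *: Chi R 0 = M - sval z0 *: G.
  apply/val_inj/funext => z.
  rewrite -[LHS]/((U z)%:C - (U z0)%:C * chi 0 z) chi0 mulr1.
  rewrite -[RHS]/(chi 1 z * g z - sval z0 * g z) -mulrBl /g.
  rewrite -rmorphB mulrCA; have [e1|zz0] := eqVneq (sval z) (sval z0).
    by rewrite (val_inj e1 : z = z0) subrr mul0r.
  by rewrite [chi 1 z]expr1z mulfV ?mulr1// subr_eq0.
(* Multiplication by z shifts Fourier coefficients by one. Multiplied by z0^k, the last bracket
   becomes the difference T k - T (k + 1). *)
have FE k : L2ip R FU (Chi R k) = (U z0)%:C * (k == 0)%:R + (gh (k - 1) - sval z0 * gh k).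
  have -> : FU = (U z0)%:C *: Chi R 0 + (M - sval z0 *: G) by rewrite -rel addrC subrK.
  rewrite ipDl ipBl !ipZl ip_Chi eq_sym; congr (_ + (_ - _)).
  apply: cint_eq => z; rewrite -[LHS]/(chi 1 z * g z * (chi k z)^*%C).
  rewrite -[RHS]/(g z * (chi (k - 1) z)^*%C) mulrAC mulrC -!chiN -chiD.
  by congr (_ * chi _ _); rewrite opprB.
pose T k := chi k z0 * gh (k - 1).
have TE k : chi k z0 * (gh (k - 1) - sval z0 * gh k) = T k - T (k + 1).
  by rewrite /T chiD addrK mulrBr mulrA.
have SE n : fourier_partial n z0 = (0 < n)%N%:R * (U z0)%:C + (T (- n%:Z) - T n%:Z).
  elim: n => [|n ih]; first by rewrite /fourier_partial big_ord0 mul0r subrr addr0.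
  rewrite fourier_partialS ih !FE.
  have h1 := TE n; have h2 := TE (Negz n).
  have e1 : Negz n + 1 = - n%:Z by rewrite NegzE; lia.
  have e2 : Posz n.+1 = n%:Z + 1 by lia.
  have -> : - Posz n.+1 = Negz n by rewrite NegzE.
  rewrite e2; rewrite e1 in h2.
  have D (a b c : R[i]) : (a + b) * c = a * c + c * b by rewrite mulrDl [b * c]mulrC.
  rewrite !D h1 h2 /= mulr0 mul0r mul1r add0r.
  case: n {ih h1 h2 e1 e2} => [|n]; first by rewrite chi0 mulr1 /=; ring.
  by rewrite /= mulr0 mul0r; ring.
pose X1 (k : nat) := Chi R (Posz k); pose X2 (k : nat) := Chi R (Negz k).
have o1 i j : L2ip R (X1 i) (X1 j) = (i == j)%:R by rewrite ip_Chi.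
have o2 i j : L2ip R (X2 i) (X2 j) = (i == j)%:R by rewrite ip_Chi.
have e22 : 0 < (e / 2) ^+ 2 by rewrite exprn_gt0// divr_gt0.
have [N1 hN1] := coef_cvg0 o1 G e22; have [N2 hN2] := coef_cvg0 o2 G e22.
have small x : cnorm2 x < (e / 2) ^+ 2 -> cabs x < e / 2.
  by rewrite -[cnorm2 x]cabs_sqr ltr_pXn2r ?nnegrE ?cabs_ge0// divr_ge0// ltW.
exists (maxn N1 N2).+1 => -[//|n]; rewrite ltnS geq_max => /andP[n1 n2].
rewrite SE mul1r addrAC subrr add0r (le_lt_trans (cabsD _ _))// cabsN /T !cabsM !cabs_chi !mul1r.
rewrite [e]splitr ltrD//; apply: small.
  have -> : - Posz n.+1 - 1 = Negz n.+1 by rewrite NegzE; lia.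
  by apply: hN2; rewrite (leq_trans n2).
have -> : Posz n.+1 - 1 = Posz n by lia.
exact: hN1.
Qed.


End pointwise_inversion.

Section trigonometric_approximation.
Variable R : realType.
Implicit Types (z : circle R).

Lemma periodic_expi (t : R) : expi (t + 2 * pi) = expi t.
Proof.
apply/val_inj; rewrite [LHS]expiD [sval (expi (2 * pi))]/= [2 * pi]mulr_natl cos2pi sin2pi.
exact: mulr1.
Qed.

Lemma fourier_coef_le (U : circle R -> R) (dU : forall t, derivable (fun t => U (expi t)) t 1) k :
  cabs (L2ip R (toL2 (cLfun2_real dU)) (Chi R k)) <= (2 * pi)^-1 *
    (`|fcos (fun t => U (expi t)) k| + `|fsin (fun t => U (expi t)) k|).
Proof.
have [i1 i2] := cLfun2_mulJ (cLfun2_real dU) (cLfun2_chi R k).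
have p0 : 0 <= (2 * pi)^-1 :> R by rewrite invr_ge0 mulr_ge0// pi_ge0.
have -> : L2ip R (toL2 (cLfun2_real dU)) (Chi R k) =
    ((2 * pi)^-1 * fcos (fun t => U (expi t)) k) +i*
    (- ((2 * pi)^-1 * fsin (fun t => U (expi t)) k)).
  rewrite -[LHS]/(inner (fun z => (U z)%:C) (chi k)) /inner /circle_integral !circle_RintegralE// -mulrN; congr (_ +i* (_ * _)).
    by congr (_ * _); apply: eq_Rintegral => t _; rewrite chi_expi cReZ.
  rewrite /fsin -mulN1r -RintegralZl//; last first.
    apply: arc_integrable; apply: continuous_mul; last exact: continuous_sinM.
    by move=> t; exact: derivable_continuous.
  by apply: eq_Rintegral => t _; rewrite chi_expi cImZ /= mulrN mulN1r.
set a := fcos _ _; set b := fsin _ _.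
have -> : ((2 * pi)^-1 * a) +i* (- ((2 * pi)^-1 * b)) =
   ((2 * pi)^-1)%:C * (a%:C + (0 +i* (-1)) * b%:C).
  by apply/eqP; rewrite eq_complex /=; apply/andP; split; apply/eqP; ring.
rewrite cabsM cabs_real ger0_norm// ler_wpM2l// (le_trans (cabsD _ _))// cabsM !cabs_real.
by rewrite /cabs {1}/cnorm2 /= expr0n sqrrN expr1n add0r sqrtr1 mul1r.
Qed.

(** Telescoping of 1 / x^2 <= 2 / x - 2 / (x + 1), valid for x >= 1. *)
Lemma sum_inv_sqr_le (n m : nat) : (0 < n)%N ->
  \sum_(j < m) ((n + j)%:R ^+ 2)^-1 <= 2 / n%:R - 2 / (n + m)%:R :> R.
Proof.
move=> n0; elim: m => [|m ih]; first by rewrite big_ord0 addn0 subrr.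
rewrite big_ord_recr /= (le_trans (lerD ih (lexx _)))//.
have : 1 <= (n + m)%:R :> R by rewrite ler1n addn_gt0 n0.
rewrite addnS -[(n + m).+1%:R]natr1; move: (n + m)%:R => x x1.
have x0 : 0 < x by lra.
have -> : 2 / n%:R - 2 / x + (x ^+ 2)^-1 = 2 / n%:R - (2 / x - (x ^+ 2)^-1) by ring.
rewrite lerB// lerBrDr -lerBrDl.
have -> : 2 / x - 2 / (x + 1) = 2 / (x * (x + 1)) by field; apply/andP; split; lra.
rewrite ler_pdivlMr ?mulr_gt0//; last lra.
rewrite mulrC ler_pdivrMr ?exprn_gt0//; nra.
Qed.

(** With q + 3 derivatives the coefficients decay like |k|^-(q+2): a factor n^-q is taken out of the
    tail and the summable k^-2 remains. Pointwise convergence allows U(z) to be replaced by a far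
    partial sum up to e. *)
Lemma fourier_rate q (U : circle R -> R)
  (dU : forall t, derivable (fun t => U (expi t)) t 1) :
  Ck q.+3 setT (fun t => U (expi t)) ->
  exists2 C : R, 0 <= C & forall n, (0 < n)%N -> forall z,
    cabs (fourier_partial dU n z - (U z)%:C) <= C / n%:R ^+ q.
Proof.
move=> hU; have pU : periodic2pi (fun t => U (expi t)) by move=> t; rewrite periodic_expi.
have [C C0 hC] := coef_decay hU pU.
have p0 : 0 <= (2 * pi)^-1 :> R by rewrite invr_ge0 mulr_ge0// pi_ge0.
pose D := (2 * pi)^-1 * (C + C).
have D0 : 0 <= D by rewrite mulr_ge0// addr_ge0.
have hF k : k != 0 -> cabs (L2ip R (toL2 (cLfun2_real dU)) (Chi R k)) <= D / `|k%:~R| ^+ q.+2.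
  move=> /hC[h1 h2]; apply: (le_trans (fourier_coef_le dU k)); rewrite /D -mulrA ler_wpM2l// mulrDl.
  exact: lerD.
exists (2 * D * 2); first by rewrite mulr_ge0// mulr_ge0.
move=> n n0 z; apply/ler_addgt0Pr => e e0.
have [M hM] := fourier_partial_cvg dU z e0.
have {hM} := hM _ (leq_addl n M); set SM := fourier_partial dU (n + M) z => hM.
have -> : fourier_partial dU n z - (U z)%:C = - (SM - fourier_partial dU n z) + (SM - (U z)%:C).
  by rewrite opprB addrA subrK.
apply: le_trans (cabsD _ _) _; rewrite cabsN; apply: lerD; last exact: ltW.
have n0' : 0 < n%:R :> R by rewrite ltr0n.
have -> : SM - fourier_partial dU n z = \sum_(j < M)
  (L2ip R (toL2 (cLfun2_real dU)) (Chi R (Posz (n + j))) * chi (Posz (n + j)) z +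
   L2ip R (toL2 (cLfun2_real dU)) (Chi R (Negz (n + j))) * chi (Negz (n + j)) z).
  by rewrite /SM /fourier_partial big_split_ord /= addrAC subrr add0r.
rewrite (le_trans (cabs_sum _))//.
have bound (j : nat) : 
  cabs (L2ip R (toL2 (cLfun2_real dU)) (Chi R (Posz (n + j))) * chi (Posz (n + j)) z +
   L2ip R (toL2 (cLfun2_real dU)) (Chi R (Negz (n + j))) * chi (Negz (n + j)) z)
  <= 2 * D / n%:R ^+ q * ((n + j)%:R ^+ 2)^-1.
  have nj0 : (0 < n + j)%N by rewrite addn_gt0 n0.
  have nj0' : 0 < (n + j)%:R :> R by rewrite ltr0n.
  have njn : n%:R <= (n + j)%:R :> R by rewrite ler_nat leq_addr.
  have base : D / (n + j)%:R ^+ q.+2 <= D / n%:R ^+ q * ((n + j)%:R ^+ 2)^-1.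
    have p1 : 0 < (n + j)%:R ^+ q.+2 :> R by rewrite exprn_gt0.
    have p2 : 0 < n%:R ^+ q * (n + j)%:R ^+ 2 :> R by rewrite mulr_gt0// exprn_gt0.
    rewrite -mulrA ler_wpM2l// -invfM lef_pV2 ?posrE//.
    by rewrite -(addn2 q) exprD ler_pM2r ?exprn_gt0// lerXn2r ?nnegrE ?ler0n.
  apply: le_trans (cabsD _ _) _; rewrite !cabsM !cabs_chi !mulr1.
  have k1 : Posz (n + j) != 0 by rewrite eqz_nat -lt0n.
  have -> : 2 * D / n%:R ^+ q * ((n + j)%:R ^+ 2)^-1 =
    D / n%:R ^+ q * ((n + j)%:R ^+ 2)^-1 + D / n%:R ^+ q * ((n + j)%:R ^+ 2)^-1 by ring.
  apply: lerD.
    by rewrite (le_trans (hF _ k1))// -pmulrn ger0_norm ?ler0n.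
  have k2 : Negz (n + j) != 0 by [].
  rewrite (le_trans (hF _ k2))// (le_trans _ base)// ler_wpM2l// lef_pV2 ?posrE ?exprn_gt0//.
    rewrite NegzE mulrNz normrN -pmulrn ger0_norm// lerXn2r ?nnegrE ?ler_nat//.
  by rewrite normr_gt0 intr_eq0.
apply: le_trans (ler_sum _ (fun (j : 'I_M) _ => bound j)) _; rewrite -mulr_sumr.
have E0 : 0 <= 2 * D / n%:R ^+ q by rewrite divr_ge0 ?exprn_ge0 ?ler0n// mulr_ge0.
rewrite [2 * D * 2 / _]mulrAC ler_wpM2l//.
rewrite (le_trans (sum_inv_sqr_le M n0))//.
have : 0 <= 2 / (n + M)%:R :> R by rewrite divr_ge0.
have : 2 / n%:R <= 2 :> R by rewrite ler_pdivrMr// ler_peMr// ler1n.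
lra.
Qed.

Lemma trig_approx q (U : circle R -> R[i]) :
  Ck q.+3 setT (fun t => complex.Re (U (expi t))) ->
  Ck q.+3 setT (fun t => complex.Im (U (expi t))) ->
  exists2 C : R, 0 <= C & forall n, (0 < n)%N -> exists a b : nat -> R[i], forall z,
    cabs (U z - \sum_(k < n) (a k * chi (Posz k) z + b k * chi (Negz k) z)) <= C / n%:R ^+ q.
Proof.
move=> h1 h2.
pose U1 z := complex.Re (U z); pose U2 z := complex.Im (U z).
have d1 t : derivable (fun t => U1 (expi t)) t 1 by have [d _] := h1; exact: d.
have d2 t : derivable (fun t => U2 (expi t)) t 1 by have [d _] := h2; exact: d.
have [C1 C10 hC1] := @fourier_rate q U1 d1 h1.
have [C2 C20 hC2] := @fourier_rate q U2 d2 h2.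
exists (C1 + C2); first exact: addr_ge0.
move=> n n0; pose F1 := toL2 (cLfun2_real d1); pose F2 := toL2 (cLfun2_real d2).
pose i := 0 +i* 1 : R[i].
exists (fun k => L2ip R F1 (Chi R (Posz k)) + i * L2ip R F2 (Chi R (Posz k))).
exists (fun k => L2ip R F1 (Chi R (Negz k)) + i * L2ip R F2 (Chi R (Negz k))) => z.
have -> : U z - \sum_(k < n)
  ((L2ip R F1 (Chi R (Posz k)) + i * L2ip R F2 (Chi R (Posz k))) * chi (Posz k) z +
   (L2ip R F1 (Chi R (Negz k)) + i * L2ip R F2 (Chi R (Negz k))) * chi (Negz k) z) =
  - (fourier_partial d1 n z - (U1 z)%:C) - i * (fourier_partial d2 n z - (U2 z)%:C).
  have -> : U z = (U1 z)%:C + i * (U2 z)%:C.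
    by apply/eqP; rewrite eq_complex /U1 /U2 /=; apply/andP; split; apply/eqP; ring.
  rewrite /fourier_partial -/F1 -/F2.
  have -> : \sum_(k < n)
  ((L2ip R F1 (Chi R (Posz k)) + i * L2ip R F2 (Chi R (Posz k))) * chi (Posz k) z +
   (L2ip R F1 (Chi R (Negz k)) + i * L2ip R F2 (Chi R (Negz k))) * chi (Negz k) z) =
  \sum_(k < n) (L2ip R F1 (Chi R (Posz k)) * chi (Posz k) z +
     L2ip R F1 (Chi R (Negz k)) * chi (Negz k) z) +
  i * \sum_(k < n) (L2ip R F2 (Chi R (Posz k)) * chi (Posz k) z +
     L2ip R F2 (Chi R (Negz k)) * chi (Negz k) z).
    rewrite mulr_sumr -big_split; apply: eq_bigr => k _.
    move: (L2ip R F1 (Chi R (Posz k))) (L2ip R F2 (Chi R (Posz k))) => x y.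
    by move: (L2ip R F1 (Chi R (Negz k))) (L2ip R F2 (Chi R (Negz k))) => x' y' /=; ring.
  by set x := \sum_(k < n) _; set y := \sum_(k < n) _; ring.
have ci : cabs i = 1 by rewrite /i /cabs /cnorm2 /= expr0n expr1n add0r sqrtr1.
apply: le_trans (cabsD _ _) _; rewrite !cabsN cabsM ci mul1r mulrDl.
by apply: lerD; [exact: hC1|exact: hC2].
Qed.

End trigonometric_approximation.

(** * Smooth cutoffs *)

Section smooth_calculus.
Variable R : realType.
Implicit Types (u v : R -> R) (U W : set R) (t : R).

Lemma Ck_pred n U u : Ck n.+1 U u -> Ck n U u.
Proof. by elim: n u => // n ih u [du hu]; split=> //; exact: ih. Qed.

Lemma Ck_sub n U W u : U `<=` W -> Ck n W u -> Ck n U u.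
Proof.
by move=> UW; elim: n u => // n ih u [du hu]; split=> [t /UW|]; [exact: du|exact: ih].
Qed.

Lemma Ck_setU n U W u : Ck n U u -> Ck n W u -> Ck n (U `|` W) u.
Proof.
elim: n u => // n ih u [du hu] [dw hw]; split=> [t []|]; [exact: du|exact: dw|exact: ih].
Qed.

Lemma Ck_local n U u v : open U -> (forall t, U t -> u t = v t) -> Ck n U u -> Ck n U v.
Proof.
move=> oU; elim: n u v => // n ih u v uv [du hu].
have near_uv t : U t -> {near t, u =1 v}.
  by move=> Ut; rewrite /prop_near1; apply: filterS uv _; apply: open_nbhs_nbhs.
split=> [t Ut|]; first by apply: near_eq_derivable (near_uv t Ut) _; exact: du.
apply: ih hu => t Ut; rewrite !derive1E; apply: near_eq_derive; exact: near_uv.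
Qed.

Lemma Ck_is_derive n U u v : open U -> (forall t, U t -> is_derive t 1 u (v t)) ->
  Ck n U v -> Ck n.+1 U u.
Proof.
move=> oU uv hv; split=> [t /uv[]//|]; apply: Ck_local hv => // t /uv h.
by rewrite derive1E derive_val.
Qed.

Lemma Ck_cst n U (a : R) : open U -> Ck n U (fun=> a).
Proof.
move=> oU; elim: n a => // n ih a; apply: (@Ck_is_derive _ _ _ (fun=> 0)) => //.
Qed.

Lemma CkD n U u v : open U -> Ck n U u -> Ck n U v -> Ck n U (fun t => u t + v t).
Proof.
move=> oU; elim: n u v => // n ih u v [du hu] [dv hv].
apply: (@Ck_is_derive _ _ _ (fun t => derive1 u t + derive1 v t)) => //; last exact: ih.
move=> t Ut; have h1 := is_derive_derive1 (du t Ut); have h2 := is_derive_derive1 (dv t Ut).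
exact: is_deriveD.
Qed.

Lemma CkM n U u v : open U -> Ck n U u -> Ck n U v -> Ck n U (fun t => u t * v t).
Proof.
move=> oU; elim: n u v => // n ih u v hu hv; have [du hu'] := hu; have [dv hv'] := hv.
have hd t : U t -> is_derive t 1 (fun t => u t * v t) (derive1 u t * v t + u t * derive1 v t).
  move=> Ut; have h1 := is_derive_derive1 (du t Ut); have h2 := is_derive_derive1 (dv t Ut).
  by apply: is_derive_eq; rewrite /GRing.scale /=; ring.
refine (Ck_is_derive oU hd _).
by apply: CkD => //; apply: ih => //; exact: Ck_pred.
Qed.

Lemma Ck_sum n U I (s : seq I) (P : pred I) (u : I -> R -> R) : open U ->
  (forall i, Ck n U (u i)) -> Ck n U (fun t => \sum_(i <- s | P i) u i t).
Proof.
move=> oU hu; elim: s => [|i s ih].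
  by under eq_fun do rewrite big_nil; exact: Ck_cst.
under eq_fun do rewrite big_cons; case: (P i) => //.
exact: CkD.
Qed.

Lemma CkV n U u : open U -> (forall t, U t -> u t != 0) -> Ck n U u ->
  Ck n U (fun t => (u t)^-1).
Proof.
move=> oU u0; elim: n u u0 => // n ih u u0 hu; have [du hu'] := hu.
have hd t : U t ->
    is_derive t 1 (fun t => (u t)^-1) (-1 * derive1 u t * ((u t)^-1 * (u t)^-1)).
  move=> Ut; have h1 := is_derive_derive1 (du t Ut).
  have -> : -1 * derive1 u t * ((u t)^-1 * (u t)^-1) = - (u t) ^- 2 *: derive1 u t.
    by rewrite /GRing.scale /= expr2 invfM; ring.
  by apply: is_deriveV; exact: u0.
refine (Ck_is_derive oU hd _).
have hV : Ck n U (fun t => (u t)^-1) by apply: ih => //; exact: Ck_pred.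
have h1 : Ck n U (fun t => -1 * derive1 u t) by apply: CkM => //; exact: Ck_cst.
by apply: CkM => //; apply: CkM.
Qed.

(** Away from 0 a single smooth branch is active; at 0 the difference quotient is 0 for h < 0 and
    h^(n+1) for h > 0. *)
Lemma is_derive_max0X n (x : R) :
  is_derive x 1 (fun y => Num.max y 0 ^+ n.+2) (n.+2%:R * Num.max x 0 ^+ n.+1).
Proof.
have [x0|x0|->] := ltgtP x 0.
- rewrite expr0n /= mulr0; apply: near_eq_is_derive (is_derive_cst (0 : R) x 1).
  near=> y; rewrite /cst; have y0 : y < 0 by near: y; exact: lt_nbhsl.
  by rewrite max_r ?expr0n// ltW.
- have h : is_derive x 1 (fun y : R => y ^+ n.+2) (n.+2%:R * x ^+ n.+1).
    have := is_derive_derive1 (@exprn_derivable R n.+2 x 1).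
    by rewrite exp_derive1.
  apply: near_eq_is_derive h.
  near=> y; have y0 : 0 < y by near: y; exact: lt_nbhsr.
  by rewrite max_l// ltW.
rewrite expr0n /= mulr0.
have lim : h^-1 *: ((fun y : R => Num.max y 0 ^+ n.+2) (h *: 1 + 0) -
    Num.max 0 0 ^+ n.+2) @[h --> 0^'] --> (0 : R).
  apply/cvgrPdist_lt => e e0; apply/nbhs_ballP; exists (Num.min e 1) => /=.
    by rewrite lt_min e0 ltr01.
  move=> h; rewrite -ball_normE /ball_ /= sub0r normrN lt_min => /andP[he h1] h0.
  rewrite maxxx expr0n /= subr0 addr0 [h *: 1]mulr1 sub0r normrN /GRing.scale /=.
  rewrite normrM normfV ltr_pdivrMl ?normr_gt0//.
  have [hle|hgt] := leP h 0; first by rewrite expr0n normr0 mulr_gt0// normr_gt0.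
  have nh : `|h| = h by rewrite gtr0_norm.
  rewrite normrX nh exprS ltr_pM2l//; rewrite nh in h1 he.
  apply: le_lt_trans he; rewrite exprS ler_piMr ?(ltW hgt)//.
  by rewrite exprn_ile1 ?(ltW hgt) ?(ltW h1).
have hd : derivable (fun y : R => Num.max y 0 ^+ n.+2) 0 1 by apply/cvg_ex; exists 0.
by apply: DeriveDef => //; exact/cvg_lim.
Unshelve. all: by end_near. Qed.

Lemma is_derive_cosB (t0 t : R) : is_derive t 1 (fun s => cos (s - t0)) (- sin (t - t0)).
Proof.
have h : is_derive t 1 (fun s : R => s - t0) 1.
  by have := is_deriveB (is_derive_id t 1) (is_derive_cst t0 t 1); rewrite subr0.
have := @is_derive1_comp R (@cos R) (fun s => s - t0) t _ _ (is_derive_cos _) h.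
by rewrite mulr1.
Qed.

Lemma is_derive_sinB (t0 t : R) : is_derive t 1 (fun s => sin (s - t0)) (cos (t - t0)).
Proof.
have h : is_derive t 1 (fun s : R => s - t0) 1.
  by have := is_deriveB (is_derive_id t 1) (is_derive_cst t0 t 1); rewrite subr0.
have := @is_derive1_comp R (@sin R) (fun s => s - t0) t _ _ (is_derive_sin _) h.
by rewrite mulr1.
Qed.

Lemma Ck_cos_sin n (t0 : R) : Ck n setT (fun t => cos (t - t0)) /\
  Ck n setT (fun t => -1 * sin (t - t0)).
Proof.
elim: n => // n [ih1 ih2]; split.
  apply: (@Ck_is_derive _ _ _ (fun t => -1 * sin (t - t0))) => //; first exact: openT.
  by move=> t _; rewrite mulN1r; exact: is_derive_cosB.
apply: (@Ck_is_derive _ _ _ (fun t => -1 * cos (t - t0))) => //; first exact: openT.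
  move=> t _; have h := is_derive_sinB t0 t.
  by apply: is_derive_eq; rewrite /GRing.scale /=; ring.
by apply: CkM => //; [exact: openT|apply: Ck_cst; exact: openT].
Qed.

(** Each derivative lowers the exponent by one and brings out a factor -sin(t - t0), so the exponent
    n + 1 affords n derivatives. Taking the cosine makes the bump periodic. *)
Lemma Ck_bump n (t0 c : R) : Ck n setT (fun t => Num.max (cos (t - t0) - c) 0 ^+ n.+1).
Proof.
elim: n => // n ih.
apply: (@Ck_is_derive _ _ _ (fun t =>
  n.+2%:R * Num.max (cos (t - t0) - c) 0 ^+ n.+1 * (-1 * sin (t - t0)))); first exact: openT.
  move=> t _.
  have h : is_derive t 1 (fun s : R => cos (s - t0) - c) (- sin (t - t0)).
    have h := is_derive_cosB t0 t.
    by have := is_deriveB h (is_derive_cst c t 1); rewrite subr0.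
  have := @is_derive1_comp R (fun y => Num.max y 0 ^+ n.+2) _ t _ _ (is_derive_max0X n _) h.
  by rewrite mulN1r.
apply: CkM; [exact: openT| |by have [] := Ck_cos_sin n t0].
by apply: CkM => //; [exact: openT|apply: Ck_cst; exact: openT].
Qed.

End smooth_calculus.

Section cutoff_functions.
Variable R : realType.
Local Notation mu := (circle_measure R).
Implicit Types (z : circle R) (w : circle R -> R[i]) (t c : R).

(** Cosine of the angle between [expi t] and z, defined on the circle itself; [cosd t z > c]
    describes an arc centered at [expi t]. *)
Definition cosd t z : R := complex.Re (sval z * (sval (expi t))^*%C).

Lemma cosd_expi t0 t : cosd t0 (expi t) = cos (t - t0).
Proof. by rewrite /cosd cReM cReJ cImJ /= mulrN opprK -cosB. Qed.

Definition bump n t c z : R := Num.max (cosd t z - c) 0 ^+ n.+1.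

Lemma bump_ge0 n t c z : 0 <= bump n t c z.
Proof. by rewrite exprn_ge0// le_max lexx orbT. Qed.

Lemma Ck_bump_expi n t0 c : Ck n setT (fun t => bump n t0 c (expi t)).
Proof. by under eq_fun do rewrite /bump cosd_expi; exact: Ck_bump. Qed.

Definition CkC n (U : circle R -> R[i]) :=
  Ck n setT (fun t => complex.Re (U (expi t))) /\ Ck n setT (fun t => complex.Im (U (expi t))).

Lemma derivable_Ck n (V : set R) (u : R -> R) :
  (forall k t, V t -> derivable (derive1n k u) t 1) -> Ck n V u.
Proof.
elim: n u => // n ih u hu; split=> [t|]; first exact: (hu 0%N).
by apply: ih => k t; rewrite -derive1Sn; exact: hu.
Qed.

(** A point outside the intersection [sing_supp w] misses some closed X off which w has a smooth
    representative g. A bump supported in an arc disjoint from X makes its product with g regular on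
    the whole circle. *)
Lemma bump_smooth n w t0 : ~ sing_supp w (expi t0) -> exists2 c, c < 1 &
  exists2 U, CkC n U & {ae mu, forall z, U z = (bump n t0 c z)%:C * w z}.
Proof.
move=> hw.
have [X [[cX [g wg gX]] nX]] : exists X, (closed X /\ smooth_off X w) /\ ~ X (expi t0).
  apply: contrapT => h; apply: hw => X hX; apply: contrapT => nX.
  by apply: h; exists X; split.
pose V : set R := [set t | ~ X (expi t)].
have oV : open V.
  have : open (@expi R @^-1` (~` X)).
    by apply: open_comp => [t _|]; [exact: continuous_expi|exact: closed_openC].
  by [].
have : nbhs t0 V by apply: open_nbhs_nbhs.
move=> /nbhs_ballP[d' d'0 hd'].
(* Half of d' keeps the closed arc inside [V], and on [0, pi] the cosine is monotone, so that
   [cos d <= cos x] means |x| <= d. *)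
pose d := Num.min (d' / 2) (pi / 2).
have d0 : 0 < d by rewrite lt_min !divr_gt0// pi_gt0.
have dpi : d <= pi.
  by rewrite ge_min; apply/orP; right; rewrite ler_pdivrMr// ler_peMr ?pi_ge0 ?ler1n.
have dd' : d < d'.
  by rewrite gt_min; apply/orP; left; rewrite ltr_pdivrMr// ltr_pMr// ltr1n.
have c1 : cos d < 1.
  by rewrite -[X in _ < X]cos0 ltr_cos ?in_itv /= ?lexx ?pi_ge0// (ltW d0) dpi.
have hV t : cos d <= cos (t - t0) -> V t.
  have [x xpi ex] := expi_surj_at t0 (expi t).
  rewrite -cosd_expi ex cosd_expi addrAC subrr add0r => cx.
  rewrite /V /= ex; apply: (hd' (t0 + x)); rewrite -ball_normE /ball_ /=.
  rewrite opprD addNKr normrN (le_lt_trans _ dd')// leNgt; apply/negP => dx.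
  move: cx; have -> : cos x = cos `|x| by case: ler0P => _ //; rewrite cosN.
  apply/negP; rewrite -ltNge ltr_cos// in_itv /= ?(ltW d0)// normr_ge0 ler_norml.
  exact: xpi.
exists (cos d) => //; exists (fun z => (bump n t0 (cos d) z)%:C * g z); last first.
  apply: filterS wg => z hz; have [t _ zt] := expi_surj z.
  have [Xz|/hz ->//] := pselect (X z).
  rewrite (_ : bump _ _ _ _ = 0) ?mul0r//.
  rewrite /bump max_r ?expr0n// zt cosd_expi subr_le0 leNgt; apply/negP => /ltW/hV.
  by rewrite /V /= -zt.
have oW : open [set t | cos (t - t0) < cos d].
  have hc : continuous (fun t => cos (t - t0)).
    by apply: continuous_is => t; exact: is_derive_cosB.
  exact: (@open_comp _ _ (fun t => cos (t - t0)) [set y | y < cos d] (fun t _ => hc t) (@open_lt _ _)).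
(* Two open sets: on [V] both factors are differentiable, on the other one the bump vanishes
   identically. *)
have cover : setT = V `|` [set t | cos (t - t0) < cos d].
  by apply/seteqP; split=> // t _; have [|] := leP (cos d) (cos (t - t0)); [left; exact: hV|right].
have key (u : R -> R) : (forall k t, V t -> derivable (derive1n k u) t 1) ->
    Ck n setT (fun t => bump n t0 (cos d) (expi t) * u t).
  move=> hu; rewrite cover; apply: Ck_setU.
    apply: CkM => //; last exact: derivable_Ck.
    exact: Ck_sub (Ck_bump_expi n t0 (cos d)).
  apply: Ck_local (Ck_cst n 0 oW) => // t /= ht.
  by rewrite /bump cosd_expi max_r ?expr0n ?mul0r// subr_le0 ltW.
split.
  under eq_fun do rewrite cReZ.
  by apply: key => k t Vt; have [] := gX k t Vt.
under eq_fun do rewrite cImZ.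
by apply: key => k t Vt; have [] := gX k t Vt.
Qed.

(** Each point lies off one of the two singular supports and carries a bump adapted to that symbol;
    by compactness finitely many bumps have a positive sum P. phi is the sum of those marked for w1,
    divided by P, and 1 - phi is the same for w2. Thus no single representative of a symbol has to
    be regular off its whole singular support. *)
Lemma cutoff n w1 w2 : sing_supp w1 `&` sing_supp w2 = set0 ->
  exists (phi : circle R -> R) U1 U2, [/\ Ck n setT (fun t => phi (expi t)),
    CkC n U1, CkC n U2, {ae mu, forall z, U1 z = (phi z)%:C * w1 z} &
    {ae mu, forall z, U2 z = (1 - phi z)%:C * w2 z}].
Proof.
move=> w12; pose w (b : bool) := if b then w1 else w2.
have E t0 : exists x : bool * R * (circle R -> R[i]), [/\ x.1.2 < 1, CkC n x.2 &
    {ae mu, forall z, x.2 z = (bump n t0 x.1.2 z)%:C * w x.1.1 z}].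
  have [h|h] : ~ sing_supp w1 (expi t0) \/ ~ sing_supp w2 (expi t0).
  - apply/not_andP => h; suff : set0 (expi t0) by [].
    by rewrite -w12.
  - by have [c c1 [U hU aeU]] := bump_smooth n h; exists (true, c, U).
  - by have [c c1 [U hU aeU]] := bump_smooth n h; exists (false, c, U).
have [F hF] := choice E.
have cpt : cover_compact `[- pi, pi : R].
  by rewrite -compact_cover; exact: segment_compact.
have [||D _ hD] := cpt R setT (fun t0 => [set t | (F t0).1.2 < cos (t - t0)]).
- move=> t0 _; have hc : continuous (fun t => cos (t - t0)).
    by apply: continuous_is => t; exact: is_derive_cosB.
  exact: (@open_comp _ _ (fun t => cos (t - t0)) [set y | (F t0).1.2 < y] (fun t _ => hc t) (@open_gt _ _)).
- by move=> t _; exists t => //=; rewrite subrr cos0; have [] := hF t.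
pose s := finmap.enum_fset D; pose b t0 z := bump n t0 (F t0).1.2 z.
pose P z := \sum_(t <- s) b t z.
have P0 z : 0 < P z.
  have [t tpi ->] := expi_surj z.
  have [|t0 /= t0D ht0] := hD t; first by rewrite /= in_itv.
  rewrite /P (big_rem t0)//= ltr_wpDr//; first by apply: sumr_ge0 => i _; exact: bump_ge0.
  by rewrite exprn_gt0// lt_max cosd_expi subr_gt0 ht0.
pose p q z := \sum_(t <- s | (F t).1.1 == q) b t z.
pose U q z := ((P z)^-1)%:C * \sum_(t <- s | (F t).1.1 == q) (F t).2 z.
have CkP : Ck n setT (fun t => (P (expi t))^-1).
  apply: CkV; first exact: openT.
    by move=> t _; rewrite gt_eqF.
  by apply: Ck_sum => [|t]; [exact: openT|exact: Ck_bump_expi].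
have CkU q : CkC n (U q).
  split.
    under eq_fun do rewrite cReZ cRe_sum.
    apply: CkM => //; first exact: openT.
    by apply: Ck_sum => [|t]; [exact: openT|have [_ [] ] := hF t].
  under eq_fun do rewrite cImZ cIm_sum.
  apply: CkM => //; first exact: openT.
  by apply: Ck_sum => [|t]; [exact: openT|have [_ [] ] := hF t].
have aeU q : {ae mu, forall z, U q z = ((P z)^-1 * p q z)%:C * w q z}.
  suff : {ae mu, forall z, \sum_(t <- s | (F t).1.1 == q) (F t).2 z = (p q z)%:C * w q z}.
    by apply: filterS => z hz; rewrite /U hz mulrA -rmorphM.
  rewrite /p; elim: s {P P0 p U CkP CkU} => [|t s ih].
    by apply: aeW => z; rewrite !big_nil mul0r.
  have [_ _ ht] := hF t; apply: filterS2 ih ht => z ih ht; rewrite !big_cons.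
  by case: eqP => // tq; rewrite ih ht tq rmorphD mulrDl.
have Pp z : P z = p true z + p false z.
  rewrite /P (bigID (fun t => (F t).1.1 == true))/=; congr (_ + _).
  by apply: eq_bigl => t; case: ((F t).1.1).
exists (fun z => (P z)^-1 * p true z), (U true), (U false); split=> //.
- apply: CkM => //; first exact: openT.
  by apply: Ck_sum => [|t]; [exact: openT|exact: Ck_bump_expi].
apply: filterS (aeU false) => z ->; congr (_%:C * _).
by rewrite -[X in X - _](mulVf (lt0r_neq0 (P0 z))) -mulrBr {3}Pp addrAC subrr add0r.
Qed.

End cutoff_functions.

(** * Products of Hankel operators *)

Section frequency_supports.
Variable R : realType.
Local Notation mu := (circle_measure R).
Local Notation ip := (L2ip R).
Local Notation rip := (re_ip (L2ip R)).
Local Notation nm := (seminorm (L2ip R)).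
Implicit Types (X Y H : L2 R) (k m j : int).

Lemma ae_eq_ip X Y : {ae mu, forall z, X z = Y z} -> eqv ip X Y.
Proof.
move=> XY h; apply/eqP; rewrite -subr_eq0 -ipBl; apply/eqP/ip_nsq0.
have := inner_eq0 (L2P (X - Y)); rewrite -[complex.Re _]/(sqnorm ip (X - Y)) => -[_]; apply.
by apply: filterS XY => z e _; rewrite -[LHS]/(X z - Y z) e subrr.
Qed.

Lemma chi_mul_L2 k Y : cLfun 2%:E (fun z => chi k z * Y z).
Proof.
have c1 : {ae mu, forall z : circle R, cnorm2 (chi k z) <= 1 ^+ 2}.
  by apply: aeW => z; rewrite cnorm2_chi expr1n.
by have [] := cLfun2_mul_bounded (cmeasurable_chi R k) c1 (L2P Y).
Qed.

Definition chi_mul k Y : L2 R := toL2 (chi_mul_L2 k Y).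

Lemma ip_chi_mul k m Y : ip (chi_mul k Y) (Chi R m) = ip Y (Chi R (m - k)).
Proof.
apply: cint_eq => z; rewrite -[LHS]/(chi k z * Y z * (chi m z)^*%C).
rewrite -[RHS]/(Y z * (chi (m - k) z)^*%C) mulrAC mulrC -!chiN -chiD.
by congr (_ * chi _ _); rewrite opprB.
Qed.

Lemma hardy_high X H (N : nat) : hardy2 X ->
  (forall j : nat, (j < N)%N -> ip X (Chi R j) = 0) ->
  (forall j : nat, (N <= j)%N -> ip H (Chi R j) = 0) -> ip X H = 0.
Proof.
move=> /hardy_limit hX X0 H0; apply: limit_of_orth hX _ => n.
rewrite ip_suml big1// => k _; rewrite ipZl; case: (ltnP k N) => kN.
  by rewrite X0// mul0r.
by rewrite -[ip _ H]ipJ H0// conjc0 mulr0.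
Qed.

(** v Y splits into (v - Tr) Y, of norm at most eps times that of Y, and a combination of shifts of
    Y by frequencies from -N to N - 1, all orthogonal to X. *)
Lemma mul_trig_small X Y (VY : L2 R) (v : circle R -> R[i]) (eps : R) (N : nat) (a b : nat -> R[i]) :
  0 <= eps -> cmeasurable v ->
  (forall z, cabs (v z - \sum_(k < N) (a k * chi (Posz k) z + b k * chi (Negz k) z)) <= eps) ->
  {ae mu, forall z, VY z = v z * Y z} ->
  (forall k : nat, (k < N)%N -> ip X (chi_mul k Y) = 0 /\ ip X (chi_mul (Negz k) Y) = 0) ->
  `|rip X VY| <= eps * nm X * nm Y.
Proof.
move=> eps0 mv hv VYE X0.
pose Tr := \sum_(k < N) (a k *: Chi R (Posz k) + b k *: Chi R (Negz k)).
have TrE z : Tr z = \sum_(k < N) (a k * chi (Posz k) z + b k * chi (Negz k) z).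
  by rewrite /Tr L2_sumE; apply: eq_bigr.
have mE : cmeasurable (fun z => v z + -1 * Tr z).
  apply: cmeasurableD mv _; apply: cmeasurableM; first exact: cmeasurable_cst.
  exact: cLfun2_meas (L2P Tr).
have bE : {ae mu, forall z, cnorm2 (v z + -1 * Tr z) <= eps ^+ 2}.
  apply: aeW => z; have := hv z; rewrite -TrE -cabs_sqr mulN1r => h.
  by rewrite lerXn2r ?nnegrE ?cabs_ge0.
have [E2 nE] := cLfun2_mul_bounded mE bE (L2P Y).
pose EY := toL2 E2.
pose rY := \sum_(k < N) (a k *: chi_mul (Posz k) Y + b k *: chi_mul (Negz k) Y).
have rYE z : rY z = Tr z * Y z.
  rewrite TrE /rY L2_sumE mulr_suml; apply: eq_bigr => k _.
  rewrite -[LHS]/(a k * (chi (Posz k) z * Y z) + b k * (chi (Negz k) z * Y z)).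
  by rewrite !mulrA -mulrDl.
have VYd : eqv ip VY (EY + rY).
  apply: ae_eq_ip; apply: filterS VYE => z ->.
  rewrite -[RHS]/((v z + -1 * Tr z) * Y z + rY z) rYE; ring.
have r0 : ip X rY = 0.
  rewrite ip_sumr big1// => k _; have [h1 h2] := X0 k (ltn_ord k).
  by rewrite ipDr !ipZr h1 h2 !mulr0 addr0.
have -> : rip X VY = rip X EY.
  rewrite ripC [RHS]ripC (eqv_ripl _ VYd) ripDl [X in _ + X]ripC.
  by rewrite [X in _ + X](_ : _ = 0) ?addr0// /re_ip r0.
apply: le_trans (rip_le _ _ _) _; rewrite mulrAC mulrC ler_wpM2r ?nm_ge0//.
rewrite -(@ler_pXn2r _ 2) ?nnegrE ?mulr_ge0 ?nm_ge0// exprMn !nm_sqr.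
exact: nE.
Qed.

Lemma ip_reflection (f : circle R -> R[i]) m (f2 : cLfun 2%:E f) :
  inner (reflection f) (chi m) = inner f (chi (- m)).
Proof.
have [i1 i2] := cLfun2_mulJ f2 (cLfun2_chi R (- m)).
rewrite /inner /circle_integral -(circle_Rintegral_conj i1) -(circle_Rintegral_conj i2).
congr (_ +i* _); apply: eq_Rintegral => z _; congr (_ _).
all: by rewrite chi_conj opprK.
Qed.

End frequency_supports.

Section integer_frequencies.
Implicit Types (k m : int) (j N : nat).

Lemma subz_gt0 k j N : k < N%:Z -> (N <= j)%N -> 0 < Posz j - k.
Proof. lia. Qed.

Lemma ltz_Negz m N : m < 0 -> - N%:Z <= m -> exists2 i, (i < N)%N & m = Negz i.
Proof. by move=> m0 mN; exists `|m|%N.-1; lia. Qed.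

Lemma gez_Posz m N : 0 <= m -> m < N%:Z -> exists2 i, (i < N)%N & m = Posz i.
Proof. by move=> m0 mN; exists `|m|%N; lia. Qed.

Lemma subz_le k j N : k < N%:Z -> k - Posz j < N%:Z.
Proof. lia. Qed.

(** The orthogonality arguments use only the upper bound k < N on a shift, which the negative shifts
    [Negz k] satisfy trivially. *)
Lemma nat_int_cases (P : int -> Prop) N : (forall k, k < N%:Z -> P k) ->
  forall k : nat, (k < N)%N -> P (Posz k) /\ P (Negz k).
Proof. by move=> hP k kN; split; apply: hP. Qed.

End integer_frequencies.

Section hankel_products.
Variable R : realType.
Local Notation mu := (circle_measure R).
Local Notation ip := (L2ip R).
Local Notation rip := (re_ip (L2ip R)).
Local Notation nm := (seminorm (L2ip R)).
Implicit Types (X Y : L2 R) (f g : H2 R) (w : circle R -> R[i]) (k m : int).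

Lemma hardy_neg (f : L2 R) m : hardy2 f -> m < 0 -> ip f (Chi R m) = 0.
Proof.
move=> /(hardy_orth f) hf m0; apply: hf => k; rewrite ip_Chi.
by case: eqP => // e; move: m0; rewrite e.
Qed.

Lemma hardy_chi (k : nat) : hardy2 (Chi R k).
Proof. by apply/hardy_orth => h hk; rewrite -ipJ hk conjc0. Qed.

Lemma H2L2P f : hardy2 (H2L2 f).
Proof. exact: H2P f. Qed.

Definition reflectL2 X : L2 R := toL2 (proj1 (cLfun2_reflection (L2P X))).

Lemma nm_reflectL2 X : nm (reflectL2 X) = nm X.
Proof. by rewrite /seminorm; congr Num.sqrt; have [_] := cLfun2_reflection (L2P X). Qed.

Lemma ip_reflectL2 X m : ip (reflectL2 X) (Chi R m) = ip X (Chi R (- m)).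
Proof. exact: ip_reflection (L2P X). Qed.

Definition symbol_mul C w (bw : bounded_by C w) f : L2 R :=
  toL2 (proj1 (cLfun2_hankel bw (hardy2L (H2P f)))).

Lemma symbol_mul_lin C w (bw : bounded_by C w) c f g :
  symbol_mul bw (c *: f + g) = c *: symbol_mul bw f + symbol_mul bw g.
Proof.
apply/val_inj/funext => z.
rewrite -[LHS]/(w z * (c * f (circle_conj z) + g (circle_conj z))).
rewrite -[RHS]/(c * (w z * f (circle_conj z)) + w z * g (circle_conj z)).
by rewrite mulrDr mulrCA.
Qed.

Lemma symbol_mul_le C w (bw : bounded_by C w) f : 0 <= C ->
  nm (symbol_mul bw f) <= C * nm (H2L2 f).
Proof.
move=> C0; rewrite -(@ler_pXn2r _ 2) ?nnegrE ?mulr_ge0 ?nm_ge0// exprMn !nm_sqr.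
by have [_] := cLfun2_hankel bw (hardy2L (H2P f)).
Qed.

Lemma symbol_mul_orth C w (bw : bounded_by C w) f X : hardy2 X ->
  ip (symbol_mul bw f - H2L2 (opH w f)) X = 0.
Proof. by move=> hX; exact: (Pplus_orth (L2P (symbol_mul bw f)) hX). Qed.

(** The projection P of F satisfies |P|^2 = <F, P>; Cauchy-Schwarz makes it a contraction. *)
Lemma nm_opH_le C w (bw : bounded_by C w) f :
  nm (H2L2 (opH w f)) <= nm (symbol_mul bw f).
Proof.
set F := symbol_mul bw f; set P := H2L2 _.
have h : sqnorm ip P = rip F P.
  have := @symbol_mul_orth C w bw f P (H2P (opH w f)); rewrite -/F -/P ipBl => /eqP.
  by rewrite subr_eq0 => /eqP e; rewrite /re_ip -[X in complex.Re X]/(ip F P) e.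
have [P0|P0] := eqVneq (nm P) 0; first by rewrite P0 nm_ge0.
have Pp : 0 < nm P by rewrite lt_def P0 nm_ge0.
by rewrite -(ler_pM2r Pp) -expr2 nm_sqr h (le_trans (ler_norm _))// rip_le.
Qed.

Lemma cmeasurable_CkC n (U : circle R -> R[i]) : CkC n.+1 U -> cmeasurable U.
Proof.
move=> [[d1 _] [d2 _]]; split.
  exact: (@measurable_circle_derivable R (fun z => complex.Re (U z)) (fun t => d1 t Logic.I)).
exact: (@measurable_circle_derivable R (fun z => complex.Im (U z)) (fun t => d2 t Logic.I)).
Qed.

Lemma Ck_1B n (u : R -> R) : Ck n setT u -> Ck n setT (fun t => 1 - u t).
Proof.
move=> hu; under eq_fun do rewrite -mulN1r.
have h1 : Ck n setT (fun=> 1 : R) := Ck_cst n 1 openT.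
have h2 : Ck n setT (fun=> -1 : R) := Ck_cst n (-1) openT.
exact: (CkD openT h1 (CkM openT h2 hu)).
Qed.

Lemma CkC_real n (u : circle R -> R) : Ck n setT (fun t => u (expi t)) ->
  CkC n (fun z => (u z)%:C).
Proof. by move=> hu; split => //=; have := Ck_cst n (0 : R) openT. Qed.

Lemma CkC_trig_approx q (U : circle R -> R[i]) : CkC q.+3 U ->
  exists2 C : R, 0 <= C & forall n, (0 < n)%N -> exists a b : nat -> R[i], forall z,
    cabs (U z - \sum_(k < n) (a k * chi (Posz k) z + b k * chi (Negz k) z)) <= C / n%:R ^+ q.
Proof. by move=> hU; exact: (@trig_approx R q U (proj1 hU) (proj2 hU)). Qed.

Lemma CkC_bounded n (U : circle R -> R[i]) : CkC n.+1 U ->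
  exists B : R, {ae mu, forall z, cnorm2 (U z) <= B ^+ 2}.
Proof.
move=> [[d1 _] [d2 _]].
have [|B1 hB1] := @bounded_circle R (fun z => complex.Re (U z)).
  by move=> t; apply: derivable_continuous; exact: d1.
have [|B2 hB2] := @bounded_circle R (fun z => complex.Im (U z)).
  by move=> t; apply: derivable_continuous; exact: d2.
exists (B1 + B2); apply: aeW => z; rewrite -cabs_sqr.
have : cabs (U z) <= B1 + B2.
  have -> : U z = (complex.Re (U z))%:C + (0 +i* 1) * (complex.Im (U z))%:C.
    by apply/eqP; rewrite eq_complex /=; apply/andP; split; apply/eqP; ring.
  apply: le_trans (cabsD _ _) _; rewrite cabsM !cabs_real.
  have -> : cabs (0 +i* 1 : R[i]) = 1 by rewrite /cabs /cnorm2 /= expr0n expr1n add0r sqrtr1.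
  by rewrite mul1r lerD.
move=> hU; rewrite lerXn2r ?nnegrE ?cabs_ge0//.
exact: le_trans (cabs_ge0 _) hU.
Qed.

Section real_multiplier.
Variables (psi : circle R -> R) (M : R).
Hypothesis mpsi : cmeasurable (fun z => (psi z)%:C).
Hypothesis bpsi : {ae mu, forall z, cnorm2 (psi z)%:C <= M ^+ 2}.

Definition rmul X : L2 R := toL2 (proj1 (cLfun2_mul_bounded mpsi bpsi (L2P X))).

Lemma rmulD X Y : rmul (X + Y) = rmul X + rmul Y.
Proof. by apply/val_inj/funext => z; exact: mulrDr. Qed.

Lemma rmulB X Y : rmul (X - Y) = rmul X - rmul Y.
Proof. by apply/val_inj/funext => z; exact: mulrBr. Qed.

Lemma rip_rmul X Y : rip X (rmul Y) = rip (rmul X) Y.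
Proof.
congr complex.Re; apply: cint_eq => z.
rewrite -[LHS]/(X z * ((psi z)%:C * Y z)^*%C) -[RHS]/((psi z)%:C * X z * (Y z)^*%C).
by rewrite conjcM conjc_real mulrCA mulrA.
Qed.

End real_multiplier.

Lemma rapid_hankel C1 C2 w1 w2 : 0 <= C1 -> 0 <= C2 -> bounded_by C1 w1 -> bounded_by C2 w2 ->
  sing_supp w1 `&` sing_supp w2 = set0 -> rapid (H2ip R) (opH w2) (opH w1).
Proof.
move=> C10 C20 bw1 bw2 w12 q.
have [phi [U1 [U2 [Cphi CU1 CU2 aeU1 aeU2]]]] := cutoff q.+3 w12.
pose psi z := 1 - phi z.
have Cpsi : Ck q.+3 setT (fun t => psi (expi t)).
  exact: Ck_1B.
have CCpsi : CkC q.+3 (fun z => (psi z)%:C) by exact: CkC_real.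
have dpsi t : derivable (fun t => psi (expi t)) t 1 by have [d _] := Cpsi; exact: d.
have [|M hM] := @bounded_circle R psi; first by move=> t; exact: derivable_continuous.
have mpsi := cmeasurable_CkC CCpsi.
have bpsi : {ae mu, forall z, cnorm2 (psi z)%:C <= M ^+ 2}.
  apply: aeW => z; rewrite -cabs_sqr cabs_real lerXn2r ?nnegrE ?hM//.
  exact: le_trans (normr_ge0 _) (hM z).
pose pm := rmul mpsi bpsi.
have [D1 D10 hD1] := CkC_trig_approx CU1.
have [D2 D20 hD2] := CkC_trig_approx CU2.
have [D3 D30 hD3] := CkC_trig_approx CCpsi.
have [B1 hB1] := CkC_bounded CU1.
have [B2 hB2] := CkC_bounded CU2.
have m1 := cmeasurable_CkC CU1; have m2 := cmeasurable_CkC CU2.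
(* The norms of F+, F-, G+, G- are at most C2, 2 C2, C1, 2 C1 times those of f or g, and reflection
   preserves norms. The two terms of [main] with a factor 1 - phi contribute 2 C1 C2 D3 each. *)
exists (C2 * D1 + 4 * C1 * C2 * D3 + C1 * D2), 3%N; split.
  by rewrite !addr_ge0 ?mulr_ge0.
move=> N N0; have N0' : 0 < N%:R ^+ q :> R by rewrite exprn_gt0// ltr0n.
(* F = w2 Wf loses the frequencies -N, ..., N - 1 and f the frequencies 0, ..., N - 1. *)
pose cond (x : 'I_N + 'I_N + 'I_N) (f : H2 R) : R[i]^o := match x with
  | inl (inl j) => ip (symbol_mul bw2 f) (Chi R (Posz j))
  | inl (inr j) => ip (symbol_mul bw2 f) (Chi R (Negz j))
  | inr j => ip (H2L2 f) (Chi R (Posz j)) end.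
exists ('I_N + 'I_N + 'I_N)%type, cond; split.
- by rewrite !card_sum !card_ord; lia.
- move=> [[j|j]|j] c f g; rewrite /cond ?symbol_mul_lin ?ipDl ?ipZl//.
  have -> : H2L2 (c *: f + g) = c *: H2L2 f + H2L2 g by exact/val_inj.
  by rewrite ipDl ipZl.
move=> f g hphi.
pose F := symbol_mul bw2 f; pose Fp := H2L2 (opH w2 f); pose Fm := F - Fp.
pose G := symbol_mul bw1 g; pose Gp := H2L2 (opH w1 g); pose Gm := G - Gp.
have Fph : hardy2 Fp := H2P (opH w2 f); have Gph : hardy2 Gp := H2P (opH w1 g).
have Fm0 X : hardy2 X -> ip Fm X = 0 by exact: (@symbol_mul_orth _ _ bw2 f X).
have Gm0 X : hardy2 X -> ip Gm X = 0 by exact: (@symbol_mul_orth _ _ bw1 g X).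
have a1 (j : nat) : (j < N)%N -> ip F (Chi R (Posz j)) = 0 := fun h => hphi (inl (inl (Ordinal h))).
have a2 (j : nat) : (j < N)%N -> ip F (Chi R (Negz j)) = 0 := fun h => hphi (inl (inr (Ordinal h))).
have a3 (j : nat) : (j < N)%N -> ip (H2L2 f) (Chi R (Posz j)) = 0 := fun h => hphi (inr (Ordinal h)).
have b1 (j : nat) : (j < N)%N -> ip Fp (Chi R (Posz j)) = 0.
  by move=> jN; have := Fm0 _ (hardy_chi j); rewrite ipBl a1// sub0r => /eqP; rewrite oppr_eq0 => /eqP.
have b3 (j : nat) : (j < N)%N -> ip Fm (Chi R (Negz j)) = 0.
  by move=> jN; rewrite ipBl a2// (hardy_neg Fph)// subrr.
pose Wf := reflectL2 (H2L2 f); pose Wg := reflectL2 (H2L2 g).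
pose S1 := toL2 (proj1 (cLfun2_mul_bounded m1 hB1 (L2P Wg))).
pose S2 := toL2 (proj1 (cLfun2_mul_bounded m2 hB2 (L2P Wf))).
have eG : eqv ip G (S1 + pm G).
  apply: ae_eq_ip; apply: filterS aeU1 => z e1.
  rewrite -[LHS]/(w1 z * Wg z) -[RHS]/(U1 z * Wg z + (psi z)%:C * (w1 z * Wg z)) e1.
  by rewrite mulrA -mulrDl -mulrDl -rmorphD subrKC mul1r.
have eF : eqv ip (pm F) S2.
  apply: ae_eq_ip; apply: filterS aeU2 => z e2.
  by rewrite -[LHS]/((psi z)%:C * (w2 z * Wf z)) -[RHS]/(U2 z * Wf z) e2 mulrA.
(* [pm] multiplies by 1 - phi, so that [S1] is phi G and [S2] is (1 - phi) F almost everywhere. Two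
   facts are used: G- is orthogonal to F+, and a real multiplier is symmetric ([rip_rmul]). *)
have main : rip Fp Gp = rip Fp S1 + rip Fp (pm Gm) + rip Gp S2 - rip Gp (pm Fm).
  have e1 : rip Fp Gp = rip Fp G.
    apply/eqP; rewrite -subr_eq0 -opprB oppr_eq0 -ripNr -ripDr -/Gm ripC /re_ip.
    by rewrite Gm0.
  have e2 : rip Fp (pm G) = rip Fp (pm Gp) + rip Fp (pm Gm).
    by rewrite -ripDr -rmulD /Gm subrKC.
  have e3 : rip (pm Fp) Gp = rip (pm F) Gp - rip (pm Fm) Gp.
    by rewrite -ripNl -ripDl -rmulB /Fm subKr.
  have e4 : rip Fp G = rip Fp S1 + rip Fp (pm G).
    by rewrite ripC (eqv_ripl _ eG) ripDl; congr (_ + _); rewrite ripC.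
  have e5 : rip (pm F) Gp = rip Gp S2 by rewrite (eqv_ripl _ eF) ripC.
  have e6 : rip Fp (pm Gp) = rip (pm Fp) Gp by exact: rip_rmul.
  have e7 : rip (pm Fm) Gp = rip Gp (pm Fm) by rewrite ripC.
  rewrite e1 e4 e2 e6 e3 e5 e7.
  by rewrite [_ - rip Gp (pm Fm) + _]addrC !addrA.
have nF : nm F <= C2 * nm (H2L2 f) by exact: symbol_mul_le.
have nG : nm G <= C1 * nm (H2L2 g) by exact: symbol_mul_le.
have nFp : nm Fp <= C2 * nm (H2L2 f) := le_trans (nm_opH_le bw2 f) nF.
have nGp : nm Gp <= C1 * nm (H2L2 g) := le_trans (nm_opH_le bw1 g) nG.
have nFm : nm Fm <= 2 * (C2 * nm (H2L2 f)).
  by apply: le_trans (nmB _ _ _) _; rewrite mulr_natl mulr2n lerD.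
have nGm : nm Gm <= 2 * (C1 * nm (H2L2 g)).
  by apply: le_trans (nmB _ _ _) _; rewrite mulr_natl mulr2n lerD.
have [a [b hab1]] := hD1 N N0; have [a' [b' hab2]] := hD2 N N0.
have [a'' [b'' hab3]] := hD3 N N0.
have e0 (D : R) : 0 <= D -> 0 <= D / N%:R ^+ q by move=> D0; rewrite divr_ge0// ltW.
have both := @nat_int_cases ^~ N.
(* F+ starts at frequency N. Wg has frequencies at most 0, and G- in the next estimate only negative
   ones, so their shifts by k < N stay below N. *)
have t1 : `|rip Fp S1| <= D1 / N%:R ^+ q * nm Fp * nm Wg.
  apply: (mul_trig_small (e0 _ D10) m1 hab1); first exact: aeW.
  apply: (both (fun k => ip Fp (chi_mul k Wg) = 0)) => k kN; apply: (hardy_high Fph b1) => j Nj.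
  by rewrite ip_chi_mul ip_reflectL2 (hardy_neg (H2L2P g))// oppr_lt0 (subz_gt0 kN Nj).
have t2 : `|rip Fp (pm Gm)| <= D3 / N%:R ^+ q * nm Fp * nm Gm.
  apply: (mul_trig_small (e0 _ D30) mpsi hab3); first exact: aeW.
  apply: (both (fun k => ip Fp (chi_mul k Gm) = 0)) => k kN; apply: (hardy_high Fph b1) => j Nj.
  rewrite ip_chi_mul -(gez0_abs (ltW (subz_gt0 kN Nj))).
  exact/Gm0/hardy_chi.
(* f starts at frequency N, so Wf ends at -N, and its shifts by k < N have only negative
   frequencies: they are orthogonal to H^2. *)
have t3 : `|rip Gp S2| <= D2 / N%:R ^+ q * nm Gp * nm Wf.
  apply: (mul_trig_small (e0 _ D20) m2 hab2); first exact: aeW.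
  apply: (both (fun k => ip Gp (chi_mul k Wf) = 0)) => k kN.
  apply: (proj1 (hardy_orth Gp) Gph) => j; rewrite ip_chi_mul ip_reflectL2 opprB.
  have [jk|kj] := ltP (k - Posz j) 0; first by rewrite (hardy_neg (H2L2P f)).
  have [i iN ->] := gez_Posz kj (subz_le j kN); exact: a3.
(* F- has no frequency at or above -N, so its shifts by k < N are again orthogonal to H^2. *)
have t4 : `|rip Gp (pm Fm)| <= D3 / N%:R ^+ q * nm Gp * nm Fm.
  apply: (mul_trig_small (e0 _ D30) mpsi hab3); first exact: aeW.
  apply: (both (fun k => ip Gp (chi_mul k Fm) = 0)) => k kN.
  apply: (proj1 (hardy_orth Gp) Gph) => j; rewrite ip_chi_mul.
  have [jk|kj] := ltP (Posz j - k) 0; last first.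
    by rewrite -(gez0_abs kj); exact/Fm0/hardy_chi.
  have jN : - N%:Z <= Posz j - k by rewrite lerNl opprB ltW// subz_le.
  have [i iN ->] := ltz_Negz jk jN; exact: b3.
have nWf : nm Wf = nm (H2L2 f) := nm_reflectL2 _.
have nWg : nm Wg = nm (H2L2 g) := nm_reflectL2 _.
rewrite -[X in `|X|]/(rip Fp Gp) -[X in _ * X * _]/(nm (H2L2 f)) -[X in _ * _ * X]/(nm (H2L2 g)).
rewrite main; rewrite nWg in t1; rewrite nWf in t3.
have xf0 := nm_ge0 ip (H2L2 f); have xg0 := nm_ge0 ip (H2L2 g).
have step (D c1 c2 x y : R) : 0 <= D -> 0 <= c1 <= x -> 0 <= c2 <= y ->
    D / N%:R ^+ q * c1 * c2 <= D / N%:R ^+ q * x * y.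
  move=> D0 /andP[c10 cx] /andP[c20 cy]; rewrite -!mulrA.
  have Nq0 : 0 <= (N%:R ^+ q)^-1 :> R by rewrite invr_ge0 ltW.
  by do 2 apply: ler_wpM2l => //; exact: ler_pM.
have u1 := le_trans t1 (@step D1 _ _ _ _ D10 (introT andP (conj (nm_ge0 ip _) nFp)) (introT andP (conj xg0 (lexx _)))).
have u2 := le_trans t2 (@step D3 _ _ _ _ D30 (introT andP (conj (nm_ge0 ip _) nFp)) (introT andP (conj (nm_ge0 ip _) nGm))).
have u3 := le_trans t3 (@step D2 _ _ _ _ D20 (introT andP (conj (nm_ge0 ip _) nGp)) (introT andP (conj xf0 (lexx _)))).
have u4 := le_trans t4 (@step D3 _ _ _ _ D30 (introT andP (conj (nm_ge0 ip _) nGp)) (introT andP (conj (nm_ge0 ip _) nFm))).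
apply: le_trans (ler_normB _ _) _.
apply: le_trans (lerD (le_trans (ler_normD _ _) (lerD (le_trans (ler_normD _ _) (lerD u1 u2)) u3)) u4) _.
move: (nm (H2L2 f)) (nm (H2L2 g)) (N%:R ^+ q)^-1 => x y r; rewrite le_eqVlt; apply/orP; left; apply/eqP.
clear; ring.
Qed.

End hankel_products.

(** * Eigenvalue sequences *)

(** If [v n > u n], monotonicity puts the level set of u at the value [v n] among the indices below
    n, where v agrees with u. As v also takes this value at n, its level set would be strictly
    larger. *)
Lemma level_sets_le (R : realType) (u v : nat -> R) :
  {homo u : m n / (m <= n)%N >-> n <= m} -> (forall n, 0 <= u n) ->
  (forall s, 0 < s -> exists d, [set n | u n = s] #= `I_d /\ [set n | v n = s] #= `I_d) ->
  forall n, (forall m, (m < n)%N -> u m = v m) -> v n <= u n.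
Proof.
move=> hu u0 hd n ih; rewrite leNgt; apply/negP => uv.
have s0 : 0 < v n by exact: le_lt_trans uv.
have [d [cu cv]] := hd _ s0; pose B := [set m | u m = v n] `|` [set n].
have us m : u m = v n -> (m < n)%N.
  by move=> e; rewrite ltnNge; apply/negP => /hu; rewrite e leNgt uv.
have cB : B #= `I_d.+1.
  apply/eq_cardSP; exists n; first by right.
  rewrite (_ : B `\ n = [set m | u m = v n])//; apply/seteqP; split=> m /=.
    by move=> [[|]].
  by move=> e; split; [left|move=> mn; move/us : e; rewrite mn ltnn].
have /subset_card_le : B `<=` [set m | v m = v n].
  by move=> m [e|->//]; rewrite /= -ih// us.
by rewrite (card_le_eql cB) (card_le_eqr cv) card_le_II ltnn.
Qed.

Section eigenvalue_bridge.
Variable R : realType.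
Local Notation mu := (circle_measure R).
Local Notation fun_circle := (circle R -> R[i]).
Local Notation ip := (H2ip R).
Implicit Types (f g : H2 R).

(** Steinitz modulo null functions: expanded in a smaller spanning family, an independent family
    would satisfy the relation given by [kernel_comb]. *)
Lemma has_dim_le (W : set fun_circle) d d' : has_dim W d -> has_dim W d' -> (d <= d')%N.
Proof.
move=> [b [Wb ib _]] [b' [Wb' _ sb']]; rewrite leqNgt; apply/negP => dd'.
have [M hM] := choice (fun j => sb' _ (Wb j)).
have card : (#|'I_d'| < #|'I_d|)%N by rewrite !card_ord.
have [c [[j cj] hc]] := kernel_comb M card.
suff /ib/(_ j)/eqP : \sum_j c j *: b j = 0 %[ae mu] by rewrite (negbTE cj).
(* The finitely many expansions, each valid almost everywhere, are made to hold at common points. *)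
have hae : {ae mu, forall z, forall j, b j z = (\sum_i M j i *: b' i) z}.
  have : forall s : seq 'I_d, {ae mu, forall z, forall j, j \in s -> b j z = (\sum_i M j i *: b' i) z}.
    elim=> [|k s ih]; first by apply: aeW => z j'; rewrite in_nil.
    apply: filterS2 ih (hM k) => z ih hk j'; rewrite inE => /orP[/eqP->|/ih//].
    exact: hk.
  by move=> /(_ (index_enum _)); apply: filterS => z h j'; apply: h; rewrite mem_index_enum.
apply: filterS hae => z hz _; rewrite fct_sumE.
transitivity (\sum_j0 \sum_i c j0 * M j0 i * b' i z).
  apply: eq_bigr => k _; rewrite -[LHS]/(c k * b k z) hz fct_sumE mulr_sumr.
  by apply: eq_bigr => i _; rewrite -mulrA.
by rewrite exchange_big big1//= => i _; rewrite -mulr_suml hc mul0r.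
Qed.

Lemma pos_eigenvalue_seq_unique (A : fun_circle -> fun_circle) u v :
  pos_eigenvalue_seq A u -> pos_eigenvalue_seq A v -> u = v.
Proof.
move=> [u1 u2 u3] [v1 v2 v3].
have hd s : 0 < s -> exists d, [set n | u n = s] #= `I_d /\ [set n | v n = s] #= `I_d.
  move=> s0; have [d dim1 c1] := u3 s s0; have [d' dim2 c2] := v3 s s0.
  exists d; split=> //; rewrite (_ : d = d')//; apply/eqP.
  by rewrite eqn_leq (has_dim_le dim1 dim2) (has_dim_le dim2 dim1).
apply/funext => n; elim/ltn_ind : n => n ih; apply/eqP; rewrite eq_le; apply/andP; split; last first.
  by apply: (@level_sets_le _ u v) => // m k; exact: u1.
apply: (@level_sets_le _ v u) => //.
  by move=> s /hd[d []]; exists d.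
by move=> m /ih.
Qed.

Lemma H2_ae f g : f = g %[ae mu] <-> eqv ip f g.
Proof.
have e : f - g = 0 %[ae mu] <-> sqnorm ip (f - g) = 0.
  by split=> [h|h]; [exact: (proj2 (inner_eq0 (hardy2L (H2P (f - g)))) h)|
                     exact: (proj1 (inner_eq0 (hardy2L (H2P (f - g)))) h)].
split=> [fg|fg].
  have /e/nsq_eq0P h : f - g = 0 %[ae mu].
    by apply: filterS fg => z h _; rewrite -[LHS]/(f z - g z) h ?subrr.
  by move=> k; apply/eqP; rewrite -subr_eq0 -ipBl h.
have /e : sqnorm ip (f - g) = 0 by apply/nsq_eq0P => k; rewrite ipBl fg subrr.
by apply: filterS => z /(_ Logic.I) h _; apply/eqP; rewrite -subr_eq0; apply/eqP.
Qed.

Lemma H2_sumE (I : finType) (F : I -> H2 R) : H2fun (\sum_i F i) = \sum_i H2fun (F i).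
Proof. exact: (big_morph (@H2fun R)). Qed.

Variables (A : H2 R -> H2 R) (B : fun_circle -> fun_circle).
Variables (lam : nat -> R) (e : nat -> H2 R).
Hypothesis AB : forall f, B f = A f.
Hypothesis sA : selfadj ip A.
Hypothesis sp : spectral ip A lam e.

(** By [eigenvectors_span] the eigenspace for s > 0 is spanned by the [e n] whose indices form the
    level set of [lam] at s, so multiplicities agree. *)
Lemma spectral_pos_eigenvalue_seq : pos_eigenvalue_seq B lam.
Proof.
split; [exact: spectral_le sp|exact: spectral_ge0 sp|move=> s s0].
have [a [d [hlam hspan]]] := eigenvectors_span sA sp s0.
have lam_s (i : 'I_d) : lam (a + i) = s.
  by apply/hlam; rewrite leq_addr ltn_add2l ltn_ord.
exists d; last first.
  rewrite (_ : [set n | lam n = s] = addn a @` `I_d).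
    by apply: inj_card_eq => m n _ _; exact: addnI.
  apply/seteqP; split=> [n /hlam /andP[an nad]|_ [i id <-]].
    by exists (n - a)%N => /=; [rewrite ltn_subLR|rewrite subnKC].
  by apply/hlam; rewrite leq_addr ltn_add2l.
exists (fun i => e (a + i)); split=> [i|c|f [fH Bf]].
- split; first exact: H2P.
  rewrite AB; apply: (proj2 (H2_ae _ (s%:C *: e (a + i)))) => h.
  by rewrite (spectral_eig sp) lam_s ipZl.
- move=> h j; pose X := \sum_i c i *: e (a + i).
  have X0 : eqv ip X 0.
    by apply/H2_ae; rewrite /X H2_sumE; exact: h.
  have := X0 (e (a + j)); rewrite ip0l ip_suml (bigD1 j)// big1 => [|i ij].
    rewrite [LHS]addr0 ipZl (spectral_orth sp) eqxx lam_s s0 mulr1; exact: id.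
  rewrite ipZl (spectral_orth sp) eqn_add2l; case: eqP => [/val_inj e1|]; last by rewrite mulr0.
  by rewrite e1 eqxx in ij.
pose f' := toH2 fH; exists (fun i => ip f' (e (a + i))).
have eig h : ip (A f') h = s%:C * ip f' h.
  have /H2_ae : A f' = s%:C *: f' %[ae mu] by rewrite -AB; exact: Bf.
  by move=> ->; rewrite ipZl.
have /H2_ae := hspan f' eig; rewrite H2_sumE; exact: id.
Qed.

Lemma lambda_pos_spectral : lambda_pos B = lam.
Proof.
apply: xget_unique; first exact: spectral_pos_eigenvalue_seq.
by move=> u hu; apply: pos_eigenvalue_seq_unique hu spectral_pos_eigenvalue_seq.
Qed.

End eigenvalue_bridge.

Section compact_bridge.
Variable R : realType.
Local Notation ip := (H2ip R).

Lemma compact_op_opH (w : circle R -> R[i]) : compact_op (hankel w) -> compact_on ip (opH w).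
Proof.
move=> cw u hu; have [k [g [hk gH hg]]] := cw (fun n => u n) (fun n => conj (H2P (u n)) (hu n)).
exists k, (toH2 gH); split=> //.
Qed.

(** Both signs go through one argument, the negative eigenvalues of [A] being by definition the
    positive ones of [- A]. *)
Definition signed (sgn : bool) (A : H2 R -> H2 R) f := if sgn then A f else - A f.

Lemma signed_selfadj sgn A : selfadj ip A -> selfadj ip (signed sgn A).
Proof. by case: sgn => // h f g; rewrite /signed ipNl ipNr h. Qed.

Lemma signed_compact_on sgn A : compact_on ip A -> compact_on ip (signed sgn A).
Proof.
case: sgn => [h|h u hu]; first exact: h.
have [k [g [hk /limit_ofP hg]]] := h u hu; exists k, (- g); split; first exact: hk.
apply/limit_ofP => e0 /hg[N hN]; exists N => n /hN.
by rewrite /signed -opprD nmN.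
Qed.

Lemma signed_rapid sgn A B : rapid ip A B -> rapid ip (signed sgn A) (signed sgn B).
Proof.
case: sgn => [h|h q]; first exact: h.
have [C [K [C0 hC]]] := h q; exists C, K; split; first exact: C0.
move=> N N0; have [I [phi [c l hphi]]] := hC N N0; exists I, phi; split; [exact: c|exact: l|move=> f g /hphi].
by rewrite /signed ripNl ripNr opprK; apply.
Qed.

Lemma lambda_spectral sgn w lam e : selfadj ip (opH w) -> spectral ip (signed sgn (opH w)) lam e ->
  lambda sgn (hankel w) = lam.
Proof.
move=> sw sp; have ssw := signed_selfadj sgn sw.
by case: sgn sp ssw => sp ssw; exact: (lambda_pos_spectral _ ssw sp).
Qed.

End compact_bridge.

Section compact_sums.
Variables (R : realType) (V : lmodType R[i]) (ip : semi_ip V).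
Variables (I : eqType) (A : I -> V -> V).

Lemma compact_on_eqv (B C : V -> V) : (forall f, eqv ip (B f) (C f)) ->
  compact_on ip B -> compact_on ip C.
Proof.
move=> BC cB u /cB[k [g [hk hg]]]; exists k, g; split; first exact: hk.
apply/limit_ofP => e0 he; move/limit_ofP : hg => /(_ _ he)[N hN]; exists N => n /hN.
by rewrite (eqv_nm (eqvB (BC _) (fun h => erefl (ip g h)))).
Qed.

Lemma selfadj_sum (s : seq I) (T : V -> V) : (forall i, selfadj ip (A i)) ->
  (forall f h, ip (T f) h = \sum_(i <- s) ip (A i f) h) -> selfadj ip T.
Proof.
move=> sA hT f g; rewrite hT -[RHS]ipJ hT rmorph_sum; apply: eq_bigr => i _.
by rewrite sA -[LHS]ipJ.
Qed.

End compact_sums.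

(** * Sums of Hankel operators and the final asymptotics *)

Section hankel_sums.
Variable R : realType.
Local Notation mu := (circle_measure R).
Local Notation ip := (H2ip R).

Lemma bounded_by_sum L (w : 'I_L -> circle R -> R[i]) (C : 'I_L -> R) :
  (forall l, 0 <= C l) -> (forall l, bounded_by (C l) (w l)) ->
  bounded_by (\sum_l C l) (\sum_l w l).
Proof.
move=> C0 bw.
suff [[]//] : bounded_by (\sum_l C l) (\sum_l w l) /\ 0 <= \sum_l C l.
elim/big_rec2 : _ => [|l v B _ [[mv bv] B0]].
  split=> //; split; first exact: cmeasurable_cst.
  by apply: aeW => z; rewrite expr0n /= /cnorm2 /= expr0n /= addr0.
have [mw hw] := bw l; split; last by rewrite addr_ge0.
split; first exact: cmeasurableD.
apply: filterS2 hw bv => z; rewrite -!cabs_sqr => h1 h2.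
have {}h1 : cabs (w l z) <= C l by move: h1; rewrite ler_sqr ?nnegrE ?cabs_ge0.
have {}h2 : cabs (v z) <= B by move: h2; rewrite ler_sqr ?nnegrE ?cabs_ge0.
rewrite ler_sqr ?nnegrE ?cabs_ge0 ?addr_ge0//.
exact: le_trans (cabsD _ _) (lerD h1 h2).
Qed.

(** Additivity in the symbol is stated for the forms, since [Pplus] chooses the representatives of
    the images independently of each other. *)
Lemma ip_opH_sum L (w : 'I_L -> circle R -> R[i]) (C : 'I_L -> R) f h :
  (forall l, 0 <= C l) -> (forall l, bounded_by (C l) (w l)) ->
  ip (opH (\sum_l w l) f) h = \sum_l ip (opH (w l) f) h.
Proof.
move=> C0 bw; have bs := bounded_by_sum C0 bw; rewrite (ip_opH f h bs).
have -> : inner (fun z => (\sum_l w l) z * reflection f z) h =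
    L2ip R (\sum_l symbol_mul (bw l) f) (H2L2 h).
  apply: cint_eq => z; congr (_ * _); rewrite fct_sumE mulr_suml L2_sumE.
  exact: eq_bigr.
by rewrite ip_suml; apply: eq_bigr => l _; rewrite (ip_opH f h (bw l)).
Qed.

End hankel_sums.

Lemma signed_asymptotics (R : realType) (L : nat) (w : 'I_L -> circle R -> R[i])
  (w_bounded : forall l, cLfun +oo%E (w l))
  (w_disjoint : forall l j, l != j -> sing_supp (w l) `&` sing_supp (w j) = set0)
  (w_symmetric : forall l, symmetric_symbol (w l))
  (w_compact : forall l, compact_op (hankel (w l)))
  (p : R) (p_gt0 : 0 < p) (sgn : bool) :
  (Delta sgn p (hankel (\sum_l w l)%R) <= \sum_l Delta sgn p (hankel (w l)))%E /\
  (\sum_l delta sgn p (hankel (w l)) <= delta sgn p (hankel (\sum_l w l)%R))%E.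
Proof.
have /choice[C hC] : forall l, exists C, 0 <= C /\ bounded_by C (w l).
  by move=> l; have [C C0 bC] := cLfun_oo_bounded (w_bounded l); exists C.
have C0 l := proj1 (hC l); have bw l := proj2 (hC l).
pose A l := signed sgn (opH (w l)); pose T := signed sgn (opH (\sum_l w l)).
have sw l : selfadj (H2ip R) (opH (w l)) := opH_selfadj (bw l) (w_symmetric l).
have sA l : selfadj (H2ip R) (A l) := signed_selfadj sgn (sw l).
have cA l : compact_on (H2ip R) (A l) := signed_compact_on sgn (compact_op_opH (w_compact l)).
have rA l j : l != j -> rapid (H2ip R) (A l) (A j).
  move=> lj; apply: signed_rapid; apply: (rapid_hankel (C0 j) (C0 l) (bw j) (bw l)).
  by apply: w_disjoint; rewrite eq_sym.
have hH f h : H2ip R (opH (\sum_l w l) f) h = \sum_l H2ip R (opH (w l) f) h.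
  exact: ip_opH_sum C0 bw.
have hT f h : H2ip R (T f) h = \sum_l H2ip R (A l f) h.
  rewrite /T /A /signed; case: (sgn); first exact: hH.
  rewrite ipNl hH -sumrN.
  by apply: eq_bigr => l _; rewrite ipNl.
have sH : selfadj (H2ip R) (opH (\sum_l w l)) := selfadj_sum sw hH.
have sT : selfadj (H2ip R) T := signed_selfadj sgn sH.
have cT : compact_on (H2ip R) T.
  have := compact_on_sum (index_enum 'I_L) cA; apply: compact_on_eqv => f h.
  by rewrite hT ip_suml.
have /choice[lam /choice[e sp]] : forall l, exists lam e, spectral (H2ip R) (A l) lam e.
  by move=> l; exact: (exists_spectral (sA l) (cA l)).
have [lamT [eT spT]] := exists_spectral sT cT.
have asym := sum_asymptotics p_gt0 sA cA sp rA (index_enum_uniq 'I_L) sT spT hT.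
have DE l : Delta sgn p (hankel (w l)) = wlimsup p (lam l).
  by rewrite /Delta (lambda_spectral (sw l) (sp l)).
have dE l : delta sgn p (hankel (w l)) = wliminf p (lam l).
  by rewrite /delta (lambda_spectral (sw l) (sp l)).
have SD : (\sum_l Delta sgn p (hankel (w l)) = \sum_l wlimsup p (lam l))%E.
  by apply: eq_bigr => l _; exact: DE.
have Sd : (\sum_l delta sgn p (hankel (w l)) = \sum_l wliminf p (lam l))%E.
  by apply: eq_bigr => l _; exact: dE.
have DT : Delta sgn p (hankel (\sum_l w l)) = wlimsup p lamT.
  by rewrite /Delta (lambda_spectral sH spT).
have dT : delta sgn p (hankel (\sum_l w l)) = wliminf p lamT.
  by rewrite /delta (lambda_spectral sH spT).
rewrite SD Sd DT dT; exact: asym.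
Qed.

Theorem theorem3p2 (R : realType) (L : nat) (w : 'I_L -> circle R -> R[i])
  (L_gt0 : (0 < L)%N)
  (w_bounded : forall l, cLfun +oo%E (w l))
  (w_disjoint : forall l j, l != j ->
     sing_supp (w l) `&` sing_supp (w j) = set0)
  (w_symmetric : forall l, symmetric_symbol (w l))
  (w_compact : forall l, compact_op (hankel (w l)))
  (p : R) (p_gt0 : 0 < p) (sgn : bool) :
  let H := hankel (\sum_(l < L) w l) in
  [/\ (Delta sgn p H <= \sum_(l < L) Delta sgn p (hankel (w l)))%E,
      (\sum_(l < L) delta sgn p (hankel (w l)) <= delta sgn p H)%E &
      (forall l, Delta sgn p (hankel (w l)) = delta sgn p (hankel (w l))) ->
      Delta sgn p H = delta sgn p H /\
      delta sgn p H = (\sum_(l < L) Delta sgn p (hankel (w l)))%E].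
Proof.
have [upper lower] := signed_asymptotics w_bounded w_disjoint w_symmetric w_compact p_gt0 sgn.
move=> H; split=> // eq_l.
(* The lower limit never exceeds the upper one, so once the two outer sums coincide both are
   squeezed to that value. *)
have dD : (delta sgn p H <= Delta sgn p H)%E by exact: limn_einf_sup.
have eqS : (\sum_(l < L) Delta sgn p (hankel (w l)) =
    \sum_(l < L) delta sgn p (hankel (w l)))%E by apply: eq_bigr => l _; exact: eq_l.
have Sd : (\sum_(l < L) Delta sgn p (hankel (w l)) <= delta sgn p H)%E by rewrite eqS.
by split; apply/eqP; rewrite eq_le; apply/andP; split=> //;
  [exact: le_trans upper Sd|exact: le_trans dD upper].
Qed.
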